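(* Let $F$ be a field of characteristic zero, let $G$ be a finite abelian group, and let $A$ be a $(G,* )$-algebra over $F$ with $\langle n\rangle$-cocharacters $\chi_{\langle n\rangle}(A)=\sum_{\langle\lambda\rangle\vdash\langle n\rangle} m_{\langle\lambda\rangle}\chi_{\langle\lambda\rangle}$. Then $m_{\langle\lambda\rangle}\le 1$ for all $n\ge1$, all compositions $\langle n\rangle$ of $n$ and all multipartitions $\langle\lambda\rangle\vdash\langle n\rangle$ if and only if both of the following hold: (i) for all $g,h\in G$ with $g\ne h$ and for each choice of $x_1\in\{y_1,z_1\}$ and $x_2\in\{y_2,z_2\}$, there is $\alpha_{g,h}\in\{0,1,-1\}$ (possibly depending on the choice) such that $x_{1,g}x_{2,h}+\alpha_{g,h}\,x_{2,h}x_{1,g}\equiv 0$ on $A$; (ii) for all $g\in G$ there is $\beta_g\in\{0,1,-1\}$ such that $y_{1,g}z_{2,g}+\beta_g\,z_{2,g}y_{1,g}\equiv 0$ on $A$.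
   Context: Algebras are associative over $F$ (not necessarily unital). Write $G=\{g_1=1,g_2,\dots,g_k\}$. A $(G,* )$-algebra is a $G$-graded algebra $A=\bigoplus_{g\in G}A^{(g)}$ with a graded involution $*$: a linear map with $(a^* )^*=a$, $(ab)^*=b^*a^*$ and $(A^{(g)})^*=A^{(g)}$ for all $g\in G$. Put $(A^{(g)})^{\pm}=\{a\in A^{(g)}: a^*=\pm a\}$. The free $(G,* )$-algebra is the free associative algebra on variables $y_{i,g}$ (symmetric of degree $g$) and $z_{i,g}$ (skew of degree $g$), $i\ge1$, $g\in G$, with $y_{i,g}^*=y_{i,g}$ and $z_{i,g}^*=-z_{i,g}$. The notation $x_{i,g}$ stands for either $y_{i,g}$ or $z_{i,g}$. A polynomial $f$ is a $(G,* )$-identity of $A$, written $f\equiv0$ on $A$, if it vanishes under every substitution of the variables $y_{i,g}$ by elements of $(A^{(g)})^+$ and of the variables $z_{i,g}$ by elements of $(A^{(g)})^-$; $\mathrm{Id}^{(G,* )}(A)$ is the set of all $(G,* )$-identities of $A$. Multiplicities: for a composition $\langle n\rangle=(n_1,\dots,n_{2k})$ of $n$ into $2k$ non-negative parts, $P_{\langle n\rangle}$ is the space of multilinear $(G,* )$-polynomials in $n$ variables, of which the first $n_1$ are symmetric of degree $g_1=1$, the next $n_2$ skew of degree $g_1$, and so on, with $n_{2i-1}$ symmetric variables of degree $g_i$ followed by $n_{2i}$ skew variables of degree $g_i$. The group $S_{\langle n\rangle}=S_{n_1}\times\cdots\times S_{n_{2k}}$ acts by permuting variables of the same type, and $P_{\langle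 n\rangle}(A)=P_{\langle n\rangle}/(P_{\langle n\rangle}\cap\mathrm{Id}^{(G,* )}(A))$ is an $S_{\langle n\rangle}$-module with character $\chi_{\langle n\rangle}(A)$. A multipartition $\langle\lambda\rangle=(\lambda_1,\dots,\lambda_{2k})\vdash\langle n\rangle$ means $\lambda_i\vdash n_i$ for all $i$; $\chi_{\langle\lambda\rangle}=\chi_{\lambda_1}\otimes\cdots\otimes\chi_{\lambda_{2k}}$, and $m_{\langle\lambda\rangle}$ is its multiplicity in $\chi_{\langle n\rangle}(A)$. *)

(* Defs.v *)
From HB Require Import structures.
From mathcomp Require Import all_boot all_order all_algebra all_fingroup.
From mathcomp Require Import all_solvable all_field all_character.
From mathcomp Require Import finmap monalg.
From Stdlib Require Import Classical ClassicalEpsilon.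

Set Implicit Arguments.
Unset Strict Implicit.
Unset Printing Implicit Defensive.

Import GRing.Theory.
Local Open Scope ring_scope.

Record gstar_algebra (F : fieldType) (gT : finGroupType) := GStarAlgebra {
  gsa_carrier :> lmodType F;
  gsa_mul : gsa_carrier -> gsa_carrier -> gsa_carrier;
  gsa_mulA : forall a b c, gsa_mul a (gsa_mul b c) = gsa_mul (gsa_mul a b) c;
  gsa_mul_linl : forall x a b c,
    gsa_mul (x *: a + b) c = x *: gsa_mul a c + gsa_mul b c;
  gsa_mul_linr : forall x a b c,
    gsa_mul a (x *: b + c) = x *: gsa_mul a b + gsa_mul a c;
  gsa_comp : gT -> gsa_carrier -> Prop;
  gsa_comp0 : forall g, gsa_comp g 0;
  gsa_comp_lin : forall g x a b,
    gsa_comp g a -> gsa_comp g b -> gsa_comp g (x *: a + b);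
  gsa_decomp : forall a, exists c : gT -> gsa_carrier,
    (forall g, gsa_comp g (c g)) /\ a = \sum_(g : gT) c g;
  gsa_direct : forall c : gT -> gsa_carrier,
    (forall g, gsa_comp g (c g)) -> \sum_(g : gT) c g = 0 ->
    forall g, c g = 0;
  gsa_compM : forall g h a b,
    gsa_comp g a -> gsa_comp h b -> gsa_comp (g * h)%g (gsa_mul a b);
  gsa_star : gsa_carrier -> gsa_carrier;
  gsa_star_lin : forall x a b,
    gsa_star (x *: a + b) = x *: gsa_star a + gsa_star b;
  gsa_starK : involutive gsa_star;
  gsa_starM : forall a b,
    gsa_star (gsa_mul a b) = gsa_mul (gsa_star b) (gsa_star a);
  gsa_star_comp : forall g a, gsa_comp g (gsa_star a) <-> gsa_comp g a
}.

(* (A^(g))^+ for e = false and (A^(g))^- for e = true. *)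
Definition homog_part (F : fieldType) (gT : finGroupType)
    (A : gstar_algebra F gT) (g : gT) (e : bool) (a : A) : Prop :=
  gsa_comp g a /\ gsa_star a = (-1) ^+ e *: a.

(* The type of a variable: its degree g and whether it is skew.  The 2k parts
   of a composition <n> are indexed by these types rather than by an
   enumeration of the group. *)
Definition vtype (gT : finGroupType) : finType := (gT * bool)%type.

(* ((g, false), i) is y_{i,g} and ((g, true), i) is z_{i,g}. *)
Definition gvar (gT : finGroupType) : choiceType := (vtype gT * nat)%type.

(* The free unital algebra on the variables; the free algebra with graded
   involution is the subspace of the elements whose constant term is zero. *)
Notation gpoly F gT := {malg F[{fmonom gvar gT}]}.

Definition gX (F : fieldType) (gT : finGroupType) (g : gT) (e : bool)
    (i : nat) : gpoly F gT :=
  (<< fmu (((g, e), i) : gvar gT) >>).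

(* A has no unit: the value on the empty word is a dummy, which is only ever
   multiplied by a zero constant term. *)
Definition word_eval (F : fieldType) (gT : finGroupType)
    (A : gstar_algebra F gT) (v : gvar gT -> A) (w : seq (gvar gT)) : A :=
  if w is x :: w' then foldl (fun a y => gsa_mul a (v y)) (v x) w' else 0.

Definition gpoly_eval (F : fieldType) (gT : finGroupType)
    (A : gstar_algebra F gT) (v : gvar gT -> A)
    (f : gpoly F gT) : A :=
  \sum_(w <- msupp f) f@_w *: word_eval v w.

Definition admissible (F : fieldType) (gT : finGroupType)
    (A : gstar_algebra F gT) (v : gvar gT -> A) : Prop :=
  forall g e i, homog_part g e (v ((g, e), i)).

Definition gstar_identity (F : fieldType) (gT : finGroupType)
    (A : gstar_algebra F gT) (f : gpoly F gT) : Prop :=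
  f@_(@fmone _) = 0 /\
  forall v : gvar gT -> A, admissible v -> gpoly_eval v f = 0.

Section Multilinear.

Variables (F : fieldType) (gT : finGroupType) (nn : vtype gT -> nat).

Definition mvars : seq (gvar gT) :=
  [seq (t, i) | t <- enum (vtype gT), i <- iota 0 (nn t)].

(* P_<n> is represented by its coordinates on the multilinear monomials, the
   words that are permutations of the list of variables. *)
Definition mwords : seq (seq (gvar gT)) := permutations mvars.
Definition mword (i : 'I_(size mwords)) : seq (gvar gT) :=
  tnth (in_tuple mwords) i.

Definition mlpoly (u : 'rV[F]_(size mwords)) : gpoly F gT :=
  \sum_i u 0 i *: (<< FMonom (mword i) >>).

Definition symprod : finGroupType := {dffun forall t : vtype gT, 'S_(nn t)}.

Definition rename (s : symprod) (x : gvar gT) : gvar gT :=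
  (x.1, if insub x.2 is Some j then val (s x.1 j) else x.2).

Definition mlpoly_mx (s : symprod) : 'M[F]_(size mwords) :=
  \matrix_(i, j) (map (rename s) (mword i) == mword j)%:R.

End Multilinear.

Section Young.

Variable n : nat.

(* A partition of n, padded with zeros to length n. *)
Record intpart := IntPart {
  intpart_val : n.-tuple 'I_n.+1;
  _ : sorted geq (map val intpart_val) && (sumn (map val intpart_val) == n)
}.

HB.instance Definition _ := [isSub for intpart_val].
HB.instance Definition _ := [Finite of intpart by <:].

Definition shape_of (la : intpart) : seq nat := map val (intpart_val la).

(* Row and column of the entry i in the tableau of shape la filled row by row
   with 0, ..., n - 1. *)
Definition tab_row (la : intpart) (i : 'I_n) := reshape_index (shape_of la) i.
Definition tab_col (la : intpart) (i : 'I_n) := reshape_offset (shape_of la) i.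

Definition row_stab (la : intpart) : {set 'S_n} :=
  [set s : 'S_n | [forall i, tab_row la (s i) == tab_row la i]].
Definition col_stab (la : intpart) : {set 'S_n} :=
  [set s : 'S_n | [forall i, tab_col la (s i) == tab_col la i]].

Variable F : fieldType.

Definition young_symmetrizer (la : intpart) : 'rV[F]_#|[set: 'S_n]%G| :=
  \sum_(p in row_stab la) \sum_(q in col_stab la)
    (-1) ^+ (q : bool) *: delta_mx 0 (gring_index [set: 'S_n]%G (p * q)%g).

(* The irreducible module attached to la: the right ideal of F[S_n] generated
   by the Young symmetrizer. *)
Definition specht_mx (la : intpart) :=
  cyclic_mx (regular_repr F [set: 'S_n]%G) (young_symmetrizer la).

Definition specht_repr (la : intpart) :=
  submod_repr (cyclic_mx_module (regular_repr F [set: 'S_n]%G)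
                                (young_symmetrizer la)).

Definition sym_char (la : intpart) (s : 'S_n) : F := \tr (specht_repr la s).

End Young.

Definition multipart (gT : finGroupType) (nn : vtype gT -> nat) : finType :=
  {dffun forall t : vtype gT, intpart (nn t)}.

Definition multi_char (F : fieldType) (gT : finGroupType)
    (nn : vtype gT -> nat) (la : multipart nn) (s : symprod nn) : F :=
  \prod_(t : vtype gT) sym_char F (la t) (s t).

Lemma subspace_mx (F : fieldType) (N : nat) (P : 'rV[F]_N -> Prop) :
  P 0 -> (forall a u v, P u -> P v -> P (a *: u + v)) ->
  exists U : 'M[F]_N, forall v : 'rV[F]_N, (v <= U)%MS <-> P v.
Proof.
move=> P0 PD.
pose good (U : 'M[F]_N) := forall v : 'rV[F]_N, (v <= U)%MS -> P v.
suff ext k (U : 'M[F]_N) : good U -> (N - \rank U <= k)%N ->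
    exists V : 'M[F]_N, forall v : 'rV[F]_N, (v <= V)%MS <-> P v.
  by apply: (ext N 0) => [v|]; rewrite ?leq_subr // submx0 => /eqP->.
elim: k U => [|k IHk] U gU leU.
  exists U => v; split=> [/gU //|_]; rewrite submx_full // /row_full.
  by rewrite eqn_leq rank_leq_row -subn_eq0 -leqn0.
have [[v [Pv nU]]|noU] := classic (exists v, P v /\ ~~ (v <= U)%MS); last first.
  exists U => v; split=> [/gU //|Pv].
  by apply/negPn/negP => nU; apply: noU; exists v.
apply: (IHk (U + v)%MS).
  move=> w /sub_addsmxP[[w1 w2] -> /=].
  rewrite addrC [w2]mx11_scalar mul_scalar_mx; apply: PD => //.
  exact/gU/submxMl.
have ltU : (\rank U < \rank (U + v)%MS)%N.
  rewrite ltn_neqAle mxrankS ?addsmxSl // andbT.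
  by rewrite (mxrank_leqif_sup (addsmxSl U v)) addsmx_sub submx_refl.
rewrite -ltnS; apply: leq_trans leU; apply: ltn_sub2l => //.
exact: leq_trans ltU (rank_leq_row _).
Qed.

Section Cocharacter.

Variables (F : fieldType) (gT : finGroupType) (A : gstar_algebra F gT).
Variable nn : vtype gT -> nat.

Local Notation N := (size (mwords nn)).

Lemma gpoly_evalEw (v : gvar gT -> A) (f : gpoly F gT)
    (d : {fset {fmonom gvar gT}}) : (msupp f `<=` d)%fset ->
  gpoly_eval v f = \sum_(w <- d) f@_w *: word_eval v w.
Proof.
move=> le_fd; apply: big_fset_incl => // w _ /mcoeff_outdom ->.
by rewrite scale0r.
Qed.

Lemma gpoly_eval_is_linear (v : gvar gT -> A) : linear (gpoly_eval v).
Proof.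
move=> a f h; pose d := (msupp f `|` msupp h `|` msupp (a *: f + h))%fset.
have s1 : (msupp f `<=` d)%fset by rewrite /d -fsetUA fsubsetUl.
have s2 : (msupp h `<=` d)%fset.
  by rewrite /d [(msupp f `|` _)%fset]fsetUC -fsetUA fsubsetUl.
have s3 : (msupp (a *: f + h) `<=` d)%fset by rewrite /d fsubsetUr.
rewrite (gpoly_evalEw v s1) (gpoly_evalEw v s2) (gpoly_evalEw v s3).
rewrite scaler_sumr -big_split /=; apply: eq_bigr => w _.
by rewrite mcoeffD mcoeffZ scalerDl scalerA.
Qed.

HB.instance Definition _ v :=
  GRing.isLinear.Build F (gpoly F gT) A _ (gpoly_eval v)
    (gpoly_eval_is_linear v).

Lemma mlpoly_is_linear : linear (@mlpoly F gT nn).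
Proof.
move=> a u v; rewrite /mlpoly scaler_sumr -big_split /=.
by apply: eq_bigr => i _; rewrite !mxE scalerDl scalerA.
Qed.

HB.instance Definition _ :=
  GRing.isLinear.Build F 'rV[F]_N (gpoly F gT) _
    (@mlpoly F gT nn) mlpoly_is_linear.

Lemma gpoly_eval_mlpoly (v : gvar gT -> A) (u : 'rV[F]_N) :
  gpoly_eval v (mlpoly u) = \sum_i u 0 i *: word_eval v (mword i).
Proof.
rewrite [mlpoly u]/mlpoly linear_sum /=; apply: eq_bigr => i _.
rewrite linearZ /=; congr (_ *: _).
have s : (msupp (<< FMonom (mword i) >> : gpoly F gT)
           `<=` [fset FMonom (mword i)])%fset by exact: msuppU_le.
by rewrite (gpoly_evalEw v s) big_seq_fset1 mcoeffUU scale1r.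
Qed.

Lemma mem_mvars (x : gvar gT) : (x \in mvars nn) = (x.2 < nn x.1)%N.
Proof.
apply/allpairsPdep/idP => [[t [i [_ + ->]]]|lti]; first by rewrite mem_iota.
by exists x.1, x.2; rewrite mem_enum mem_iota; split=> //; case: x {lti}.
Qed.

Lemma mvars_uniq : uniq (mvars nn).
Proof.
apply: allpairs_uniq_dep => [|t _|]; rewrite ?enum_uniq ?iota_uniq //.
by move=> [t i] [t' i'] _ _ /= [-> ->].
Qed.

Lemma rename1 (x : gvar gT) : rename (1%g : symprod nn) x = x.
Proof.
case: x => t i; rewrite /rename /=; congr (_, _).
by case: insubP => // j _ <-; rewrite ffunE perm1.
Qed.

Lemma renameM (s r : symprod nn) (x : gvar gT) :
  rename (s * r)%g x = rename r (rename s x).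
Proof.
case: x => t i; rewrite /rename /=; congr (_, _).
case: insubP => [j _ ej|ni]; first by rewrite valK ffunE permM.
by rewrite insubN.
Qed.

Lemma rename_inj (s : symprod nn) : injective (rename s).
Proof.
by apply: (can_inj (g := rename (s^-1)%g)) => x; rewrite -renameM mulgV rename1.
Qed.

Lemma mwords_rename (s : symprod nn) (w : seq (gvar gT)) :
  w \in mwords nn -> map (rename s) w \in mwords nn.
Proof.
rewrite /mwords !mem_permutations => pw.
apply: perm_trans (perm_map _ pw) _.
apply: uniq_perm; rewrite ?mvars_uniq // ?(map_inj_uniq (@rename_inj s)) //
  ?mvars_uniq //.
have sub (r : symprod nn) : {subset map (rename r) (mvars nn) <= mvars nn}.
  move=> x /mapP[[t i]]; rewrite mem_mvars /= => lti ->.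
  by rewrite mem_mvars /rename /= insubT /=.
move=> x; apply/idP/idP => [/sub //|mx]; apply/mapP.
exists (rename (s^-1)%g x); last by rewrite -renameM mulVg rename1.
by apply: (sub (s^-1)%g); apply: map_f.
Qed.

Lemma mword_in (i : 'I_N) : mword i \in mwords nn.
Proof. exact: mem_tnth. Qed.

Lemma mword_inj : injective (@mword gT nn).
Proof.
move=> i j /eqP; rewrite /mword !(tnth_nth [::]) /= nth_uniq //.
  by move/eqP/val_inj.
exact: permutations_uniq.
Qed.

Lemma mwordP (w : seq (gvar gT)) :
  w \in mwords nn -> {i : 'I_N | mword i = w}.
Proof.
move=> mw; have lt : (index w (mwords nn) < N)%N by rewrite index_mem.
by exists (Ordinal lt); rewrite /mword (tnth_nth [::]) /= nth_index.
Qed.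

Lemma mlpoly_mx_repr : mx_repr [set: symprod nn] (@mlpoly_mx F gT nn).
Proof.
split=> [|s r _ _]; apply/matrixP=> i j; rewrite !mxE.
  rewrite (eq_map rename1) map_id; congr (_%:R); congr (nat_of_bool _).
  by apply/eqP/eqP => [/mword_inj|->].
have [k ek] := mwordP (mwords_rename s (mword_in i)).
rewrite (bigD1 k) //= !mxE ek eqxx mul1r big1 ?addr0 => [|l nkl].
  by rewrite -map_comp (eq_map (renameM s r)).
rewrite !mxE -ek; case: eqP => [/mword_inj kl|]; last by rewrite mul0r.
by rewrite kl eqxx in nkl.
Qed.

Definition mlpoly_repr := MxRepresentation mlpoly_mx_repr.

Lemma mlpoly_identity_lin a (u v : 'rV[F]_N) :
  gstar_identity A (mlpoly u) -> gstar_identity A (mlpoly v) ->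
  gstar_identity A (mlpoly (a *: u + v)).
Proof.
move=> [u0 uI] [v0 vI]; rewrite linearP /=; split=> [|w aw].
  by rewrite mcoeffD mcoeffZ u0 v0 mulr0 addr0.
by rewrite linearP /= uI // vI // scaler0 addr0.
Qed.

Lemma mlpoly_identity0 : gstar_identity A (mlpoly (0 : 'rV[F]_N)).
Proof.
by rewrite linear0; split=> [|w _]; rewrite ?mcoeff0 // linear0.
Qed.

Lemma mlidentities_exist : exists U : 'M[F]_N,
  forall u : 'rV[F]_N, (u <= U)%MS <-> gstar_identity A (mlpoly u).
Proof.
by apply: subspace_mx; [exact: mlpoly_identity0 | exact: mlpoly_identity_lin].
Qed.

(* P_<n> :&: Id(A), as a row space. *)
Definition mlidentities : 'M[F]_N :=
  proj1_sig (constructive_indefinite_description _ mlidentities_exist).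

Lemma mlidentitiesP (u : 'rV[F]_N) :
  (u <= mlidentities)%MS <-> gstar_identity A (mlpoly u).
Proof.
exact: (proj2_sig (constructive_indefinite_description _ mlidentities_exist)).
Qed.

Lemma word_eval_map (v : gvar gT -> A) (f : gvar gT -> gvar gT) w :
  word_eval v (map f w) = word_eval (v \o f) w.
Proof.
by case: w => //= x w; elim: w (v (f x)) => //= y w IHw a; rewrite IHw.
Qed.

Lemma mlpoly_coef1 (u : 'rV[F]_N) : (mlpoly u)@_(@fmone _) =
  \sum_i u 0 i * (mword i == [::])%:R.
Proof.
rewrite /mlpoly raddf_sum /=; apply: eq_bigr => i _.
by rewrite mcoeffZ mcoeffU fmP fm1 /=; case: eqP.
Qed.

Lemma sum_mlpoly_mx (V : lmodType F) (s : symprod nn) (u : 'rV[F]_N)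
    (f : seq (gvar gT) -> V) :
  \sum_j (u *m mlpoly_mx F s) 0 j *: f (mword j)
    = \sum_i u 0 i *: f (map (rename s) (mword i)).
Proof.
under eq_bigr do rewrite mxE scaler_suml.
rewrite exchange_big /=; apply: eq_bigr => i _.
have [k ek] := mwordP (mwords_rename s (mword_in i)).
rewrite (bigD1 k) //= !mxE ek eqxx mulr1 big1 ?addr0 // => l nkl.
rewrite !mxE -ek; case: eqP => [/mword_inj kl|]; last by rewrite mulr0 scale0r.
by rewrite kl eqxx in nkl.
Qed.

Lemma mlidentities_module : mxmodule mlpoly_repr mlidentities.
Proof.
apply/mxmoduleP => s _; apply/row_subP => i; rewrite row_mul.
have : (row i mlidentities <= mlidentities)%MS by exact: row_sub.
move/mlidentitiesP; move: (row i mlidentities) => u [u1 uI].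
apply/mlidentitiesP; split=> [|v av].
  rewrite -[RHS]u1 !mlpoly_coef1.
  rewrite (sum_mlpoly_mx s u (fun w => (w == [::])%:R : F^o)).
  by apply: eq_bigr => j _; congr (_ * _%:R); case: (mword j).
rewrite gpoly_eval_mlpoly (sum_mlpoly_mx s u (word_eval v)).
under eq_bigr do rewrite word_eval_map.
rewrite -gpoly_eval_mlpoly; apply: uI => g e j.
exact: av.
Qed.

(* The quotient module P_<n>(A) and its character. *)
Definition mlquotient_repr := factmod_repr mlidentities_module.

Definition cocharacter (s : symprod nn) : F := \tr (mlquotient_repr s).

End Cocharacter.

(* Main.v *)
(* For a partition, let e' be the column antisymmetrizer times the row
   symmetrizer, and for a multipartition the product of these elements over the
   types of variables.  The trace of a quasi-idempotent is its eigenvalue times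
   its rank, so the multiplicity of <lambda> is at most the rank of e' on
   P_<n>(A).

   Under (i) and (ii), elements of two different parts (A^(g))^+- commute up to a
   sign depending only on the parts.  So every word is, up to sign, a product of
   words in variables of a single type, and it remains to see that e' maps the
   words in elements of one part to a line.  For a, b in one part, ab + ba and
   ab - ba lie in the parts of degree g^2; when these commute up to sign with
   a and b, the words form a quotient of F[S_n] f for an idempotent f fixed by
   inversion, with f s f = f s^-1 f for all permutations s, so that f F[S_n] f is
   commutative (Gelfand's trick) and f F[S_n] e' is a line.  The remaining case
   is that of skew elements of degree 1 all commuting with the symmetric ones:
   there antisymmetrization kills columns of length at least 4 and merges columns
   of length 3 into central triple products and columns of length 2 into
   commutators, and the letters that are left commute up to sign once the rows
   are symmetrized.

   Conversely, when P_<n>(A) has dimension at most 1 for two variables of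
   different types, p ab + q ba = 0 on A for some (p, q) <> 0; applying the
   involution exchanges p and q, so ab = ba or ab = - ba. *)

From HB Require Import structures.
From mathcomp Require Import all_boot all_order all_algebra all_fingroup.
From mathcomp Require Import all_solvable all_character.
From mathcomp Require Import finmap monalg ring zify.
From Stdlib Require Import Classical.
From Stdlib Require Ncring Ncring_tac.
Require Import Defs.

Set Implicit Arguments.
Unset Strict Implicit.
Unset Printing Implicit Defensive.

Import GRing.Theory.
Local Open Scope ring_scope.

(** The order of the two factors of e' matters: the left factor acts on a word first, so column
    signs can be used to rewrite words by identities of A while the row symmetrization is still
    pending and can then reorder the letters. A nonzero multiple of the Young symmetrizer factors
    through e', so passing to e' does not lower the bound on multiplicities.

    The obstacle is that (i) and (ii) say nothing about two elements of the same part. If g is not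
    1, then g^2 differs from g, so ab + ba and ab - ba lie outside the part of a and b, and their
    signs come from the hypotheses. If g = 1, one of the two falls back into that part. When
    symmetric and skew elements anticommute, a ring identity supplies the missing sign; when they
    commute, the involution gives more for symmetric letters, but for skew letters no sign rule for
    reordering a word is at hand. There the tableau itself has to guide the rewriting, column by
    column.

    All products are taken in the unitization, where empty words and blocks have the value 1. *)

(** * Characteristic zero and traces of quasi-idempotents *)

Lemma natr_charf0_inj (F : fieldType) (charF0 : [pchar F] =i pred0) (a b : nat) :
  a%:R = b%:R :> F -> a = b.
Proof.
wlog ab : a b / (a <= b)%N => [H|].
  have [ab|/ltnW ba /esym] := leqP a b; first exact: H.
  by move/(H _ _ ba).
move/eqP; rewrite eq_sym -subr_eq0 -natrB //; have /pcharf0P-> := charF0.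
by rewrite subn_eq0 => ba; apply/eqP; rewrite eqn_leq ab.
Qed.

Lemma mulrn_charf0_inj (F : fieldType) (charF0 : [pchar F] =i pred0)
    (V : lmodType F) (m : nat) (a b : V) :
  (0 < m)%N -> a *+ m = b *+ m -> a = b.
Proof.
move=> m_gt0; rewrite -!scaler_nat; apply: scalerI.
by have /pcharf0P-> := charF0; rewrite -lt0n.
Qed.

Lemma eq_opp_charf0 (F : fieldType) (charF0 : [pchar F] =i pred0)
    (V : lmodType F) (a : V) : a = - a -> a = 0.
Proof.
move=> aN; apply: (mulrn_charf0_inj charF0 (m := 2)) => //.
by rewrite mulr2n {2}aN subrr mul0rn.
Qed.

(** Factor M = K H with K of full column rank and H of full row rank. Cancelling K and H in M M = c
    M leaves H K = c I, and H K has the trace of M. *)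
Lemma tr_quasi_idempotent (F : fieldType) n (M : 'M[F]_n) (c : F) :
  M *m M = c *: M -> \tr M = c * (\rank M)%:R.
Proof.
have key r (K : 'M[F]_(n, r)) (H R' : 'M_(r, n)) (L' : 'M_(n, r)) :
    K *m H = M -> R' *m K = 1%:M -> H *m L' = 1%:M ->
    M *m M = c *: M -> \tr M = c * r%:R.
  move=> <- RK HL MM; have HK : H *m K = c%:M.
    transitivity (R' *m (K *m H *m (K *m H)) *m L').
      by rewrite -!mulmxA HL mulmx1 [RHS]mulmxA RK mul1mx.
    by rewrite MM -scalemxAr -scalemxAl mulmxA RK mul1mx HL scalemx1.
  by rewrite mxtrace_mulC HK mxtrace_scalar mulr_natr.
have [L' HL] := row_freeP (row_base_free M).
have [R' RK] := row_fullP (col_base_full M).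
exact: key (mulmx_base M) RK HL.
Qed.

(** * Group algebras *)

(** The group algebra as functions under convolution, so that the symmetric trace form is evaluation
    of a product at 1. *)
Definition galg (F : fieldType) (gT : finGroupType) := {ffun gT -> F^o}.

HB.instance Definition _ F gT := GRing.Lmodule.on (galg F gT).

Section GroupAlgebra.

Variables (F : fieldType) (gT : finGroupType).
Implicit Types (a b c : galg F gT) (g h : gT).

Definition gunit g : galg F gT := [ffun h => (h == g)%:R].

Definition gconv a b : galg F gT :=
  [ffun g => \sum_h a h * b (h^-1 * g)%g].

Fact gconvA : associative gconv.
Proof.
move=> a b c; apply/ffunP=> g; rewrite !ffunE.
under eq_bigr => h _ do rewrite ffunE mulr_sumr.
rewrite exchange_big /=.
under [RHS]eq_bigr => h _ do rewrite ffunE mulr_suml.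
rewrite [RHS]exchange_big /= exchange_big; apply: eq_bigr => h _ /=.
rewrite [RHS](reindex_inj (mulgI h)) /=; apply: eq_bigr => k _.
by rewrite mulKg invMg !mulgA mulrA.
Qed.

Fact gconv1l : left_id (gunit 1%g) gconv.
Proof.
move=> a; apply/ffunP=> g; rewrite !ffunE (bigD1 1%g) //= ffunE eqxx mul1r.
rewrite invg1 mul1g big1 ?addr0 // => h /negPf nh.
by rewrite ffunE nh mul0r.
Qed.

Fact gconv1r : right_id (gunit 1%g) gconv.
Proof.
move=> a; apply/ffunP=> g; rewrite !ffunE (bigD1 g) //= ffunE mulVg eqxx mulr1.
rewrite big1 ?addr0 // => h nh; rewrite ffunE; case: eqP; last by rewrite mulr0.
by move/(canRL (mulKVg _)) => eg; rewrite eg mulg1 eqxx in nh.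
Qed.

Fact gconvDl : left_distributive gconv +%R.
Proof.
move=> a b c; apply/ffunP=> g; rewrite !ffunE -big_split /=.
by apply: eq_bigr => h _; rewrite ffunE mulrDl.
Qed.

Fact gconvDr : right_distributive gconv +%R.
Proof.
move=> a b c; apply/ffunP=> g; rewrite !ffunE -big_split /=.
by apply: eq_bigr => h _; rewrite ffunE mulrDr.
Qed.

Fact gunit_neq0 : gunit 1%g != 0.
Proof.
by apply/eqP=> /ffunP/(_ 1%g)/eqP; rewrite !ffunE eqxx oner_eq0.
Qed.

HB.instance Definition _ := GRing.Zmodule_isNzRing.Build (galg F gT)
  gconvA gconv1l gconv1r gconvDl gconvDr gunit_neq0.

Fact gscaleAl (k : F) a b : k *: (a * b) = (k *: a) * b.
Proof.
apply/ffunP=> g; rewrite !ffunE scaler_sumr; apply: eq_bigr => h _.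
by rewrite ffunE scalerAl.
Qed.

HB.instance Definition _ := GRing.Lmodule_isLalgebra.Build F (galg F gT)
  gscaleAl.

Fact gscaleAr (k : F) a b : k *: (a * b) = a * (k *: b).
Proof.
apply/ffunP=> g; rewrite !ffunE scaler_sumr; apply: eq_bigr => h _.
by rewrite ffunE scalerAr.
Qed.

HB.instance Definition _ := GRing.Lalgebra_isAlgebra.Build F (galg F gT)
  gscaleAr.

Lemma galgM a b g : (a * b) g = \sum_h a h * b (h^-1 * g)%g.
Proof. exact: ffunE. Qed.

Lemma gunit1 : gunit 1%g = 1. Proof. by []. Qed.

Lemma gunitMl g a h : (gunit g * a) h = a (g^-1 * h)%g.
Proof.
rewrite galgM (bigD1 g) //= ffunE eqxx mul1r big1 ?addr0 // => k /negPf nk.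
by rewrite ffunE nk mul0r.
Qed.

Lemma gunitM g h : gunit (g * h)%g = gunit g * gunit h.
Proof.
apply/ffunP=> k; rewrite gunitMl !ffunE; congr (_%:R); congr (nat_of_bool _).
by apply/eqP/eqP => [->|<-]; rewrite ?mulKg ?mulKVg.
Qed.

Lemma galgE a : a = \sum_g a g *: gunit g.
Proof.
apply/ffunP=> g; rewrite sum_ffunE (bigD1 g) //= !ffunE eqxx big1 ?addr0.
  by rewrite [RHS]mulr1.
by move=> h nh; rewrite !ffunE eq_sym (negPf nh) [LHS]mulr0.
Qed.

Lemma galg_coef1M a b : (a * b) 1%g = (b * a) 1%g.
Proof.
rewrite !galgM (reindex_inj invg_inj) /=; apply: eq_bigr => h _.
by rewrite mulrC invgK !mulg1.
Qed.

(** The anti-automorphism on which Gelfand's trick rests. *)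
Definition ginv a : galg F gT := [ffun g => a g^-1%g].

Lemma ginvM a b : ginv (a * b) = ginv b * ginv a.
Proof.
apply/ffunP=> g; rewrite ffunE !galgM (reindex_inj (mulgI (g^-1)%g)) /=.
by apply: eq_bigr => h _; rewrite !ffunE !invMg !invgK mulrC mulgK.
Qed.

Lemma ginvK : involutive ginv.
Proof. by move=> a; apply/ffunP=> g; rewrite !ffunE invgK. Qed.

Lemma ginvZ k a : ginv (k *: a) = k *: ginv a.
Proof. by apply/ffunP=> g; rewrite !ffunE. Qed.

Lemma ginvD a b : ginv (a + b) = ginv a + ginv b.
Proof. by apply/ffunP=> g; rewrite !ffunE. Qed.

Lemma ginv_gunit g : ginv (gunit g) = gunit g^-1%g.
Proof.
apply/ffunP=> h; rewrite !ffunE; congr (_%:R); congr (nat_of_bool _).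
by apply/eqP/eqP => [<-|->]; rewrite invgK.
Qed.

Lemma ginv_sum (I : Type) (r : seq I) (P : pred I) (f : I -> galg F gT) :
  ginv (\sum_(i <- r | P i) f i) = \sum_(i <- r | P i) ginv (f i).
Proof.
elim/big_ind2: _ => //; first by apply/ffunP=> g; rewrite !ffunE.
by move=> ? a ? b <- <-; rewrite ginvD.
Qed.

End GroupAlgebra.

Arguments gunit F {gT}.

Section GroupAlgebraRepr.

Variables (F : fieldType) (gT : finGroupType) (n : nat).
Variable rG : mx_representation F [set: gT] n.

Definition galg_mx (a : galg F gT) : 'M[F]_n := \sum_g a g *: rG g.

Lemma galg_mxM a b : galg_mx (a * b) = galg_mx a *m galg_mx b.
Proof.
rewrite /galg_mx mulmx_suml.
under [RHS]eq_bigr => h _ do rewrite mulmx_sumr.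
under [LHS]eq_bigr => g _ do rewrite galgM scaler_suml.
rewrite exchange_big; apply: eq_bigr => h _ /=.
rewrite (reindex_inj (mulgI h)) /=; apply: eq_bigr => k _.
by rewrite mulKg repr_mxM ?inE // -scalemxAl -scalemxAr scalerA.
Qed.

Lemma galg_mxZ k a : galg_mx (k *: a) = k *: galg_mx a.
Proof.
rewrite /galg_mx scaler_sumr; apply: eq_bigr => g _.
by rewrite ffunE scalerA.
Qed.

Lemma tr_galg_mx a : \tr (galg_mx a) = \sum_g a g * \tr (rG g).
Proof.
by rewrite /galg_mx raddf_sum /=; apply: eq_bigr => g _; rewrite mxtraceZ.
Qed.

End GroupAlgebraRepr.

(** * Young symmetrizers *)

(** The Young subgroup of the level sets of f. It serves for rows and columns of a tableau, for
    parity classes and for initial segments. *)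
Definition fun_stab n (f : 'I_n -> nat) : {set 'S_n} :=
  [set s : 'S_n | [forall i, f (s i) == f i]].

Lemma fun_stabP n (f : 'I_n -> nat) (s : 'S_n) :
  reflect (forall i, f (s i) = f i) (s \in fun_stab f).
Proof. by rewrite inE; apply: eqfunP. Qed.

Lemma fun_stab_group_set n (f : 'I_n -> nat) : group_set (fun_stab f).
Proof.
apply/group_setP; split=> [|s r /fun_stabP fs /fun_stabP fr].
  by apply/fun_stabP=> i; rewrite perm1.
by apply/fun_stabP=> i; rewrite permM fr fs.
Qed.

Canonical fun_stab_group n (f : 'I_n -> nat) := Group (fun_stab_group_set f).

Lemma tperm_fun_stab n (f : 'I_n -> nat) i j :
  f i = f j -> tperm i j \in fun_stab f.
Proof. by move=> fij; apply/fun_stabP=> k; case: tpermP => // ->. Qed.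

Section Tableau.

Variables (n : nat) (row col : 'I_n -> nat).
Hypothesis row_col_inj : forall i j, row i = row j -> col i = col j -> i = j.
Hypothesis col_down : forall i r, (r <= row i)%N ->
  exists2 j, row j = r & col j = col i.

Section Count.

Variable s : 'S_n.
Hypothesis s_good : forall i j, row i = row j -> col (s i) = col (s j) -> i = j.

Let A k c := #|[set i | (col (s i) == c) && (row i < k)%N]|.
Let B k c := #|[set i | (col i == c) && (row i < k)%N]|.

(** [A] counts the entries of the first k rows that s sends into column c, [B] the cells of column c
    in these rows. If column c reaches row k, it meets every earlier row, and the entries counted by
    [A] lie in distinct rows; sending each to the cell of its row is injective. Otherwise [B] counts
    the whole column and s itself is the injection. *)
Lemma tab_count_leq k c : (A k c <= B k c)%N.
Proof.
have [/existsP[j /andP[/eqP jc kj]]|] :=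
    boolP [exists j, (col j == c) && (k <= row j)%N]; last first.
  rewrite negb_exists => /forallP noj; rewrite /A -(card_imset _ (@perm_inj _ s)).
  apply/subset_leq_card/subsetP=> j /imsetP[i]; rewrite inE => /andP[ic _] ->.
  by rewrite inE ic ltnNge; move: (noj (s i)); rewrite ic.
pose f i := odflt i [pick l | (col l == c) && (row l == row i)].
have fP i : (row i < k)%N -> col (f i) = c /\ row (f i) = row i.
  move=> ik; rewrite /f; case: pickP => [l /andP[/eqP ? /eqP ?] //|no].
  have [l li lj] := col_down (leq_trans (ltnW ik) kj).
  by move/(_ l): no; rewrite lj li jc !eqxx.
rewrite /A -(@card_in_imset _ _ f) => [|i i']; last first.
  rewrite !inE => /andP[/eqP ic ik] /andP[/eqP ic' ik'] ff.
  by apply: s_good; rewrite ?ic ?ic' // -(fP i ik).2 ff (fP i' ik').2.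
apply/subset_leq_card/subsetP=> l /imsetP[i]; rewrite !inE.
by move=> /andP[_ ik] ->; have [-> ->] := fP i ik; rewrite eqxx.
Qed.

(** Summed over the columns, both sides count the entries of the first k rows, so no inequality is
    strict. The bound M makes the sum finite. *)
Lemma tab_count_eq k c : A k c = B k c.
Proof.
pose M := (\max_i col i).+1.
have leM i : (col i < M)%N by rewrite ltnS; apply: leq_bigmax.
have part (h : 'I_n -> 'I_M) :
    (\sum_(c < M) #|[set i | (h i == c) && (row i < k)%N]|
      = #|[set i | (row i < k)%N]|)%N.
  rewrite -[RHS]sum1_card (partition_big h xpredT) //=; apply: eq_bigr => d _.
  by rewrite -sum1_card; apply: eq_bigl => i; rewrite !inE andbC.
have eA (d : 'I_M) : A k d = #|[set i |
    (Ordinal (leM (s i)) == d) && (row i < k)%N]|.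
  by apply: eq_card => i; rewrite !inE.
have eB (d : 'I_M) : B k d = #|[set i |
    (Ordinal (leM i) == d) && (row i < k)%N]|.
  by apply: eq_card => i; rewrite !inE.
have [ltc|gec] := ltnP c M; last first.
  have no i : (col i == c) = false.
    by apply/eqP=> ic; move: (leM i); rewrite ic ltnNge gec.
  by rewrite /A /B !eq_card0 // => i; rewrite !inE no.
have := leqif_sum (fun (d : 'I_M) (_ : true) => leqif_eq (tab_count_leq k d)).
case=> _; under eq_bigr do rewrite eA; under [X in _ == X]eq_bigr do rewrite eB.
rewrite !part eqxx => /esym/forallP/(_ (Ordinal ltc)).
by rewrite implyTb => /eqP.
Qed.

(** Entry i makes [A] grow when its row is added to the count; hence [B] grows as well, and the new
    cell lies in row i. *)
Lemma tab_cell_exists i : exists2 j, row j = row i & col j = col (s i).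
Proof.
have ltA : (A (row i) (col (s i)) < A (row i).+1 (col (s i)))%N.
  apply: proper_card; apply/properP; split.
    by apply/subsetP=> j; rewrite !inE => /andP[-> /ltnW].
  by exists i; rewrite !inE eqxx ?ltnSn // ltnn.
have /subsetPn[j] : ~~ ([set j | (col j == col (s i)) && (row j < (row i).+1)%N]
    \subset [set j | (col j == col (s i)) && (row j < row i)%N]).
  apply: contraL ltA => /subset_leq_card; rewrite -leqNgt.
  by rewrite !tab_count_eq.
rewrite !inE => /andP[/eqP jc lej]; rewrite jc eqxx -leqNgt => gej.
by exists j => //; apply/eqP; rewrite eqn_leq gej andbT.
Qed.

(** Let p move i within its row to the cell in column [col (s i)]; then p^-1 s preserves columns. *)
Lemma good_perm_factor :
  exists p q, [/\ p \in fun_stab row, q \in fun_stab col & s = (p * q)%g].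
Proof.
pose f i := odflt i [pick j | (row j == row i) && (col j == col (s i))].
have fP i : row (f i) = row i /\ col (f i) = col (s i).
  rewrite /f; case: pickP => [j /andP[/eqP-> /eqP->] //|no].
  have [j ji jc] := tab_cell_exists i.
  by move/(_ j): no; rewrite ji jc !eqxx.
have f_inj : injective f.
  move=> i j ff; have [ri ci] := fP i; have [rj cj] := fP j.
  by apply: s_good; [rewrite -ri ff rj | rewrite -ci ff cj].
exists (perm f_inj), ((perm f_inj)^-1 * s)%g; split; last by rewrite mulKVg.
  by apply/fun_stabP=> i; rewrite permE (fP i).1.
apply/fun_stabP=> i; rewrite permM -(fP _).2 -(permE f_inj).
by rewrite permKV.
Qed.

End Count.

Variable F : fieldType.
Hypothesis charF0 : [pchar F] =i pred0.

Let R := fun_stab row.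
Let C := fun_stab col.

Definition row_sym : galg F 'S_n := \sum_(p in R) gunit F p.
Definition col_alt : galg F 'S_n := \sum_(q in C) (-1) ^+ (q : bool) *: gunit F q.
Definition young : galg F 'S_n := row_sym * col_alt.

Lemma row_symMr p : p \in R -> row_sym * gunit F p = row_sym.
Proof.
move=> Rp; rewrite [RHS](reindex_inj (mulIg p)) /= mulr_suml.
by apply: eq_big => [r|r _]; rewrite ?gunitM // groupMr.
Qed.

Lemma row_symMl p : p \in R -> gunit F p * row_sym = row_sym.
Proof.
move=> Rp; rewrite [RHS](reindex_inj (mulgI p)) /= mulr_sumr.
by apply: eq_big => [r|r _]; rewrite ?gunitM // groupMl.
Qed.

Lemma col_altMl q : q \in C -> gunit F q * col_alt = (-1) ^+ (q : bool) *: col_alt.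
Proof.
move=> Cq; rewrite [in RHS]/col_alt (reindex_inj (mulgI q)) /= mulr_sumr.
rewrite scaler_sumr; apply: eq_big => [r|r _]; first by rewrite groupMl.
rewrite -scalerAr -gunitM scalerA odd_permM; congr (_ *: _).
by case: (odd_perm q); case: (odd_perm r); rewrite /= ?mulrNN ?mulr1 ?mul1r.
Qed.

(** Von Neumann's dichotomy: either s is a row permutation times a column permutation, or two
    entries of a row are sent to one column; then their transposition is absorbed with sign 1 on the
    left of s and with sign -1 on its right. *)
Lemma row_sym_col_alt s :
  exists k, row_sym * gunit F s * col_alt = k *: young.
Proof.
have [/existsP[i /existsP[j /and3P[nij /eqP rij /eqP cij]]]|] :=
  boolP [exists i, exists j, [&& i != j, row i == row j & col (s i) == col (s j)]].
  exists 0; rewrite scale0r; apply: (eq_opp_charf0 charF0).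
  rewrite -{1}(row_symMr (tperm_fun_stab rij)) -(mulrA row_sym) -gunitM.
  rewrite -(mulKVg s (tperm i j * s)%g) -conjgE tpermJ.
  rewrite gunitM mulrA -mulrA col_altMl ?tperm_fun_stab //.
  by rewrite odd_tperm (inj_eq perm_inj) nij scaleN1r mulrN.
move=> noij; have good i j : row i = row j -> col (s i) = col (s j) -> i = j.
  move=> rij cij; apply/eqP; apply: contraNT noij => nij.
  by apply/existsP; exists i; apply/existsP; exists j; rewrite nij rij cij !eqxx.
have [p [q [Rp Cq ->]]] := good_perm_factor good.
exists ((-1) ^+ (q : bool)).
by rewrite gunitM mulrA row_symMr // -mulrA col_altMl // -scalerAr.
Qed.

Lemma row_sym_mul_col_alt x : exists k, row_sym * x * col_alt = k *: young.
Proof.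
rewrite [x]galgE; elim/big_rec: (\sum_g x g *: _) => [|s y _ [k ek]].
  by exists 0; rewrite scale0r mulr0 mul0r.
have [l el] := row_sym_col_alt s; exists (x s * l + k).
by rewrite mulrDr mulrDl ek -scalerAr -scalerAl el scalerA scalerDl.
Qed.

Lemma young_mul x : exists k, young * x * young = k *: young.
Proof.
have [k ek] := row_sym_mul_col_alt (col_alt * x * row_sym).
by exists k; rewrite -ek /young !mulrA.
Qed.

Lemma young_coef1 : young 1%g = 1.
Proof.
rewrite galgM (bigD1 1%g) //= invg1 mulg1.
have rE p : row_sym p = (p \in R)%:R.
  rewrite /row_sym sum_ffunE; have [Rp|nRp] := boolP (p \in R).
    rewrite (bigD1 p) //= !ffunE eqxx big1 ?addr0 // => r /andP[_ nr].
    by rewrite ffunE eq_sym (negPf nr).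
  rewrite big1 // => r Rr; rewrite ffunE; case: eqP => // er.
  by rewrite er Rr in nRp.
have cE q : col_alt q = (-1) ^+ (q : bool) * (q \in C)%:R.
  rewrite /col_alt sum_ffunE; have [Cq|nCq] := boolP (q \in C).
    rewrite (bigD1 q) //= !ffunE eqxx big1 ?addr0 // => r /andP[_ nr].
    by rewrite !ffunE eq_sym (negPf nr) [LHS]mulr0.
  rewrite big1 ?mulr0 // => r Cr; rewrite !ffunE; case: eqP => [er|_].
    by rewrite er Cr in nCq.
  exact: mulr0.
rewrite rE cE !group1 odd_perm1 mulr1 mul1r big1 ?addr0 // => p np.
rewrite rE cE mulg1 groupV; case: (boolP (p \in R)) => [Rp|]; last by rewrite mul0r.
case: (boolP (p \in C)) => [Cp|]; last by rewrite !mulr0.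
case/eqP: np; apply/permP=> i; rewrite perm1.
by apply: row_col_inj; [move/fun_stabP: Rp | move/fun_stabP: Cp].
Qed.

(** Right multiplication by [young] on the group algebra has trace n! times the coefficient at 1,
    that is n!. It is also k times a rank, so k is not 0. *)
Lemma young_sqr : exists2 k, k != 0 & young * young = k *: young.
Proof.
have [k] := young_mul 1; rewrite mulr1 => ek; exists k => //.
pose M := galg_mx (regular_repr F [set: 'S_n]) young.
have : \tr M = k * (\rank M)%:R.
  by apply: tr_quasi_idempotent; rewrite -galg_mxM ek galg_mxZ.
rewrite tr_galg_mx (bigD1 1%g) //= young_coef1 repr_mx1 mxtrace1 mul1r.
rewrite big1 ?addr0 => [trE|s ns]; last first.
  rewrite [\tr _]big1 ?mulr0 // => i _; rewrite !mxE.
  rewrite eqxx /=; case: eqP => //.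
  move/(congr1 (@enum_val _ _)); rewrite gring_indexK ?inE //.
  move/esym/eqP; rewrite -{2}[enum_val i]mulg1 (inj_eq (mulgI _)).
  by rewrite (negPf ns).
apply: contra_eq_neq trE => ->; rewrite mul0r.
have /pcharf0P-> := charF0.
by rewrite -lt0n cardG_gt0.
Qed.

End Tableau.

Section Shape.

Variables (n : nat) (la : intpart n).

Lemma shape_sorted : sorted geq (shape_of la).
Proof. by have /andP[] := valP la. Qed.

Lemma shape_sumn : sumn (shape_of la) = n.
Proof. by have /andP[_ /eqP] := valP la. Qed.

Lemma tab_inj i j :
  tab_row la i = tab_row la j -> tab_col la i = tab_col la j -> i = j.
Proof.
rewrite /tab_row /tab_col => eqr eqc; apply: val_inj => /=.
by rewrite -(reshape_indexK (shape_of la) i) eqr eqc reshape_indexK.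
Qed.

Lemma tab_col_down i r : (r <= tab_row la i)%N ->
  exists2 j, tab_row la j = r & tab_col la j = tab_col la i.
Proof.
move=> ler; have lti : (i < sumn (shape_of la))%N by rewrite shape_sumn.
have ltc : (tab_col la i < nth 0 (shape_of la) r)%N.
  apply: leq_trans (reshape_offsetP lti) _.
  move: ler (reshape_indexP lti); rewrite /tab_row.
  set r' := reshape_index _ _ => ler ltr'.
  have geq_trans : transitive geq by move=> ? ? ? /[swap]; apply: leq_trans.
  apply: (sorted_leq_nth geq_trans leqnn 0 shape_sorted) => //.
  by rewrite inE (leq_ltn_trans ler).
have := flatten_indexP ltc; rewrite shape_sumn => ltn.
exists (Ordinal ltn); rewrite /tab_row /tab_col /=.
  exact: flatten_indexKl.
exact: flatten_indexKr.
Qed.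

End Shape.

Section Specht.

Variables (F : fieldType) (charF0 : [pchar F] =i pred0) (n : nat).

Definition tab_young (la : intpart n) : galg F 'S_n :=
  young (tab_row la) (tab_col la) F.

Definition tab_coyoung (la : intpart n) : galg F 'S_n :=
  col_alt (tab_col la) F * row_sym (tab_row la) F.

Lemma tab_young_sqr la :
  exists2 k, k != 0 & tab_young la * tab_young la = k *: tab_young la.
Proof.
by apply: young_sqr => //; [apply: tab_inj | apply: tab_col_down].
Qed.

Lemma tab_young_mul la x : exists k, tab_young la * x * tab_young la = k *: tab_young la.
Proof. by apply: young_mul => //; apply: tab_col_down. Qed.

Definition galg_row (a : galg F 'S_n) : 'rV[F]_#|[set: 'S_n]%G| :=
  \sum_g a g *: delta_mx 0 (gring_index [set: 'S_n]%G g).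

Lemma galg_rowM a b :
  galg_row a *m galg_mx (regular_repr F [set: 'S_n]) b = galg_row (a * b).
Proof.
have deltaM g h : delta_mx 0 (gring_index [set: 'S_n]%G g)
      *m regular_repr F [set: 'S_n] h
    = delta_mx 0 (gring_index [set: 'S_n]%G (g * h)%g) :> 'rV[F]__.
  by rewrite -rowE; apply/rowP=> j; rewrite !mxE gring_indexK ?inE.
rewrite /galg_row mulmx_suml.
under [RHS]eq_bigr => g _ do rewrite galgM scaler_suml.
rewrite exchange_big; apply: eq_bigr => h _ /=.
rewrite [RHS](reindex_inj (mulgI h)) /= mulmx_sumr; apply: eq_bigr => k _.
by rewrite mulKg -scalemxAl -scalemxAr deltaM scalerA.
Qed.

Lemma galg_row_eq0 a : galg_row a = 0 -> a = 0.
Proof.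
move/rowP=> a0; apply/ffunP=> g; move: (a0 (gring_index [set: 'S_n]%G g)).
rewrite summxE (bigD1 g) //= !mxE !eqxx mulr1 big1 ?addr0 ?ffunE //.
move=> h nh; rewrite !mxE eqxx /=; case: eqP; rewrite ?mulr0 //.
move/(congr1 (@enum_val _ _)); rewrite !gring_indexK ?inE // => gh.
by rewrite gh eqxx in nh.
Qed.

Lemma young_symmetrizerE la : young_symmetrizer F la = galg_row (tab_young la).
Proof.
rewrite /young_symmetrizer -[row_stab la]/(fun_stab (tab_row la)).
rewrite -[col_stab la]/(fun_stab (tab_col la)) /tab_young /young.
have lin : linear galg_row.
  move=> k a b; rewrite /galg_row scaler_sumr -big_split; apply: eq_bigr => g _.
  by rewrite !ffunE scalerDl scalerA.
have row0 : galg_row 0 = 0.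
  by apply: big1 => g _; rewrite ffunE scale0r.
have rowD a b : galg_row (a + b) = galg_row a + galg_row b.
  by rewrite -[a]scale1r lin !scale1r.
have rowZ k a : galg_row (k *: a) = k *: galg_row a.
  by rewrite -[k *: a]addr0 lin row0 addr0.
have rowG g : galg_row (gunit F g) = delta_mx 0 (gring_index [set: 'S_n]%G g).
  rewrite /galg_row (bigD1 g) //= ffunE eqxx scale1r big1 ?addr0 // => h nh.
  by rewrite ffunE (negPf nh) scale0r.
rewrite [row_sym _ _ * _]mulr_suml (big_morph galg_row rowD row0).
apply: eq_bigr => p _.
rewrite [_ * col_alt _ _]mulr_sumr (big_morph galg_row rowD row0).
by apply: eq_bigr => q _; rewrite -scalerAr -gunitM rowZ rowG.
Qed.

(** Here r is the rank of e on the Specht module of mu. For mu = la that module contains e itself,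
    an eigenvector with eigenvalue k, and e is nonzero because its coefficient at 1 is 1. *)
Lemma specht_trace la k : tab_young la * tab_young la = k *: tab_young la ->
  k != 0 -> forall mu, exists2 r : nat,
    \sum_s tab_young la s * sym_char F mu s = k * r%:R & mu = la -> (0 < r)%N.
Proof.
move=> ek nk mu; pose M := galg_mx (specht_repr F mu) (tab_young la).
exists (\rank M) => [|emu].
  rewrite -(@tr_quasi_idempotent _ _ M) ?tr_galg_mx //.
  by rewrite -galg_mxM ek galg_mxZ.
subst mu; rewrite lt0n mxrank_eq0; apply/eqP=> M0.
have yS : (young_symmetrizer F la <= specht_mx F la)%MS by apply: cyclic_mx_id.
pose v := in_submod (specht_mx F la) (young_symmetrizer F la).
have : v *m M = k *: v.
  rewrite /M /galg_mx mulmx_sumr.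
  have -> : k *: v = in_submod _ (k *: young_symmetrizer F la) by rewrite linearZ.
  have -> : k *: young_symmetrizer F la = young_symmetrizer F la *m
      galg_mx (regular_repr F [set: 'S_n]) (tab_young la).
    rewrite young_symmetrizerE galg_rowM ek /galg_row scaler_sumr.
    by apply: eq_bigr => g _; rewrite scalerA; congr (_ *: _); rewrite [RHS]ffunE.
  rewrite /galg_mx mulmx_sumr linear_sum; apply: eq_bigr => g _ /=.
  rewrite -!scalemxAr linearZ /=; congr (_ *: _).
  by rewrite -(in_submodJ (cyclic_mx_module _ _)).
rewrite M0 mulmx0 => /esym/eqP; rewrite scaler_eq0 (negPf nk) /= => /eqP v0.
have := in_submodK yS; rewrite -/v v0 linear0 young_symmetrizerE.
move/esym/galg_row_eq0 => e0; have := young_coef1 (@tab_inj n la) F.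
by rewrite -/(tab_young la) e0 ffunE => /eqP; rewrite eq_sym oner_eq0.
Qed.

End Specht.

(** * Products of symmetric groups, and multiplicities bounded by ranks *)

Lemma sum_dffun_prod (R : pzSemiRingType) (I : finType) (T_ : I -> finType)
    (f : forall i, T_ i -> R) :
  \sum_(s : {dffun forall i, T_ i}) \prod_i f i (s i)
    = \prod_i \sum_(x : T_ i) f i x.
Proof.
pose P_ i : {ffun T_ i -> R} := [ffun x => f i x].
have -> : \prod_i \sum_(x : T_ i) f i x
    = \prod_i \sum_(j in tagged_with T_ i) untag 0 (P_ i) j.
  apply: eq_bigr => i _; rewrite -(big_tag (fun i x => P_ i x)).
  by apply: eq_bigr => x _; rewrite ffunE.
rewrite bigA_distr_big_dep -(big_fprod _ _ P_).
rewrite (reindex (@dffun_of_fprod _ T_)) /=; last first.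
  exact/onW_bij/dffun_of_fprod_bij.
by apply: eq_bigr => s _; apply: eq_bigr => i _; rewrite !ffunE.
Qed.

Section ProductGroup.

Variables (F : fieldType) (gT : finGroupType) (nn : vtype gT -> nat).

Definition gprod (a : forall t, galg F 'S_(nn t)) : galg F (symprod nn) :=
  [ffun s : symprod nn => \prod_t a t (s t)].

Lemma gprodM a b : gprod a * gprod b = gprod (fun t => a t * b t).
Proof.
apply/ffunP=> s; rewrite galgM ffunE.
under [RHS]eq_bigr => t _ do rewrite galgM.
rewrite -sum_dffun_prod; apply: eq_bigr => r _; rewrite !ffunE -big_split /=.
by apply: eq_bigr => t _; rewrite !ffunE.
Qed.

Lemma gprodZ k a : gprod (fun t => k t *: a t) = (\prod_t k t) *: gprod a.
Proof.
apply/ffunP=> s; rewrite !ffunE -[RHS]big_split /=.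
by apply: eq_bigr => t _; rewrite ffunE.
Qed.

Lemma eq_gprod a b : (forall t, a t = b t) -> gprod a = gprod b.
Proof.
by move=> ab; apply/ffunP=> s; rewrite !ffunE; apply: eq_bigr => t _; rewrite ab.
Qed.

End ProductGroup.

Section Multiplicity.

Variables (F : fieldType) (charF0 : [pchar F] =i pred0).
Variables (gT : finGroupType) (nn : vtype gT -> nat) (d : nat).
Variable rW : mx_representation F [set: symprod nn] d.
Variable m : multipart nn -> nat.
Hypothesis trW : forall s, \tr (rW s) = \sum_la (m la)%:R * multi_char F la s.

Lemma multiplicity_leq_rank la :
  (m la <= \rank (galg_mx rW
    (gprod (fun t => tab_coyoung F (la t)))))%N.
Proof.
pose e t := tab_young F (la t).
set e' := gprod _.
have [k nk ek] : exists2 k : forall t, F,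
    forall t, k t != 0 & forall t, e t * e t = k t *: e t.
  have /fin_all_exists2[k nk ek] := fun t => tab_young_sqr charF0 (la t).
  by exists k.
pose K := \prod_t k t.
have nK : K != 0 by apply/prodf_neq0 => t _.
pose x : galg F (symprod nn) := gprod (fun t => row_sym (tab_row (la t)) F).
pose y : galg F (symprod nn) := gprod (fun t => col_alt (tab_col (la t)) F).
have exy : gprod e = x * y by rewrite gprodM.
have eyx : e' = y * x by rewrite gprodM.
have ee : gprod e * gprod e = K *: gprod e.
  by rewrite gprodM (eq_gprod ek) gprodZ.
pose M := galg_mx rW (gprod e); pose M' := galg_mx rW e'.
have trM : \tr M = K * (\rank M)%:R.
  by apply: tr_quasi_idempotent; rewrite -galg_mxM ee galg_mxZ.
have leM : (\rank M <= \rank M')%N.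
  (* K^2 e = e e e = x (y x) (y x y), so a nonzero multiple of e factors through e' = y x. *)
  have: K *: (K *: M) = galg_mx rW x *m M' *m galg_mx rW (y * (x * y)).
    rewrite -!galg_mxZ -!galg_mxM; congr galg_mx.
    by rewrite -ee scalerAr -ee exy eyx !mulrA.
  move=> eM; have <- : \rank (K *: (K *: M)) = \rank M.
    by rewrite !(eqmx_scale _ nK).
  by rewrite eM; apply: leq_trans (mxrankM_maxl _ _) (mxrankM_maxr _ _).
apply: leq_trans leM.
have /fin_all_exists[r rP] (mu : multipart nn) : exists r : vtype gT -> nat,
    (forall t, \sum_s e t s * sym_char F (mu t) s = k t * (r t)%:R)
    /\ (forall t, mu t = la t -> (0 < r t)%N).
  have [r] := fin_all_exists2 (fun t => specht_trace (ek t) (nk t) (mu t)).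
  by exists r.
have trE : \tr M = K * (\sum_mu m mu * \prod_t r mu t)%:R.
  rewrite tr_galg_mx natr_sum mulr_sumr.
  under eq_bigr => s _ do rewrite trW mulr_sumr.
  rewrite exchange_big; apply: eq_bigr => mu _ /=.
  rewrite natrM natr_prod mulrCA -big_split /=.
  have [rE _] := rP mu; under [in RHS]eq_bigr => t _ do rewrite -rE.
  rewrite -(sum_dffun_prod (fun t s => e t s * sym_char F (mu t) s)) mulr_sumr.
  apply: eq_bigr => s _; rewrite ffunE mulrCA; congr (_ * _).
  by rewrite -big_split.
(* Cancelling K leaves an equality of natural numbers in F, with nonnegative terms; the term of [la]
   is at least [m la]. *)
have /(mulfI nK) : K * (\rank M)%:R = K * (\sum_mu m mu * \prod_t r mu t)%:R.
  by rewrite -trM.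
move/(natr_charf0_inj charF0)->; rewrite (bigD1 la) //=; apply: leq_trans (leq_addr _ _).
by rewrite leq_pmulr // prodn_gt0 // => t; apply: (rP la).2.
Qed.

End Multiplicity.

(** * Gelfand's trick *)

Section Gelfand.

Variables (F : fieldType) (gT : finGroupType).
Implicit Types e f x y : galg F gT.

Definition quasi_primitive e :=
  (forall x, exists k, e * x * e = k *: e)
  /\ (exists2 k, k != 0 & e * e = k *: e).

Lemma proportional_of_comm a a' b e (k k0 c : F) : k0 != 0 -> c != 0 ->
    b * a = k0 *: e -> b * a' = k *: e -> a * e = c *: a -> a' * e = c *: a' ->
  a' * b * (a * b) = a * b * (a' * b) -> a' = (k0^-1 * k) *: a.
Proof.
move=> nk0 nc ba ba' ae a'e comm.
have : a' * (b * a) * (b * a) = a * (b * a') * (b * a).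
  have -> : a' * (b * a) * (b * a) = a' * b * (a * b) * a by rewrite !mulrA.
  by rewrite comm !mulrA.
rewrite ba ba' -!scalerAr -!scalerAl a'e ae -!scalerAl a'e ae !scalerA => E.
have nkc : k0 * (k0 * (c * c)) != 0 by rewrite !mulf_neq0.
apply: (scalerI nkc); rewrite scalerA.
have -> : k0 * (k0 * (c * c)) = k0 * (k0 * c) * c by ring.
by rewrite E; congr (_ *: _); field.
Qed.

(* If a = f x e is nonzero, the trace form x, y |-> (x y)(1) gives b in e F[G] f
   with b a a nonzero multiple of e; for a' in f F[G] e the elements a b and
   a' b of the commutative algebra f F[G] f commute, and expanding
   a' b a b a = a b a' b a shows that a' is a multiple of a. *)
Lemma gelfand_line e f : quasi_primitive e -> f * f = f ->
  (forall x y, f * x * f * (f * y * f) = f * y * f * (f * x * f)) ->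
  exists a, forall x, exists k, f * x * e = k *: a.
Proof.
move=> [eSe [c nc ee]] ff comm.
have [[x0 nx0]|no] := classic (exists x, f * x * e <> 0); last first.
  exists 0 => x; exists 0; rewrite scaler0; apply: NNPP => nx.
  by apply: no; exists x.
pose a := f * x0 * e; have ae : a * e = c *: a.
  by rewrite /a -mulrA ee -scalerAr.
have fa : f * a = a by rewrite /a !mulrA ff.
have [g ag] : exists g, a g != 0.
  apply/existsP; apply: contra_notT nx0; rewrite negb_exists => /forallP a0.
  by apply/ffunP=> g; rewrite [RHS]ffunE; apply/eqP/negPn/a0.
(* The coefficient of e s a at 1 is that of s a e = c s a, namely c times [a g]; this choice of s
   thus makes b a nonzero. *)
pose s := gunit F g^-1%g; pose b := e * s * f.
have [k0 bk0] := eSe (s * f * f * x0).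
have {bk0}ba : b * a = k0 *: e by rewrite -bk0 /b /a !mulrA.
have nk0 : k0 != 0.
  apply: contra_neq ag => k00.
  have : (e * (s * a)) 1%g = 0.
    have -> : e * (s * a) = b * a by rewrite /b -!mulrA fa.
    by rewrite ba k00 scale0r ffunE.
  rewrite galg_coef1M -mulrA ae -scalerAr ffunE gunitMl invgK mulg1.
  by move/eqP; rewrite mulf_eq0 (negPf nc) => /eqP.
exists a => x; pose a' := f * x * e.
have [k bk] := eSe (s * f * f * x).
have {bk}ba' : b * a' = k *: e by rewrite -bk /b /a' !mulrA.
have a'e : a' * e = c *: a' by rewrite /a' -mulrA ee -scalerAr.
exists (k0^-1 * k); apply: (proportional_of_comm nk0 nc ba ba' ae a'e).
have -> : a' * b = f * (x * e * e * s) * f by rewrite /a' /b !mulrA.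
have -> : a * b = f * (x0 * e * e * s) * f by rewrite /a /b !mulrA.
exact: comm.
Qed.

(** On the span of the f g f, inversion is the identity; an anti-automorphism that is the identity
    forces commutativity. *)
Lemma ginv_comm f : ginv f = f ->
  (forall g, f * gunit F g * f = f * gunit F g^-1%g * f) ->
  forall x y, f * x * f * (f * y * f) = f * y * f * (f * x * f).
Proof.
move=> fV fs; have fxV x : ginv (f * x * f) = f * x * f.
  rewrite !ginvM fV mulrA [x]galgE ginv_sum.
  rewrite !mulr_sumr !mulr_suml; apply: eq_bigr => g _.
    by rewrite ginvZ ginv_gunit -!scalerAr -!scalerAl (fs g).
move=> x y; have e : f * x * f * (f * y * f) = f * (x * f * f * y) * f.
  by rewrite !mulrA.
by rewrite e -fxV -e ginvM !fxV.
Qed.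

Section Twisted.

Variables (charF0 : [pchar F] =i pred0) (H : {group gT}) (b : gT -> bool).
Hypothesis bM : {in H &, forall g h, b (g * h)%g = b g (+) b h}.

(** The idempotent of the linear character (-1)^b of H. *)
Definition twisted_idem : galg F gT :=
  (#|H|%:R)^-1 *: \sum_(h in H) (-1) ^+ (b h) *: gunit F h.

Lemma twisted_sign1 : b 1%g = false.
Proof. by have := bM (group1 H) (group1 H); rewrite mulg1; case: (b _). Qed.

Lemma twisted_signV h : h \in H -> b h^-1%g = b h.
Proof.
move=> Hh; have := bM Hh (groupVr Hh); rewrite mulgV twisted_sign1.
by case: (b h); case: (b _).
Qed.

Lemma twisted_idemMl h : h \in H ->
  gunit F h * twisted_idem = (-1) ^+ (b h) *: twisted_idem.
Proof.
move=> Hh; rewrite /twisted_idem -scalerAr scalerA mulrC -scalerA.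
congr (_ *: _); rewrite mulr_sumr scaler_sumr.
rewrite [RHS](reindex_inj (mulgI h)) /=.
apply: eq_big => [g|g Hg]; first by rewrite groupMl.
by rewrite bM // signr_addb scalerA mulrA -expr2 sqrr_sign mul1r gunitM scalerAr.
Qed.

Lemma twisted_idemMr h : h \in H ->
  twisted_idem * gunit F h = (-1) ^+ (b h) *: twisted_idem.
Proof.
move=> Hh; rewrite /twisted_idem -scalerAl scalerA mulrC -scalerA.
congr (_ *: _); rewrite mulr_suml scaler_sumr.
rewrite [RHS](reindex_inj (mulIg h)) /=.
apply: eq_big => [g|g Hg]; first by rewrite groupMr.
rewrite bM // signr_addb scalerA mulrCA -expr2 sqrr_sign mulr1 gunitM.
by rewrite scalerAl.
Qed.

Lemma card_group_neq0 : #|H|%:R != 0 :> F.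
Proof. by have /pcharf0P-> := charF0; rewrite -lt0n cardG_gt0. Qed.

Lemma twisted_idemK : twisted_idem * twisted_idem = twisted_idem.
Proof.
rewrite {1}/twisted_idem -scalerAl mulr_suml.
rewrite (eq_bigr (fun _ => twisted_idem)) => [|h Hh]; last first.
  by rewrite -scalerAl twisted_idemMl // scalerA -expr2 sqrr_sign scale1r.
rewrite sumr_const -scaler_nat scalerA mulVf ?scale1r //.
exact: card_group_neq0.
Qed.

Lemma ginv_twisted_idem : ginv twisted_idem = twisted_idem.
Proof.
rewrite /twisted_idem ginvZ ginv_sum; congr (_ *: _).
rewrite (reindex_inj invg_inj) /=; apply: eq_big => [h|h]; rewrite groupV //.
by move=> Hh; rewrite ginvZ ginv_gunit invgK twisted_signV.
Qed.

Lemma twisted_idem_inv s h h' : h \in H -> h' \in H ->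
  (s^-1 = h * s * h')%g -> b h = b h' ->
  twisted_idem * gunit F s * twisted_idem
    = twisted_idem * gunit F s^-1%g * twisted_idem.
Proof.
move=> Hh Hh' -> bhh'.
have := twisted_idemMl Hh'; have := twisted_idemMr Hh.
move: twisted_idem => f fh h'f; rewrite !gunitM !mulrA fh -[in RHS]mulrA h'f.
rewrite -!scalerAl -scalerAr scalerA bhh'.
by rewrite -expr2 sqrr_sign scale1r.
Qed.

End Twisted.

End Gelfand.

(** * Words in elements of one type *)

Section PermutationInduction.

Variables (n : nat) (f : 'I_n -> nat) (P : 'S_n -> Prop).
Hypotheses (P1 : P 1%g) (PM : forall s r, P s -> P r -> P (s * r)%g).

(** Multiplying s by the transposition of i and [s i] stays in the stabilizer and fixes one more
    point. *)
Lemma fun_stab_tperm_ind : (forall i j, f i = f j -> P (tperm i j)) ->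
  forall s, s \in fun_stab f -> P s.
Proof.
move=> Pt s; have [k] := ubnP #|[set i | s i != i]|.
elim: k s => // k IHk s ltk fs; have [/eqP s1|] := boolP (s == 1%g); first by rewrite s1.
move=> ns; have [i si] : exists i, s i != i.
  apply/existsP; apply: contraNT ns; rewrite negb_exists => /forallP si.
  by apply/eqP/permP=> i; rewrite perm1; apply/eqP/negPn/si.
pose r := tperm i (s i); have ft : f i = f (s i).
  by move/fun_stabP: fs => ->.
have -> : s = (r * (r * s))%g by rewrite mulgA tperm2 mul1g.
apply: PM; first exact: Pt.
apply: IHk; last by rewrite groupM // tperm_fun_stab.
rewrite ltnS in ltk; apply: leq_trans ltk; apply: proper_card.
apply/properP; split; last first.
  exists (s i); rewrite !inE ?(inj_eq perm_inj) //.
  by rewrite permM tpermR eqxx.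
apply/subsetP=> j; rewrite !inE; apply: contra => /eqP sj.
have nij : i != j by apply: contraNneq si => ->; rewrite sj.
rewrite permM tpermD ?sj // -[j in _ != j]sj (inj_eq perm_inj) //.
Qed.

(** When the classes of f are progressions of step d, conjugating by the transposition of m = j - d
    and j turns (i m) into (i j). Step 2 serves parity classes, step 1 intervals. *)
Lemma fun_stab_step_ind (d : nat) :
    (forall i j : 'I_n, (i < j)%N -> f i = f j ->
       exists m : 'I_n, [/\ (m + d)%N = j, f m = f i & (i <= m < j)%N]) ->
    (forall i j : 'I_n, (i + d)%N = j -> f i = f j -> P (tperm i j)) ->
  forall s, s \in fun_stab f -> P s.
Proof.
move=> pred Pt; apply: fun_stab_tperm_ind => i j.
wlog lij : i j / (i < j)%N => [H|].
  case: (ltngtP i j) => [|ji fij|/val_inj-> _]; first exact: H.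
    by rewrite tpermC; apply: H.
  by rewrite tperm1.
have [k] := ubnP j; elim: k j lij => // k IHk j lij ltk fij.
have [m [md fm /andP[im mj]]] := pred i j lij fij.
have Pmj : P (tperm m j) by apply: Pt; rewrite // fm.
move: im; rewrite leq_eqVlt => /orP[/eqP/val_inj-> //|im].
have -> : tperm i j = (tperm m j * (tperm i m * tperm m j))%g.
  rewrite -{1}[tperm m j]tpermV -conjgE tpermJ tpermL tpermD //.
    by rewrite -val_eqE gtn_eqF.
  by rewrite -val_eqE gtn_eqF.
apply/PM => //; apply/PM => //; apply: IHk => //.
by apply: leq_trans mj _.
Qed.

End PermutationInduction.

(** Let Q be the set where p holds. The involution [s0] exchanging the part of Q outside s^-1 Q with
    the part of s^-1 Q outside Q maps Q onto s^-1 Q, so s0 s stabilizes Q, and h = (s0 s)^-1 works.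
    With the same h on both sides, the signs of any character with values 1 and -1 cancel. *)
Lemma fun_stab_double_coset n (p : pred 'I_n) (s : 'S_n) :
  exists2 h, h \in fun_stab (fun i => p i : nat) & (s^-1 = h * s * h)%g.
Proof.
pose D1 := [set i | p i && ~~ p (s i)].
pose D2 := [set i | ~~ p i && p (s i)].
have eqD : #|D1| = #|D2|.
  pose Q := [set i | p i]; pose Q' := s @^-1: Q.
  have cQ : #|Q'| = #|Q|.
    by apply: on_card_preimset; apply: onW_bij; apply: (Bijective (permK s) (permKV s)).
  have -> : D1 = Q :\: Q' by apply/setP=> i; rewrite !inE andbC.
  have -> : D2 = Q' :\: Q by apply/setP=> i; rewrite !inE.
  by apply/eqP; rewrite -(eqn_add2l #|Q :&: Q'|) cardsID setIC cardsID cQ.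
have disj i : i \in D1 -> i \notin D2 by rewrite !inE => /andP[-> _].
pose swap (A B : {set 'I_n}) i := nth i (enum B) (index i (enum A)).
have swapP (A B : {set 'I_n}) i : #|A| = #|B| -> i \in A ->
    swap A B i \in B /\ swap B A (swap A B i) = i.
  move=> AB Ai; have ltA : (index i (enum A) < size (enum A))%N.
    by rewrite index_mem mem_enum.
  have ltB : (index i (enum A) < size (enum B))%N by rewrite -cardE -AB cardE.
  split; first by rewrite -mem_enum mem_nth.
  by rewrite /swap index_uniq ?enum_uniq // nth_index // mem_enum.
pose f i := if i \in D1 then swap D1 D2 i
            else if i \in D2 then swap D2 D1 i else i.
have fK : involutive f.
  move=> i; rewrite {2}/f; have [D1i|nD1] := boolP (i \in D1).
    have [D2f fi] := swapP _ _ _ eqD D1i.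
    by rewrite /f D2f ifN //; apply: contraTN D2f; apply: disj.
  have [D2i|nD2] := boolP (i \in D2); last by rewrite /f (negPf nD1) (negPf nD2).
  by have [D1f fi] := swapP _ _ _ (esym eqD) D2i; rewrite /f D1f.
pose s0 := perm (inv_inj fK).
have s0V : (s0 * s0 = 1)%g by apply/permP=> i; rewrite permM !permE fK.
have s0s i : p (s (s0 i)) = p i.
  rewrite permE /f; have [D1i|nD1] := boolP (i \in D1).
    have [] := swapP _ _ _ eqD D1i; rewrite inE => /andP[_ ->] _.
    by move: D1i; rewrite inE => /andP[->].
  have [D2i|nD2] := boolP (i \in D2).
    have [] := swapP _ _ _ (esym eqD) D2i; rewrite inE => /andP[_ /negPf->] _.
    by move: D2i; rewrite inE => /andP[/negPf->].
  by move: nD1 nD2; rewrite !inE; case: (p i); case: (p (s i)).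
exists (s0 * s)^-1%g.
  by rewrite groupV; apply/fun_stabP=> i; rewrite permM s0s.
have s0I : (s0^-1 = s0)%g by apply/eqP; rewrite eq_invg_mul s0V.
by rewrite invMg s0I !mulgA mulgK -mulgA s0V mulg1.
Qed.

Section Words.

Variables (F : fieldType) (charF0 : [pchar F] =i pred0) (U : algType F).
Variables (n : nat) (Z : U -> Prop).
Implicit Types (w : {ffun 'I_n -> U} -> U) (a b e : galg F 'S_n).
Implicit Types (x : {ffun 'I_n -> U}) (s r : 'S_n).

Definition pperm s x : {ffun 'I_n -> U} := [ffun i => x (s i)].

(** A right action on functions of the letters: by [wactM] the left factor of a product is applied
    first. *)
Definition wact w a x : U := \sum_s a s *: w (pperm s x).

Definition word1 x : U := \prod_(i < n) x i.

(* The simple module generated by [e] occurs at most once in the words with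
   letters in [Z]. *)
Definition line_ok e := exists Phi : {ffun 'I_n -> U} -> U, forall s,
  exists k, forall x, (forall i, Z (x i)) ->
  wact word1 (gunit F s * e) x = k *: Phi x.

Lemma ppermM s r x : pperm (s * r)%g x = pperm s (pperm r x).
Proof. by apply/ffunP=> i; rewrite !ffunE permM. Qed.

Lemma pperm1 x : pperm 1%g x = x.
Proof. by apply/ffunP=> i; rewrite ffunE perm1. Qed.

Lemma pperm_in s x : (forall i, Z (x i)) -> forall i, Z (pperm s x i).
Proof. by move=> Zx i; rewrite ffunE. Qed.

Lemma wactM w a b x : wact w (a * b) x = wact (wact w a) b x.
Proof.
rewrite /wact; under eq_bigr => s _ do rewrite galgM scaler_suml.
under [RHS]eq_bigr => s _ do rewrite scaler_sumr.
rewrite exchange_big [RHS]exchange_big; apply: eq_bigr => s _ /=.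
rewrite (reindex_inj (mulgI s)) /=; apply: eq_bigr => r _.
by rewrite mulKg ppermM scalerA mulrC.
Qed.

Lemma wact_gunit w s x : wact w (gunit F s) x = w (pperm s x).
Proof.
rewrite /wact (bigD1 s) //= ffunE eqxx scale1r big1 ?addr0 // => r nr.
by rewrite ffunE (negPf nr) scale0r.
Qed.

Lemma wactZ w k a x : wact w (k *: a) x = k *: wact w a x.
Proof. by rewrite /wact scaler_sumr; apply: eq_bigr => s _; rewrite ffunE scalerA. Qed.

Lemma wactD w a b x : wact w (a + b) x = wact w a x + wact w b x.
Proof. by rewrite /wact -big_split; apply: eq_bigr => s _; rewrite ffunE scalerDl. Qed.

Lemma wact_sum w (I : Type) (l : seq I) (P : pred I) (a : I -> galg F 'S_n) x :
  wact w (\sum_(i <- l | P i) a i) x = \sum_(i <- l | P i) wact w (a i) x.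
Proof.
elim/big_ind2: _ => [|y a1 y' a2 <- <-|//]; last by rewrite wactD.
by rewrite /wact big1 // => s _; rewrite ffunE scale0r.
Qed.

Lemma wactDl w w' a x :
  wact (fun y => w y + w' y) a x = wact w a x + wact w' a x.
Proof. by rewrite /wact -big_split; apply: eq_bigr => s _; rewrite scalerDr. Qed.

Lemma eq_wact w w' : (forall x, (forall i, Z (x i)) -> w x = w' x) ->
  forall a x, (forall i, Z (x i)) -> wact w a x = wact w' a x.
Proof.
move=> ww' a x Zx; apply: eq_bigr => s _; congr (_ *: _).
exact/ww'/pperm_in.
Qed.

Lemma wact_twisted_idem w (H : {group 'S_n}) (b : 'S_n -> bool) :
    (forall h, h \in H -> forall x, (forall i, Z (x i)) ->
       w (pperm h x) = (-1) ^+ (b h) *: w x) ->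
  forall x, (forall i, Z (x i)) -> wact w (twisted_idem F H b) x = w x.
Proof.
move=> wH x Zx; rewrite /twisted_idem wactZ wact_sum.
rewrite (eq_bigr (fun _ => w x)) => [|h Hh]; last first.
  by rewrite wactZ wact_gunit wH // scalerA -expr2 sqrr_sign scale1r.
by rewrite sumr_const -scaler_nat scalerA mulVf ?scale1r // card_group_neq0.
Qed.

(** Permuted words have the form w b with w = w f. So [word1] acted on by s e is w f b e, and f
    F[S_n] e is a line. *)
Lemma gelfand_line_ok e (f : galg F 'S_n) w : quasi_primitive e -> f * f = f ->
    (forall a b, f * a * f * (f * b * f) = f * b * f * (f * a * f)) ->
    (forall x, (forall i, Z (x i)) -> wact w f x = w x) ->
    (forall s, exists b, forall x, (forall i, Z (x i)) ->
       word1 (pperm s x) = wact w b x) ->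
  line_ok e.
Proof.
move=> qe ff comm wf gen; have [a fae] := gelfand_line qe ff comm.
exists (wact w a) => s; have [b wb] := gen s; have [k fbe] := fae b.
exists k => x Zx; rewrite -wactZ -fbe !wactM.
apply: eq_wact Zx => y Zy; rewrite wact_gunit wb // wactM.
by apply: eq_wact Zy => z Zz; rewrite wf.
Qed.

Lemma twisted_line_ok (H : {group 'S_n}) (b : 'S_n -> bool) e :
    {in H &, forall g h, b (g * h)%g = b g (+) b h} ->
    (forall s, exists h h', [/\ h \in H, h' \in H, (s^-1 = h * s * h')%g & b h = b h']) ->
    (forall h, h \in H -> forall x, (forall i, Z (x i)) ->
       word1 (pperm h x) = (-1) ^+ (b h) *: word1 x) ->
  quasi_primitive e -> line_ok e.
Proof.
move=> bM Hinv wH qe; apply: (gelfand_line_ok (f := twisted_idem F H b) (w := word1) qe).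
- exact: twisted_idemK.
- apply: ginv_comm; first exact: (ginv_twisted_idem _ bM).
  move=> s; have [h [h' [Hh Hh' es bb]]] := Hinv s.
  exact: (twisted_idem_inv _ bM Hh Hh').
- exact: wact_twisted_idem wH.
by move=> s; exists (gunit F s) => x _; rewrite wact_gunit.
Qed.

Lemma line_ok_trivial e : (n <= 1)%N -> line_ok e.
Proof.
move=> len1; exists (wact word1 e) => s; exists 1 => x _.
have -> : s = 1%g.
  apply/permP=> i; apply: val_inj => /=; rewrite perm1.
  have lt0 (j : 'I_n) : nat_of_ord j = 0%N.
    by apply/eqP; rewrite -leqn0 -ltnS; apply: leq_trans (ltn_ord j) len1.
  by rewrite !lt0.
by rewrite gunit1 mul1r scale1r.
Qed.

(** Positions are natural numbers so that words can be cut anywhere; out of range stands the neutral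
    letter 1. *)
Definition nthx x k : U := if insub k is Some i then x i else 1.

Lemma nthx_ord x (i : 'I_n) : nthx x i = x i.
Proof. by rewrite /nthx valK. Qed.

Lemma word1E x : word1 x = \prod_(0 <= k < n) nthx x k.
Proof. by rewrite big_mkord; apply: eq_bigr => i _; rewrite nthx_ord. Qed.

Definition subword x i j : U := \prod_(i <= k < j) nthx x k.

Lemma word1_split x i d : (i + d <= n)%N ->
  word1 x = subword x 0 i * subword x i (i + d) * subword x (i + d) n.
Proof.
move=> le_n; rewrite word1E (big_cat_nat (n := i)) //=; last first.
  exact: leq_trans (leq_addr _ _) le_n.
by rewrite (big_cat_nat (m := i) (n := i + d)) ?leq_addr //= mulrA.
Qed.

Lemma eq_subword x (y : {ffun 'I_n -> U}) i j : (forall k : 'I_n, (i <= k < j)%N -> x k = y k) ->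
  subword x i j = subword y i j.
Proof.
move=> xy; apply: eq_big_nat => k kij; rewrite /nthx.
by case: insubP => // o _ ok; rewrite xy ?ok.
Qed.

Lemma subword_pperm s x i j : (forall k : 'I_n, (i <= k < j)%N -> s k = k) ->
  subword (pperm s x) i j = subword x i j.
Proof. by move=> sk; apply: eq_subword => k kij; rewrite ffunE sk. Qed.

Lemma subword_recl x (i : 'I_n) j : (i < j)%N ->
  subword x i j = x i * subword x i.+1 j.
Proof. by move=> lij; rewrite /subword big_ltn // nthx_ord. Qed.

Lemma subwordnn x i : subword x i i = 1.
Proof. by rewrite /subword big_geq. Qed.

End Words.

(** * Commutation rules under which the words yield a line *)

Section LineCases.

Variables (F : fieldType) (charF0 : [pchar F] =i pred0) (U : algType F).
Variables (n : nat) (Z : U -> Prop) (e : galg F 'S_n).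
Hypothesis qe : quasi_primitive e.
Implicit Types (x : {ffun 'I_n -> U}) (s r h : 'S_n).

Lemma word1_pperm_local s x i d : (i + d <= n)%N ->
    (forall k : 'I_n, ~~ (i <= k < i + d)%N -> s k = k) ->
  word1 (pperm s x) = subword x 0 i * subword (pperm s x) i (i + d)
                      * subword x (i + d) n.
Proof.
move=> le_n sk; rewrite (word1_split _ le_n).
rewrite [subword _ 0 i]subword_pperm; last first.
  by move=> k /andP[_ ki]; apply: sk; rewrite leqNgt ki.
rewrite [subword _ (i + d) n]subword_pperm // => k /andP[ik _].
by apply: sk; rewrite [(k < _)%N]ltnNge ik andbF.
Qed.

Lemma subword2 x (i j : 'I_n) : i.+1 = j -> subword x i (i + 2) = x i * x j.
Proof.
move=> ij; rewrite addn2 !subword_recl // ij subword_recl ?ij // subwordnn.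
by rewrite mulr1.
Qed.

Lemma subword3 x (i j k : 'I_n) : i.+1 = j -> j.+1 = k ->
  subword x i (i + 3) = x i * x j * x k.
Proof.
move=> ij jk; rewrite addn3 subword_recl ?ltnS //; last by apply: leqW; apply: leqW.
rewrite ij subword_recl ?ij // ?jk ?leqW // subword_recl ?jk // subwordnn.
by rewrite mulr1 mulrA.
Qed.

(* Words whose letters in positions of the same parity commute up to one
   common sign: they span a quotient of the module induced from a linear
   character of the Young subgroup of the parity classes. *)
Lemma line_ok_parity (d : bool) :
    (forall a b c, Z a -> Z b -> Z c -> a * b * c = (-1) ^+ d *: (c * b * a)) ->
  line_ok Z e.
Proof.
move=> Zabc; pose par (i : 'I_n) : nat := odd i.
pose b s := d && odd_perm s.
have bM : {in fun_stab par &, forall g h, b (g * h)%g = b g (+) b h}.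
  by move=> g h _ _; rewrite /b odd_permM andb_addr.
apply: (twisted_line_ok (H := fun_stab_group par) charF0 bM _ _ qe).
  move=> s; have [h Hh es] := fun_stab_double_coset (fun i : 'I_n => odd i) s.
  by exists h, h.
move=> h Hh; move: h Hh; apply: (@fun_stab_step_ind _ par _ _ _ 2).
- by move=> x _; rewrite pperm1 /b odd_perm1 andbF scale1r.
- move=> s r Ps Pr x Zx; rewrite ppermM Ps; last exact: pperm_in.
  by rewrite Pr // scalerA -signr_addb /b odd_permM andb_addr.
- move=> i j lij fij; have oij : odd i = odd j.
    by move: fij; rewrite /par; case: (odd i); case: (odd j).
  have l2 : (i + 2 <= j)%N.
    rewrite addn2 ltn_neqAle lij andbT; apply/eqP=> eij.
    by move: oij; rewrite -eij /=; case: (odd i).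
  have ltj : (j - 2 < n)%N by apply: leq_ltn_trans (leq_subr _ _) (ltn_ord j).
  have j2 : (2 <= j)%N by apply: leq_trans l2; rewrite leq_addl.
  exists (Ordinal ltj); split; rewrite /= ?subnK //.
    by rewrite /par /= oddB // addbF -oij.
  by lia.
move=> i j ij _ x Zx.
have ltm : (i.+1 < n)%N by rewrite (leq_trans _ (ltn_ord j)) // -ij addn2.
pose m := Ordinal ltm; have mj : m.+1 = j by rewrite -ij addn2.
have le_n : (i + 3 <= n)%N by rewrite addnS ij.
have nij : i != j by rewrite -val_eqE /= -ij addn2 ltn_eqF.
rewrite (word1_pperm_local _ le_n) => [|k nk]; last first.
  by rewrite tpermD //; apply/eqP=> ek; move: nk; rewrite -ek; lia.
rewrite !(@subword3 _ i m j) // !ffunE tpermL tpermR.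
rewrite tpermD ?(word1_split x le_n) ?(@subword3 _ i m j) //.
- by rewrite (Zabc (x j)) // -scalerAr -scalerAl /b odd_tperm nij andbT.
- by rewrite -val_eqE /= ltn_eqF.
by rewrite -val_eqE /= -mj gtn_eqF.
Qed.

Lemma fun_stab_adjacent_ind (P : 'S_n -> Prop) :
    P 1%g -> (forall s r, P s -> P r -> P (s * r)%g) ->
    (forall i j : 'I_n, i.+1 = j -> P (tperm i j)) ->
  forall s, P s.
Proof.
move=> P1 PM Pt s.
apply: (@fun_stab_step_ind _ (fun=> 0%N) P P1 PM 1); last 1 first.
- by apply/fun_stabP.
- move=> i j lij _; have ltj : (j.-1 < n)%N by move: (ltn_ord j); lia.
  by exists (Ordinal ltj); split=> //=; lia.
by move=> i j ij _; apply: Pt; rewrite -ij addn1.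
Qed.

Lemma word1_adjacent x (i j : 'I_n) : i.+1 = j ->
  word1 x = subword x 0 i * (x i * x j) * subword x (i + 2) n
  /\ word1 (pperm (tperm i j) x)
       = subword x 0 i * (x j * x i) * subword x (i + 2) n.
Proof.
move=> ij; have le_n : (i + 2 <= n)%N by rewrite addn2 ij.
split; first by rewrite (word1_split x le_n) (subword2 _ ij).
rewrite (word1_pperm_local _ le_n) => [|k nk]; last first.
  by rewrite tpermD //; apply/eqP=> ek; move: nk; rewrite -ek; lia.
by rewrite (subword2 _ ij) !ffunE tpermL tpermR.
Qed.

(* A word only depends on the parity of its permutation. *)
Lemma line_ok_cyclic :
    (forall a b c, Z a -> Z b -> Z c -> a * b * c = c * a * b) ->
  line_ok Z e.
Proof.
move=> Zabc; have [/line_ok_trivial ok|n_gt1] := leqP n 1; first exact: ok.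
pose o0 : 'I_n := Ordinal (ltnW n_gt1); pose o1 : 'I_n := Ordinal n_gt1.
pose t := tperm o0 o1.
pose w (c : bool) x := word1 (if c then pperm t x else x).
(* On a window abc the two transpositions give bac and acb, which are cyclic rotations of each
   other. *)
have w_step x (i j k : 'I_n) : i.+1 = j -> j.+1 = k -> (forall i, Z (x i)) ->
    word1 (pperm (tperm i j) x) = word1 (pperm (tperm j k) x).
  move=> ij jk Zx; have le_n : (i + 3 <= n)%N by rewrite addn3 ij jk.
  rewrite !(word1_pperm_local _ le_n); last 2 first.
  - by move=> l nl; rewrite tpermD //; apply/eqP=> el; move: nl; rewrite -el; lia.
  - by move=> l nl; rewrite tpermD //; apply/eqP=> el; move: nl; rewrite -el; lia.
  rewrite !(subword3 _ ij jk) !ffunE !tpermL !tpermR.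
  have nik : i != k by apply/eqP=> ik; move: jk; rewrite -ij ik; lia.
  have nij : i != j by apply/eqP=> eij; move: ij; rewrite eij; lia.
  have njk : j != k by apply/eqP=> ejk; move: jk; rewrite ejk; lia.
  rewrite [tperm i j k]tpermD // [tperm j k i]tpermD 1?eq_sym //.
  by rewrite (Zabc (x i) (x k)) //.
have w_adj x (i j : 'I_n) : i.+1 = j -> (forall i, Z (x i)) ->
    word1 (pperm (tperm i j) x) = word1 (pperm t x).
  case: i => i; elim: i j => [|i IHi] ltn j ij Zx.
    by congr (word1 (pperm (tperm _ _) x)); apply: val_inj.
  have ltn' : (i < n)%N by apply: ltnW.
  by rewrite -(w_step x (Ordinal ltn')) // IHi.
have wM s : forall c x, (forall i, Z (x i)) -> w c (pperm s x) = w (c (+) s) x.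
  elim/fun_stab_adjacent_ind: s => [c x Zx|s r Ps Pr c x Zx|i j ij c x Zx].
  - by rewrite pperm1 odd_perm1 addbF.
  - rewrite ppermM Ps; last exact: pperm_in.
    by rewrite Pr // odd_permM addbA.
  have nij : i != j by apply/eqP=> eij; move: ij; rewrite eij; lia.
  rewrite odd_tperm nij addbT; case: c; rewrite /w /=; last exact: w_adj.
  rewrite -(w_adj _ i j) //; last exact: pperm_in.
  by rewrite -ppermM tperm2 pperm1.
have bM : {in (Alt_group 'I_n) &, forall g h : 'S_n, false = false (+) false} by [].
apply: (twisted_line_ok charF0 (H := (Alt_group 'I_n)) (b := fun=> false)) => //.
  (* s^-1 = 1 s s^-2, and s^-2 is even. *)
  move=> s; exists 1%g, (s^-1 * s^-1)%g; split => //.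
    by rewrite Alt_even odd_permM addbb.
  by rewrite mul1g mulKVg.
move=> h; rewrite Alt_even => /negPf evh x Zx.
by have := wM h false x Zx; rewrite /w evh scale1r.
Qed.

(* Central commutators with vanishing products: the words span the trivial
   module plus a quotient of the module induced from sgn (x) 1 on S_2 x S_(n-2),
   generated by the words with one commutator. *)
Lemma line_ok_central_commutators :
    (forall a b c, Z a -> Z b -> Z c -> (a * b - b * a) * c = c * (a * b - b * a)) ->
    (forall a b c d, Z a -> Z b -> Z c -> Z d ->
       (a * b - b * a) * (c * d - d * c) = 0) ->
  line_ok Z e.
Proof.
move=> Zc Zcc; have [/line_ok_trivial ok|n_gt1] := leqP n 1; first exact: ok.
pose o0 : 'I_n := Ordinal (ltnW n_gt1); pose o1 : 'I_n := Ordinal n_gt1.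
have n01 : o0 != o1 by [].
pose t := tperm o0 o1; pose low (i : 'I_n) : nat := (i < 2)%N.
pose kap x := word1 x - word1 (pperm t x).
have Zsub a b x i j : Z a -> Z b -> (forall i, Z (x i)) ->
    (a * b - b * a) * subword x i j = subword x i j * (a * b - b * a).
  move=> Za Zb Zx; rewrite /subword.
  elim/big_ind: _ => [|y z ey ez|k _]; first by rewrite mulr1 mul1r.
    by rewrite mulrA ey -mulrA ez mulrA.
  rewrite /nthx; case: insub => [l|]; first exact: Zc.
  by rewrite mulr1 mul1r.
have kapE x : kap x = (x o0 * x o1 - x o1 * x o0) * subword x 2 n.
  have [e1 e2] := word1_adjacent x (erefl : o0.+1 = o1).
  by rewrite /kap e1 e2 !subwordnn !mul1r -mulrBl.
have diffE x (i j : 'I_n) : i.+1 = j -> (forall i, Z (x i)) ->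
    word1 x - word1 (pperm (tperm i j) x)
    = (x i * x j - x j * x i) * (subword x 0 i * subword x (i + 2) n).
  move=> ij Zx; have [-> ->] := word1_adjacent x ij.
  by rewrite -mulrBl -mulrBr -Zsub // mulrA.
pose b (h : 'S_n) := h o0 == o1.
have lowP i : low i = 1%N -> (i == o0) || (i == o1).
  by rewrite /low -!val_eqE /=; case: i => [[|[|i]]].
have bM : {in fun_stab low &, forall g h, b (g * h)%g = b g (+) b h}.
  move=> g h /fun_stabP Hg /fun_stabP Hh; rewrite /b permM.
  have := lowP (g o0) (Hg o0); have := lowP (h o0) (Hh o0).
  have := lowP (h o1) (Hh o1).
  case/orP=> /eqP h1 /orP[] /eqP h0 /orP[] /eqP g0; rewrite g0 ?h1 ?h0 ?eqxx //.
  - by move: n01; rewrite -(inj_eq (@perm_inj _ h)) h0 h1 eqxx.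
  - by move: n01; rewrite -(inj_eq (@perm_inj _ h)) h0 h1 eqxx.
have kapH h : h \in fun_stab low -> forall x, (forall i, Z (x i)) ->
    kap (pperm h x) = (-1) ^+ (b h) *: kap x.
  move=> Hh; suff [] : h \in fun_stab low /\ forall x, (forall i, Z (x i)) ->
      kap (pperm h x) = (-1) ^+ (b h) *: kap x by [].
  move: h Hh; apply: (@fun_stab_step_ind _ low _ _ _ 1).
  - split=> [|x _]; first exact: group1.
    by rewrite pperm1 /b perm1 (negPf n01) scale1r.
  - move=> s r [Hs Ps] [Hr Pr]; split=> [|x Zx]; first exact: groupM.
    rewrite ppermM Ps; last exact: pperm_in.
    by rewrite Pr // scalerA -signr_addb bM.
  - move=> i j lij lowij; have ltj : (j.-1 < n)%N by move: (ltn_ord j); lia.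
    exists (Ordinal ltj); split=> //=; try lia.
    by move: lowij; rewrite /low /=; lia.
  move=> i j ij lowij; split=> [|x Zx]; first exact: tperm_fun_stab.
  have [i2|i2] := ltnP i 2.
    have j2 : (j < 2)%N by move: lowij; rewrite /low i2; case: (j < 2)%N.
    have -> : i = o0 by apply: val_inj => /=; lia.
    have -> : j = o1 by apply: val_inj => /=; lia.
    rewrite /b tpermL eqxx scaleN1r !kapE subword_pperm => [|k k2].
      by rewrite !ffunE tpermL tpermR -opprB mulNr.
    by rewrite tpermD // -val_eqE /=; lia.
  have ni0 : i != o0 by rewrite -val_eqE /=; lia.
  have nj0 : j != o0 by rewrite -val_eqE /=; lia.
  have ni1 : i != o1 by rewrite -val_eqE /=; lia.
  have nj1 : j != o1 by rewrite -val_eqE /=; lia.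
  (* Beyond the first two positions, exchanging neighbours changes [kap] by a multiple of a product
     of two commutators, which is 0. *)
  rewrite /b tpermD // (negPf n01) scale1r /kap; apply/eqP.
  rewrite -subr_eq0 -/(kap _) -/(kap _) !kapE !ffunE !tpermD //.
  rewrite -mulrBr.
  have ij' : i.+1 = j by rewrite -ij addn1.
  have split2 (y : {ffun 'I_n -> U}) : subword y 2 n
      = subword y 2 i * (y i * y j) * subword y (i + 2) n.
    rewrite -(subword2 y ij') /subword -big_cat_nat ?leq_addr //=.
    rewrite -big_cat_nat //=; first by apply: leq_trans i2 (leq_addr _ _).
    by rewrite addn2 ij'.
  rewrite !split2 !ffunE tpermL tpermR.
  rewrite ![subword (pperm _ _) _ _]subword_pperm; first last.
  - by move=> k kk; rewrite tpermD // -val_eqE /=; lia.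
  - by move=> k kk; rewrite tpermD // -val_eqE /=; lia.
  rewrite -mulrBl -mulrBr !mulrA Zsub // -[_ * (x j * x i - _)]mulrA.
  by rewrite Zcc // mulr0 mul0r.
(* The symmetrizer [f1] and the sign idempotent [f2] are orthogonal: t is absorbed by [f1] with sign
   1 and by [f2] with sign -1. *)
pose f1 := twisted_idem F [set: 'S_n]%G (fun=> false).
pose f2 := twisted_idem F (fun_stab_group low) b.
have b1M : {in [set: 'S_n] &, forall g h : 'S_n, false = false (+) false} by [].
have f1l g : gunit F g * f1 = f1.
  by have := twisted_idemMl F b1M (in_setT g); rewrite scale1r.
have f1r g : f1 * gunit F g = f1.
  by have := twisted_idemMr F b1M (in_setT g); rewrite scale1r.
have Ht : t \in fun_stab low by apply: tperm_fun_stab.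
have bt : b t by rewrite /b tpermL.
have f12 : f1 * f2 = 0.
  apply: (eq_opp_charf0 charF0); have := twisted_idemMl F bM Ht.
  by rewrite bt scaleN1r -mulrN => <-; rewrite mulrA f1r.
have f21 : f2 * f1 = 0.
  apply: (eq_opp_charf0 charF0); have := twisted_idemMr F bM Ht.
  by rewrite bt scaleN1r -mulNr => <-; rewrite -mulrA f1l.
have f11 : f1 * f1 = f1 by apply: (twisted_idemK charF0 b1M).
have f22 : f2 * f2 = f2 by apply: (twisted_idemK charF0 bM).
pose Sym := wact (@word1 F U n) f1.
have kap_f2 x : (forall i, Z (x i)) -> wact kap f2 x = kap x.
  exact: (wact_twisted_idem charF0 kapH).
have kap_f1 x : (forall i, Z (x i)) -> wact kap f1 x = 0.
  move=> Zx; transitivity (wact (wact kap f2) f1 x).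
    by apply: eq_wact Zx => y Zy; rewrite kap_f2.
  by rewrite -wactM f21 /wact big1 // => s _; rewrite ffunE scale0r.
(* A single generator: [f1] and [f2] recover the two summands from it. *)
pose w0 x := Sym x + kap x.
have w0f1 x : (forall i, Z (x i)) -> wact w0 f1 x = Sym x.
  by move=> Zx; rewrite wactDl kap_f1 // addr0 /Sym -wactM f11.
have w0f2 x : (forall i, Z (x i)) -> wact w0 f2 x = kap x.
  move=> Zx; rewrite wactDl kap_f2 // /Sym -wactM f12.
  by rewrite /wact big1 ?add0r // => s _; rewrite ffunE scale0r.
have diff_kap (i : nat) (lti : (i.+1 < n)%N) : exists a, forall x,
    (forall i, Z (x i)) ->
    word1 x - word1 (pperm (tperm (Ordinal (ltnW lti)) (Ordinal lti)) x)
      = wact kap a x.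
  elim: i lti => [|i IHi] lti.
    exists (gunit F 1%g) => x Zx; rewrite wact_gunit pperm1 /kap.
    by congr (_ - word1 (pperm (tperm _ _) x)); apply: val_inj.
  have [a aP] := IHi (ltnW lti).
  set k1 := Ordinal lti; set j1 := Ordinal (ltnW lti).
  pose i1 := Ordinal (ltnW (ltnW lti)).
  have nij : i1 != j1 by rewrite -val_eqE /=; lia.
  have nik : i1 != k1 by rewrite -val_eqE /=; lia.
  have njk : j1 != k1 by rewrite -val_eqE /=; lia.
  (* The commutator of the letters at j1 and k1 is central, so the letter at i1 may be moved behind
     it. After the 3-cycle c the same element is a difference at i1 and j1. *)
  pose c := (tperm i1 j1 * tperm i1 k1)%g.
  exists (a * gunit F c) => x Zx; have Zcx := pperm_in c Zx.
  have -> : wact kap (a * gunit F c) x = wact kap a (pperm c x).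
    by rewrite wactM wact_gunit.
  have ci : c i1 = j1 by rewrite permM tpermL tpermD // eq_sym.
  have cj : c j1 = k1 by rewrite permM tpermR tpermL.
  have ck : c k1 = i1 by rewrite permM [tperm i1 j1 _]tpermD // tpermR.
  rewrite -aP // [LHS]diffE //.
  rewrite (_ : Ordinal _ = i1); last exact: val_inj.
  rewrite (_ : Ordinal _ = j1); last exact: val_inj.
  rewrite (diffE (pperm c x) i1 j1) // !ffunE ci cj; congr (_ * _).
  have cfix (l : 'I_n) : (l < i1)%N || (k1 < l)%N -> c l = l.
    move=> nl; rewrite permM !tpermD // -val_eqE /=; move: nl => /=; lia.
  have -> : subword x 0 j1 = subword x 0 i1 * x i1.
    by rewrite /subword big_nat_recr //= -(nthx_ord x i1).
  have -> : subword (pperm c x) (i1 + 2) n = x i1 * subword x (j1 + 2) n.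
    rewrite (_ : (i1 + 2)%N = k1); last by rewrite addn2.
    rewrite subword_recl ?ltn_ord // ffunE ck; congr (_ * _).
    rewrite addn2; apply: eq_subword => l /andP[kl _].
    by rewrite ffunE cfix // orbC kl.
  rewrite !mulrA; congr (_ * _ * _); apply/esym.
  by apply: subword_pperm => l /andP[_ li]; rewrite cfix ?li.
have gen s : exists a, forall x, (forall i, Z (x i)) ->
    word1 x - word1 (pperm s x) = wact kap a x.
  elim/fun_stab_adjacent_ind: s => [|s r [a aP] [a' aP']|i j ij].
  - exists 0 => x _; rewrite pperm1 subrr /wact big1 // => s _.
    by rewrite ffunE scale0r.
  - exists (a' + a * gunit F r) => x Zx; rewrite wactD -aP' // wactM wact_gunit.
    by rewrite -aP ?ppermM ?addrA ?subrK //; apply: pperm_in.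
  have lti : (i.+1 < n)%N by rewrite ij.
  have [a aP] := diff_kap i lti; exists a => x Zx; rewrite -aP //.
  by congr (_ - word1 (pperm (tperm _ _) x)); apply: val_inj.
(* The average over all s of the relations in [gen]. *)
have [eta etaP] : exists a, forall x, (forall i, Z (x i)) ->
    word1 x - Sym x = wact kap a x.
  have /fin_all_exists[a aP] := gen.
  exists (#|[set: 'S_n]|%:R^-1 *: \sum_(s in [set: 'S_n]) a s) => x Zx.
  have nG := card_group_neq0 charF0 [set: 'S_n]%G.
  have -> : word1 x = #|[set: 'S_n]|%:R^-1 *: (\sum_(s in [set: 'S_n]) word1 x).
    by rewrite sumr_const -scaler_nat scalerA mulVf ?scale1r.
  rewrite /Sym /f1 /twisted_idem !wactZ !wact_sum -scalerBr -sumrB.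
  congr (_ *: _); apply: eq_bigr => s _.
  by rewrite -aP // scale1r wact_gunit.
apply: (gelfand_line_ok (f := f1 + f2) (w := w0) qe).
- by rewrite mulrDl !mulrDr f11 f12 f21 f22 addr0 add0r.
- apply: ginv_comm => [|g].
    by rewrite ginvD (ginv_twisted_idem _ b1M) (ginv_twisted_idem _ bM).
  have expand h : (f1 + f2) * gunit F h * (f1 + f2) = f1 + f2 * gunit F h * f2.
    by rewrite mulrDl f1r mulrDl !mulrDr f11 f12 addr0 -mulrA f1l f21 add0r.
  rewrite !expand; congr (_ + _).
  have [h Hh es] := fun_stab_double_coset (fun i : 'I_n => (i < 2)%N) g.
  exact: (twisted_idem_inv _ bM Hh Hh).
- by move=> x Zx; rewrite wactD w0f1 // w0f2.
(* word1 = Sym + kap eta = w0 (f1 + f2 eta). *)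
move=> s; exists ((f1 + f2 * eta) * gunit F s) => x Zx.
have Zsx := pperm_in s Zx.
rewrite wactM wact_gunit wactD w0f1 // wactM.
have -> : wact (wact w0 f2) eta (pperm s x) = wact kap eta (pperm s x).
  by apply: eq_wact Zsx => y Zy; rewrite w0f2.
rewrite -etaP //.
by rewrite addrC subrK.
Qed.

End LineCases.

(** * Skew elements commuting with the symmetric ones *)

Section NcIdentities.

Variable R : nzRingType.
Implicit Types a b c d q s k x : R.

#[local] Instance nc_ring_ops : @Ncring.Ring_ops R 0 1 (@GRing.add R)
  (@GRing.mul R) (fun x y => x - y) (@GRing.opp R) (@eq R) := {}.

#[local] Instance nc_ring : @Ncring.Ring R 0 1 (@GRing.add R)
  (@GRing.mul R) (fun x y => x - y) (@GRing.opp R) (@eq R) nc_ring_ops.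
Proof.
split; [exact _ | by move=> ? ? -> ? ? -> | by move=> ? ? -> ? ? ->
  | by move=> ? ? -> ? ? -> | by move=> ? ? -> | exact: add0r | exact: addrC
  | exact: addrA | exact: mul1r | exact: mulr1 | exact: mulrA | exact: mulrDl
  | by move=> x y z; exact: mulrDr | by [] | exact: subrr].
Qed.

Definition jord a b := a * b + b * a.
Definition lie a b := a * b - b * a.
(** On skew elements commuting with all symmetric ones it is alternating, and 3 [trip] is twice the
    standard polynomial of degree 3, the cyclic sum in [lie_sum_nc]. *)
Definition trip a b d := jord (lie a b) d.

Ltac nc := rewrite /trip /jord /lie ?mulrS ?mulr0n; Ncring_tac.non_commutative_ring.

(** The identities of this section hold in every ring. Where correction terms occur, most are
    arranged as commutators of a symmetric element, often a [jord] of skew ones, with a skew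
    element, so that they vanish in the application. *)
Lemma trip_cyc_nc a b d :
  trip a b d - trip b d a = lie (jord a d) b.
Proof. nc. Qed.

Lemma tripN a b d : trip b a d = - trip a b d.
Proof. nc. Qed.

Lemma jordC a b : jord a b = jord b a.
Proof. nc. Qed.

Lemma lieN a b : lie b a = - lie a b.
Proof. nc. Qed.

Lemma lie_swap_nc a b s k :
  (a * (s + k) * b - b * (s + k) * a) *+ 4
    - ((s + k) * lie a b + (s - k) * lie a b *+ 3
       - lie a b * (s + k) + lie a b * (s - k))
  = - lie s a * b *+ 4 + lie s b * a *+ 4
    - lie (jord k b) a *+ 2 + lie (jord k a) b *+ 2.
Proof. nc. Qed.

Lemma lie_lie_nc a b c :
  lie b (lie a c) - (jord a b * c - jord b c * a) *+ 2
  = lie (jord b c) a - lie (jord a b) c.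
Proof. nc. Qed.

Lemma jord_mul_nc q d x :
  (jord q d * x - jord d x * q) *+ 2 - lie d (lie q x)
  = lie (jord d q) x - lie (jord d x) q.
Proof. nc. Qed.

Lemma lie_sum_nc a b d :
  (lie a b * d + lie b d * a + lie d a * b) *+ 2
  = trip a b d + trip b d a + trip d a b.
Proof. nc. Qed.

Lemma lie_sumr_nc a b d :
  (d * lie a b + a * lie b d + b * lie d a) *+ 2
  = trip a b d + trip b d a + trip d a b.
Proof. nc. Qed.

Lemma lie_mul_nc d J b J' a :
  lie d (J * b - J' * a) = J * lie d b - J' * lie d a
     - lie J d * b + lie J' d * a.
Proof. nc. Qed.

Lemma trip_mid_nc a b d k :
  jord k d * lie a b + jord k a * lie b d + jord k b * lie d a
  - (lie a b * d + lie b d * a + lie d a * b) * k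
  = lie a b * k * d + lie b d * k * a + lie d a * k * b
    + (lie (jord k d) (lie a b) + lie (jord k a) (lie b d)
       + lie (jord k b) (lie d a)).
Proof. nc. Qed.

Lemma trip_midr_nc a b d k :
  jord k d * lie a b + jord k a * lie b d + jord k b * lie d a
  - k * (d * lie a b + a * lie b d + b * lie d a)
  = d * k * lie a b + a * k * lie b d + b * k * lie d a.
Proof. nc. Qed.

Lemma lie_lieN a b x : lie (lie a b) x = - lie x (lie a b).
Proof. nc. Qed.

Lemma trip4_nc (Jed Jea Jeb Jad Jab Jbd a b d e : R) :
  (Jed * lie a b + Jea * lie b d + Jeb * lie d a)
  - (Jad * lie e b + Jea * lie b d + Jab * lie d e)
  - (Jbd * lie a e + Jab * lie e d + Jeb * lie d a)
  - (Jed * lie a b + Jad * lie b e + Jbd * lie e a) = 0.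
Proof. nc. Qed.

Lemma trip_mul_sum_nc Tx Ja Jb Jd a b d :
  (Tx - Jd * lie a b) *+ 2 - (Jb * lie d a - Ja * lie d b) *+ 2
  + ((Tx - Ja * lie b d) *+ 2 - (Jd * lie a b - Jb * lie a d) *+ 2)
  + ((Tx - Jb * lie d a) *+ 2 - (Ja * lie b d - Jd * lie b a) *+ 2)
  = Tx *+ 6 - (Jd * lie a b + Ja * lie b d + Jb * lie d a) *+ 6.
Proof. nc. Qed.

Lemma sym_sum_nc s a b d p q r :
  p * s * a + q * s * b + r * s * d
  = s * (p * a + q * b + r * d)
    - (lie s p * a + lie s q * b + lie s r * d).
Proof. nc. Qed.

Lemma lie_trip_nc s a b d :
  lie s (trip a b d) = jord (lie s (lie a b)) d + jord (lie a b) (lie s d).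
Proof. nc. Qed.

Lemma trip_sum_nc t s k Qs Qk :
  (Qs + Qk) *+ 4 - t * ((s + k) + (s - k) *+ 2) *+ 2
  = (Qs *+ 2 - s * t *+ 3) *+ 2 + (Qk *+ 2 + t * k) *+ 2 + lie s t *+ 6.
Proof. nc. Qed.

Lemma jord_assoc_nc a b c : jord (jord a c) b - jord a (jord c b) = lie c (lie a b).
Proof. nc. Qed.

Lemma lie_jord_nc a b c : lie (jord a b) c = jord a (lie b c) + jord b (lie a c).
Proof. nc. Qed.

End NcIdentities.

Section SkewAlgebra.

Variables (F : fieldType) (charF0 : [pchar F] =i pred0) (U : algType F).

(* In the application, [D] is the unitization of the component of degree 1. *)
Variables (D : U -> Prop) (star : U -> U).
Hypotheses (D_lin : forall k a b, D a -> D b -> D (k *: a + b)) (D1 : D 1).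
Hypotheses (D_mul : forall a b, D a -> D b -> D (a * b)).
Hypotheses (D_star : forall a, D a -> D (star a)).
Hypothesis star_lin : forall k a b, star (k *: a + b) = k *: star a + star b.
Hypothesis starK : involutive star.
Hypothesis star_mul : forall a b, star (a * b) = star b * star a.

Definition skew_elt (a : U) := D a /\ star a = - a.

Hypothesis sym_comm : forall d z, D d -> star d = d -> skew_elt z -> lie d z = 0.

Lemma starD a b : star (a + b) = star a + star b.
Proof. by rewrite -[a]scale1r star_lin !scale1r. Qed.

Lemma starB a b : star (a - b) = star a - star b.
Proof. by rewrite addrC -scaleN1r star_lin scaleN1r addrC. Qed.

Lemma D_add a b : D a -> D b -> D (a + b).
Proof. by move=> Da Db; rewrite -[a]scale1r; apply: D_lin. Qed.

Lemma D_sub a b : D a -> D b -> D (a - b).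
Proof. by move=> Da Db; rewrite addrC -scaleN1r; apply: D_lin. Qed.

Lemma addD_subD (v w : U) : v + w + (v - w) = v *+ 2.
Proof. by rewrite addrACA subrr addr0 mulr2n. Qed.

Lemma addB_subD (v w : U) : v + w - (v - w) = w *+ 2.
Proof. by rewrite opprB [v + w]addrC addrACA subrr addr0 mulr2n. Qed.

Lemma skew_lie a b : skew_elt a -> skew_elt b -> skew_elt (lie a b).
Proof.
move=> [Da sa] [Db sb]; split; first by apply: D_sub; apply: D_mul.
by rewrite starB !star_mul sa sb !mulrNN opprB.
Qed.

Lemma lie_jord a b c : skew_elt a -> skew_elt b -> skew_elt c -> lie (jord a b) c = 0.
Proof.
move=> [Da sa] [Db sb]; apply: sym_comm; first by apply: D_add; apply: D_mul.
by rewrite starD !star_mul sa sb !mulrNN addrC.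
Qed.

Lemma lie_trip a b d c : skew_elt a -> skew_elt b -> skew_elt d -> skew_elt c ->
  lie (trip a b d) c = 0.
Proof. by move=> sa sb; apply: lie_jord; apply: skew_lie. Qed.

Lemma trip_cyc a b d : skew_elt a -> skew_elt b -> skew_elt d -> trip a b d = trip b d a.
Proof. by move=> sa sb sd; apply/eqP; rewrite -subr_eq0 trip_cyc_nc lie_jord. Qed.

Lemma tripNr a b d : skew_elt a -> skew_elt b -> skew_elt d -> trip a d b = - trip a b d.
Proof. by move=> sa sb sd; rewrite trip_cyc // tripN -trip_cyc // -trip_cyc. Qed.

Lemma lie_sym v z : D v -> skew_elt z -> lie (v + star v) z = 0.
Proof.
move=> Dv; apply: sym_comm; first by apply: D_add => //; apply: D_star.
by rewrite starD starK addrC.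
Qed.

Lemma skew_sub v : D v -> skew_elt (v - star v).
Proof.
move=> Dv; split; first by apply: D_sub => //; apply: D_star.
by rewrite starB starK opprB.
Qed.

(** Write 2v = s + k with s = v + [star v] symmetric and k = v - [star v] skew; s commutes with a
    and b, and so do the Jordan products of k with a and with b. Antisymmetrizing around v thus
    leaves only commutators of a and b at the ends of v or [star v]. *)
Lemma lie_swap a b v : skew_elt a -> skew_elt b -> D v ->
  (a * v * b - b * v * a) *+ 4
  = v * lie a b + star v * lie a b *+ 3 - lie a b * v + lie a b * star v.
Proof.
move=> sa sb Dv; apply: (mulrn_charf0_inj charF0 (m := 2)) => //.
have := lie_swap_nc a b (v + star v) (v - star v).
have sk := skew_sub Dv.
rewrite !(lie_sym Dv) // !lie_jord // !(oppr0, mul0r, mul0rn, addr0).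
move/eqP; rewrite subr_eq0 => /eqP.
rewrite addD_subD addB_subD.
rewrite !(mulrnAl, mulrnAr) -!mulrnBl -mulrnA mulnC mulrnA => ->.
by rewrite -!mulrnA mulnC mulrnA -!(mulrnBl, mulrnDl).
Qed.

(** With q = [a,b], both [trip] times x and [q,x] are expressed through Jordan products of skew
    elements, which commute with skew elements; the double commutator of d with [q,x] links the
    two. *)
Lemma trip_mul a b d x : skew_elt a -> skew_elt b -> skew_elt d -> skew_elt x ->
  trip a b d * x
  = jord x d * lie a b + jord x a * lie b d + jord x b * lie d a.
Proof.
have one a' b' d' : skew_elt a' -> skew_elt b' -> skew_elt d' -> skew_elt x ->
    (trip a' b' d' * x - jord d' x * lie a' b') *+ 2
    = (jord x b' * lie d' a' - jord a' x * lie d' b') *+ 2.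
  move=> sa sb sd sx; have sq := skew_lie sa sb.
  have /eqP := jord_mul_nc (lie a' b') d' x.
  rewrite !lie_jord // subr0 subr_eq0 => /eqP ->.
  rewrite lie_lieN; have /eqP := lie_lie_nc a' x b'.
  rewrite !lie_jord // subr0 subr_eq0 => /eqP ->.
  rewrite -mulNrn opprB; have -> z : lie d' (z *+ 2) = lie d' z *+ 2.
    by rewrite /lie mulrnAl mulrnAr -mulrnBl.
  by rewrite lie_mul_nc !lie_jord // !mul0r oppr0 !addr0.
move=> sa sb sd sx; apply: (mulrn_charf0_inj charF0 (m := 6)) => //.
have := one a b d sa sb sd sx; have := one b d a sb sd sa sx.
have := one d a b sd sa sb sx.
rewrite -(trip_cyc sd sa sb) -(trip_cyc sb sd sa) -(trip_cyc sa sb sd) => e1 e2 e3.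
apply/eqP; rewrite -subr_eq0 -trip_mul_sum_nc; apply/eqP.
rewrite [jord x b]jordC [jord x a]jordC [jord x d]jordC in e1 e2 e3 *.
by rewrite e1 e2 e3 !subrr !addr0.
Qed.

Lemma lie_sym_trip v a b d : skew_elt a -> skew_elt b -> skew_elt d -> D v ->
  lie (v + star v) (trip a b d) = 0.
Proof.
move=> sa sb sd Dv; rewrite lie_trip_nc !(lie_sym Dv) //; last exact: skew_lie.
by rewrite /jord !mul0r !mulr0 !addr0.
Qed.

Lemma trip_sum3 a b d : skew_elt a -> skew_elt b -> skew_elt d ->
  trip a b d + trip b d a + trip d a b = trip a b d *+ 3.
Proof.
move=> sa sb sd; rewrite (trip_cyc sd sa sb) -(trip_cyc sa sb sd).
by rewrite !mulrS mulr0n addr0 addrA.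
Qed.

(** Since 2v = s + k and 2(v + 2 [star v]) = 3s - k, the values of Q on the symmetric s and the skew
    k carry the coefficients 3 and -1. *)
Lemma trip_sum_of t v (Q : U -> U) : D v -> (forall x y, Q (x + y) = Q x + Q y) ->
    lie (v + star v) t = 0 ->
    Q (v + star v) *+ 2 = (v + star v) * t *+ 3 ->
    Q (v - star v) *+ 2 = - (t * (v - star v)) ->
  Q v *+ 2 = t * (v + star v *+ 2).
Proof.
move=> Dv QD st Qs Qk; apply: (mulrn_charf0_inj charF0 (m := 4)) => //.
have := trip_sum_nc t (v + star v) (v - star v) (Q (v + star v)) (Q (v - star v)).
rewrite Qs Qk st subrr addNr !mul0rn !addr0 -QD => /eqP.
rewrite addD_subD addB_subD.
have -> : Q (v *+ 2) = Q v *+ 2 by rewrite !mulr2n QD.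
by rewrite subr_eq0 => /eqP ->; rewrite -mulrnDl mulrnAr -mulrnA.
Qed.

(** A symmetric v can be pulled out, leaving v times the standard polynomial; for a skew v,
    [trip_mul] yields the difference of v multiplied by [trip] and by the standard polynomial. *)
Lemma trip_sum a b d v : skew_elt a -> skew_elt b -> skew_elt d -> D v ->
  (lie a b * v * d + lie b d * v * a + lie d a * v * b) *+ 2
  = trip a b d * (v + star v *+ 2).
Proof.
move=> sa sb sd Dv; have [sab sbd sda] :=
  And3 (skew_lie sa sb) (skew_lie sb sd) (skew_lie sd sa).
have sum2 := etrans (lie_sum_nc a b d) (trip_sum3 sa sb sd).
apply: (trip_sum_of (Q := fun v => lie a b * v * d + lie b d * v * a + lie d a * v * b)) => //.
- move: (lie a b) (lie b d) (lie d a) => p q r x y.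
  by rewrite !mulrDr !mulrDl [RHS]addrACA; congr (_ + _); rewrite addrACA.
- exact: lie_sym_trip.
- rewrite sym_sum_nc !(lie_sym Dv) // !mul0r !addr0 subr0.
  by rewrite -[RHS]mulrnAr -sum2 mulrnAr.
have sk := skew_sub Dv; move: (v - star v) sk => k sk.
have -> : lie a b * k * d + lie b d * k * a + lie d a * k * b
    = trip a b d * k - (lie a b * d + lie b d * a + lie d a * b) * k.
  by rewrite trip_mul // trip_mid_nc !lie_jord // !addr0.
rewrite mulrnBl -[in X in _ - X]mulrnAl sum2 mulrnAl !mulrS mulr0n addr0 !opprD !addrA.
by rewrite addrK addrAC subrr add0r.
Qed.

Lemma trip_sumr a b d v : skew_elt a -> skew_elt b -> skew_elt d -> D v ->
  (d * v * lie a b + a * v * lie b d + b * v * lie d a) *+ 2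
  = trip a b d * (v + star v *+ 2).
Proof.
move=> sa sb sd Dv; have [sab sbd sda] :=
  And3 (skew_lie sa sb) (skew_lie sb sd) (skew_lie sd sa).
have sum2 := etrans (lie_sumr_nc a b d) (trip_sum3 sa sb sd).
apply: (trip_sum_of (Q := fun v => d * v * lie a b + a * v * lie b d + b * v * lie d a)) => //.
- move: (lie a b) (lie b d) (lie d a) => p q r x y.
  by rewrite !mulrDr !mulrDl [RHS]addrACA; congr (_ + _); rewrite addrACA.
- exact: lie_sym_trip.
- rewrite sym_sum_nc !(lie_sym Dv) // !mul0r !addr0 subr0.
  by rewrite -[RHS]mulrnAr -sum2 mulrnAr.
have sk := skew_sub Dv; move: (v - star v) sk => k sk.
have -> : d * k * lie a b + a * k * lie b d + b * k * lie d a
    = trip a b d * k - k * (d * lie a b + a * lie b d + b * lie d a).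
  by rewrite trip_mul // trip_midr_nc.
rewrite mulrnBl -[in X in _ - X]mulrnAr sum2 mulrnAr.
have /eqP := lie_trip sa sb sd sk; rewrite subr_eq0 => /eqP <-.
rewrite !mulrS mulr0n addr0 !opprD !addrA.
by rewrite addrK subrr add0r.
Qed.

(** Expanded by [trip_mul], the products of a [jord] and a [lie] cancel in pairs. *)
Lemma trip4 a b d e : skew_elt a -> skew_elt b -> skew_elt d -> skew_elt e ->
  trip a b d * e - trip e b d * a - trip a e d * b - trip a b e * d = 0.
Proof.
move=> sa sb sd se; rewrite !trip_mul //.
rewrite [jord a e]jordC [jord b e]jordC [jord d e]jordC.
rewrite [jord b a]jordC [jord d a]jordC [jord d b]jordC.
exact: trip4_nc.
Qed.

Lemma star_one : star 1 = 1.
Proof. by rewrite -[star 1]mul1r -{1}[1]starK -star_mul mul1r starK. Qed.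

Lemma lie0_comm (a b : U) : lie a b = 0 -> a * b = b * a.
Proof. by move=> /eqP; rewrite subr_eq0 => /eqP. Qed.

(** * Words in commuting-with-symmetric skew letters, rewritten along a tableau *)

Section SkewWords.

Variables (n : nat) (row col : 'I_n -> nat).
Hypothesis row_col_inj : forall i j, row i = row j -> col i = col j -> i = j.
Hypothesis col_down : forall i r, (r <= row i)%N ->
  exists2 j, row j = r & col j = col i.

(* The letter [inr (a, b)] stands for the commutator of the variables a, b. *)
Let letter : eqType := ('I_n + 'I_n * 'I_n)%type.
Let triple : eqType := ('I_n * 'I_n * 'I_n)%type.

Implicit Types (x : {ffun 'I_n -> U}) (w u v : seq letter) (T : seq triple).

Definition lsupp (l : letter) : seq 'I_n :=
  match l with inl i => [:: i] | inr p => [:: p.1; p.2] end.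
Definition tsupp (t : triple) : seq 'I_n := [:: t.1.1; t.1.2; t.2].

Definition lval x (l : letter) : U :=
  match l with inl i => x i | inr p => lie (x p.1) (x p.2) end.
Definition wval x w : U := \prod_(l <- w) lval x l.
Definition tval x (t : triple) : U := trip (x t.1.1) (x t.1.2) (x t.2).
Definition sval T w x : U := (\prod_(t <- T) tval x t) * wval x w.

Local Notation onZ x := (forall i, skew_elt (x i)).
Local Notation coyoung := (col_alt col F * row_sym row F).

Definition good (Phi w : {ffun 'I_n -> U} -> U) : Prop :=
  exists k, forall x, onZ x -> wact w coyoung x = k *: Phi x.

Lemma wact_scale (w : {ffun 'I_n -> U} -> U) k (a : galg F 'S_n) x :
  wact (fun y => k *: w y) a x = k *: wact w a x.
Proof.
rewrite /wact scaler_sumr; apply: eq_bigr => s _.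
by rewrite !scalerA mulrC.
Qed.

Lemma wact_comp (w : {ffun 'I_n -> U} -> U) s (a : galg F 'S_n) x :
  wact (fun y => w (pperm s y)) a x = wact w (gunit F s * a) x.
Proof.
by rewrite wactM; apply: eq_bigr => r _; rewrite wact_gunit.
Qed.

Lemma wact_col (w : {ffun 'I_n -> U} -> U) c x : c \in fun_stab col ->
  wact (fun y => w (pperm c y)) coyoung x = (-1) ^+ (c : bool) *: wact w coyoung x.
Proof.
by move=> Cc; rewrite wact_comp mulrA col_altMl // -scalerAl wactZ.
Qed.

Lemma good_eq Phi (w w' : {ffun 'I_n -> U} -> U) : (forall x, onZ x -> w x = w' x) ->
  good Phi w' -> good Phi w.
Proof.
move=> ww' [k w'k]; exists k => x Zx; rewrite -w'k //.
exact: (eq_wact ww').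
Qed.

Lemma good0 Phi : good Phi (fun=> 0).
Proof.
by exists 0 => x _; rewrite scale0r /wact big1 // => s _; rewrite scaler0.
Qed.

Lemma good_add Phi (w w' : {ffun 'I_n -> U} -> U) : good Phi w -> good Phi w' ->
  good Phi (fun x => w x + w' x).
Proof.
move=> [k wk] [k' wk']; exists (k + k') => x Zx.
by rewrite wactDl wk // wk' // scalerDl.
Qed.

Lemma good_scale Phi k (w : {ffun 'I_n -> U} -> U) : good Phi w -> good Phi (fun x => k *: w x).
Proof.
by move=> [l wl]; exists (k * l) => x Zx; rewrite wact_scale wl // scalerA.
Qed.

(** The column antisymmetrizer absorbs each c with its sign, so w and the signed average of its
    images under [cs] have the same image under e'. *)
Lemma good_absorb Phi (cs : seq 'S_n) (w w' : {ffun 'I_n -> U} -> U) : (0 < size cs)%N ->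
    {subset cs <= fun_stab col} ->
    (forall x, onZ x -> \sum_(c <- cs) (-1) ^+ (c : bool) *: w (pperm c x) = w' x) ->
  good Phi w' -> good Phi w.
Proof.
move=> cs_gt0 Ccs ww' [k w'k]; exists ((size cs)%:R^-1 * k) => x Zx.
rewrite -scalerA -w'k //.
have -> : wact w' coyoung x = (size cs)%:R *: wact w coyoung x.
  transitivity (wact (fun y => \sum_(c <- cs) (-1) ^+ (c : bool) *: w (pperm c y))
                     coyoung x).
    by apply: (eq_wact _ _ Zx) => y Zy; rewrite ww'.
  elim: (cs) Ccs => [|c l IHl] Cl.
    rewrite scale0r /wact big1 // => s _; rewrite big_nil scaler0 //.
  transitivity (wact (fun y => (-1) ^+ (c : bool) *: w (pperm c y)) coyoung x
     + wact (fun y => \sum_(c <- l) (-1) ^+ (c : bool) *: w (pperm c y)) coyoung x).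
    by rewrite -wactDl; apply: eq_bigr => s _; rewrite big_cons.
  rewrite IHl => [|d ld]; last by rewrite Cl // inE ld orbT.
  rewrite wact_scale wact_col; last by rewrite Cl ?mem_head.
  by rewrite scalerA -expr2 sqrr_sign -scalerDl -natr1 addrC.
have nz : (size cs)%:R != 0 :> F by have /pcharf0P-> := charF0; rewrite -lt0n.
by rewrite scalerA mulVf ?scale1r.
Qed.

Definition avoid (A : seq 'I_n) w :=
  forall l, l \in w -> forall i, i \in lsupp l -> i \notin A.
Definition avoidT (A : seq 'I_n) T :=
  forall t, t \in T -> forall i, i \in tsupp t -> i \notin A.

Lemma wval_fix (s : 'S_n) x w : (forall l, l \in w -> forall i, i \in lsupp l -> s i = i) ->
  wval (pperm s x) w = wval x w.
Proof.
move=> sw; apply: eq_big_seq => -[i|[i j]] lw /=; rewrite !ffunE.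
  by rewrite (sw _ lw) ?mem_head.
by rewrite !(sw _ lw) // !inE eqxx ?orbT.
Qed.

Lemma tprod_fix (s : 'S_n) x T : (forall t, t \in T -> forall i, i \in tsupp t -> s i = i) ->
  \prod_(t <- T) tval (pperm s x) t = \prod_(t <- T) tval x t.
Proof.
move=> sT; apply: eq_big_seq => -[[i j] k] tT; rewrite /tval /= !ffunE.
by rewrite !(sT _ tT) // !inE eqxx ?orbT.
Qed.

Lemma wval_cons x l w : wval x (l :: w) = lval x l * wval x w.
Proof. by rewrite /wval big_cons. Qed.

Lemma wval_cat x w w' : wval x (w ++ w') = wval x w * wval x w'.
Proof. by rewrite /wval big_cat. Qed.

Lemma skew_lval x l : onZ x -> skew_elt (lval x l).
Proof. by move=> Zx; case: l => [i|[i j]] //=; apply: skew_lie. Qed.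

Lemma D_wval x w : onZ x -> D (wval x w).
Proof.
move=> Zx; rewrite /wval; elim/big_ind: _ => // l _.
exact: (skew_lval l Zx).1.
Qed.

Lemma star_wval x w : onZ x ->
  star (wval x w) = (-1) ^+ (size w) *: wval x (rev w).
Proof.
move=> Zx; elim: w => [|l w IHw]; first by rewrite /wval big_nil star_one scale1r.
rewrite wval_cons star_mul IHw (skew_lval l Zx).2 /= rev_cons -cats1 wval_cat.
rewrite {3}/wval big_seq1 mulrN -scalerAl exprS mulN1r scaleNr.
by [].
Qed.

Lemma wval_comm t x w : onZ x -> (forall z, skew_elt z -> lie t z = 0) ->
  t * wval x w = wval x w * t.
Proof.
move=> Zx tz; rewrite /wval; elim/big_ind: _ => [|a b ea eb|l _].
- by rewrite mulr1 mul1r.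
- by rewrite mulrA ea -[LHS]mulrA eb mulrA.
exact/lie0_comm/tz/skew_lval.
Qed.

Lemma perm_split2 (S : eqType) (a b : S) (s R : seq S) : perm_eq s (a :: b :: R) ->
  exists u v s' : seq S, (s = u ++ a :: v ++ b :: s' \/ s = u ++ b :: v ++ a :: s')
    /\ perm_eq (u ++ v ++ s') R.
Proof.
move=> ps; have as_ : a \in s by rewrite (perm_mem ps) mem_head.
case/splitPr: as_ ps => u s1 ps.
have ps1 : perm_eq (u ++ s1) (b :: R).
  apply/seq.permP=> P; move/seq.permP/(_ P): ps; rewrite /= !count_cat /=; lia.
have : b \in u ++ s1 by rewrite (perm_mem ps1) mem_head.
rewrite mem_cat; case/orP=> [bu|bs].
  case/splitPr: bu ps1 => u1 u2 ps1; exists u1, u2, s1; split.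
    by right; rewrite -catA.
  apply/seq.permP=> P; move/seq.permP/(_ P): ps1; rewrite /= !count_cat /= ?count_cat; lia.
case/splitPr: bs ps1 => v s' ps1; exists u, v, s'; split; first by left.
apply/seq.permP=> P; move/seq.permP/(_ P): ps1; rewrite /= !count_cat /= ?count_cat; lia.
Qed.

Lemma avoid_perm A w w' : perm_eq w w' -> avoid A w' -> avoid A w.
Proof. by move=> pw Aw l; rewrite (perm_mem pw); apply: Aw. Qed.

(* By [lie_swap], antisymmetrizing two letters of a column merges them into a
   commutator. *)
Lemma good_pair Phi a b T R : a != b -> col a = col b ->
    avoid [:: a; b] R -> avoidT [:: a; b] T ->
    (forall w, perm_eq w (inr (a, b) :: R) -> good Phi (sval T w)) ->
  forall w, perm_eq w (inl a :: inl b :: R) -> good Phi (sval T w).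
Proof.
move=> nab cab aR aT gq w /perm_split2[u [v [w' [ew pR]]]].
pose t := tperm a b; have Ct : t \in fun_stab col by apply: tperm_fun_stab.
have tfix i : i \notin [:: a; b] -> t i = i.
  by rewrite !inE negb_or => /andP[ia ib]; rewrite tpermD // eq_sym.
have aall := avoid_perm pR aR.
have wt x w0 : {subset w0 <= u ++ v ++ w'} -> wval (pperm t x) w0 = wval x w0.
  by move=> sub; apply: wval_fix => l /sub lw i il; apply/tfix/(aall l).
have Tt x : \prod_(t0 <- T) tval (pperm t x) t0 = \prod_(t0 <- T) tval x t0.
  by apply: tprod_fix => t0 t0T i it0; apply/tfix/(aT t0).
have subu : {subset u <= u ++ v ++ w'} by move=> l lu; rewrite mem_cat lu.
have subv : {subset v <= u ++ v ++ w'} by move=> l lv; rewrite !mem_cat lv orbT.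
have subw : {subset w' <= u ++ v ++ w'} by move=> l lw; rewrite !mem_cat lw !orbT.
have ta x : pperm t x a = x b by rewrite ffunE tpermL.
have tb x : pperm t x b = x a by rewrite ffunE tpermR.
have gw : good Phi (sval T (u ++ inl a :: v ++ inl b :: w')).
  have n4 : 4%:R != 0 :> F by have /pcharf0P-> := charF0.
  pose q : letter := inr (a, b); pose sg : F := (-1) ^+ (size v).
  have gS l1 l2 : perm_eq (l1 ++ l2) v ->
      good Phi (sval T (u ++ l1 ++ q :: l2 ++ w')).
    move=> pl; apply: gq; apply/seq.permP=> P; move/seq.permP/(_ P): pR.
    by move/seq.permP/(_ P): pl; rewrite /q /= !count_cat /= !count_cat; lia.
  pose W l1 l2 := sval T (u ++ l1 ++ q :: l2 ++ w').
  (* The right-hand side of [lie_swap] with v the subword between a and b; by [star_wval], [star v]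
     is the reversed subword with sign [sg]. *)
  pose w2 x := 4%:R^-1 *: (W v [::] x + (sg * 3%:R) *: W (rev v) [::] x
                           + ((-1) *: W [::] v x + sg *: W [::] (rev v) x)).
  apply: (@good_absorb _ [:: 1%g; t] _ w2) => //.
  - by move=> c; rewrite in_cons mem_seq1 => /orP[] /eqP-> //; exact: group1.
  - move=> x Zx; rewrite !big_cons big_nil addr0 odd_perm1 scale1r pperm1.
    rewrite odd_tperm nab scaleN1r /w2 /W /sval Tt !(wval_cat, wval_cons) /=.
    rewrite !wt // ta tb; set X := \prod_(t0 <- T) _; set V := wval x v.
    have sV : sg *: wval x (rev v) = star V by rewrite /V star_wval.
    have := lie_swap (Zx a) (Zx b) (D_wval v Zx); rewrite -/V -sV.
    rewrite /wval !big_nil !mul1r; move: (lie (x a) (x b)) => q'.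
    rewrite -/(wval x u) -/(wval x w'); move: (wval x u) (wval x w') => u' y.
    rewrite -/(wval x (rev v)); move: (wval x (rev v)) => r {sV}.
    move: (x a) (x b) V => a' b' V e4; apply: (scalerI n4).
    rewrite [RHS]scalerA mulfV // scale1r scaler_nat.
    have -> : (X * (u' * (a' * (V * (b' * y)))) - X * (u' * (b' * (V * (a' * y))))) *+ 4
      = X * u' * ((a' * V * b' - b' * V * a') *+ 4) * y.
      by rewrite mulrnAr mulrnAl mulrBr mulrBl !mulrA.
    rewrite e4 -[_ *+ 3]scaler_nat [sg * _]mulrC; move: (3%:R : F) => k3.
    rewrite !(mulrDr, mulrDl) mulrN mulNr scaleN1r addrA.
    by rewrite -!(scalerAl, scalerAr) scalerA !mulrA.
  apply: good_scale; apply: good_add; apply: good_add.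
  - by apply: gS; rewrite cats0.
  - by apply: good_scale; apply: gS; rewrite cats0 perm_rev.
  - by apply: good_scale; apply: gS.
  - by apply: good_scale; apply: gS; rewrite perm_rev.
(* If b precedes a, the transposition of a and b leads back to the order just treated, at the cost
   of a sign. *)
case: ew => -> //; apply: (@good_absorb _ [:: t] _ (fun x => - sval T (u ++ inl
  a :: v ++ inl b :: w') x)) => //.
- by move=> c; rewrite mem_seq1 => /eqP->.
- move=> x _; rewrite big_seq1 odd_tperm nab scaleN1r; congr (- _).
  by rewrite /sval Tt !(wval_cat, wval_cons) /= !wt // ta tb.
apply: (good_eq _ (good_scale (-1) gw)) => x _.
by rewrite scaleN1r.
Qed.

(* By [trip_sum] and [trip_sumr], cyclic permutations merge a commutator and a
   third letter of the column into a triple product. *)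
Lemma good_trip Phi a b d T R : a != b -> a != d -> b != d ->
    col a = col b -> col a = col d ->
    avoid [:: a; b; d] R -> avoidT [:: a; b; d] T ->
    (forall w, perm_eq w R -> good Phi (sval (rcons T (a, b, d)) w)) ->
  forall w, perm_eq w (inr (a, b) :: inl d :: R) -> good Phi (sval T w).
Proof.
move=> nab nad nbd cab cad aR aT gq w /perm_split2[u [v [w' [ew pR]]]].
pose g := (tperm a b * tperm a d)%g.
have Cg : g \in fun_stab col by rewrite groupM ?tperm_fun_stab.
have oddg : odd_perm g = false by rewrite odd_permM !odd_tperm nab nad.
have ga : g a = b by rewrite permM tpermL tpermD // eq_sym.
have gb : g b = d by rewrite permM tpermR tpermL.
have gd : g d = a by rewrite permM [tperm a b d]tpermD ?tpermR.
have gfix i : i \notin [:: a; b; d] -> g i = i.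
  rewrite !inE !negb_or => /and3P[ia ib id].
  by rewrite permM [tperm a b i]tpermD ?tpermD // eq_sym.
clearbody g.
have aall := avoid_perm pR aR.
have wt x w0 : {subset w0 <= u ++ v ++ w'} -> wval (pperm g x) w0 = wval x w0.
  by move=> sub; apply: wval_fix => l /sub lw i il; apply/gfix/(aall l).
have Tt x : \prod_(t0 <- T) tval (pperm g x) t0 = \prod_(t0 <- T) tval x t0.
  by apply: tprod_fix => t0 t0T i it0; apply/gfix/(aT t0).
have subu : {subset u <= u ++ v ++ w'} by move=> l lu; rewrite mem_cat lu.
have subv : {subset v <= u ++ v ++ w'} by move=> l lv; rewrite !mem_cat lv orbT.
have subw : {subset w' <= u ++ v ++ w'} by move=> l lw; rewrite !mem_cat lw !orbT.
have n2 : 2%:R != 0 :> F by have /pcharf0P-> := charF0.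
pose sg : F := (-1) ^+ (size v).
pose T' := rcons T (a, b, d).
(* Half of v + 2 [star v] as in [trip_sum]; the triple product commutes with skew letters and is
   collected in [T']. *)
pose w2 x := 2%:R^-1 *: (sval T' (u ++ v ++ w') x
                           + (sg * 2%:R) *: sval T' (u ++ rev v ++ w') x).
apply: (@good_absorb _ [:: 1%g; g; (g * g)%g] _ w2) => //.
- move=> c; rewrite !in_cons in_nil orbF => /or3P[] /eqP->.
  + exact: group1.
  + exact: Cg.
  + exact: groupM.
- move=> x Zx; rewrite !big_cons big_nil addr0 odd_perm1 odd_permM oddg.
  rewrite !scale1r pperm1 ppermM.
  have Zgx := pperm_in g Zx.
  have sV : sg *: wval x (rev v) = star (wval x v) by rewrite star_wval.
  have tu : trip (x a) (x b) (x d) * wval x u = wval x u * trip (x a) (x b) (x d).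
    by apply: wval_comm => // z; apply: lie_trip.
  have tr1 := trip_sum (Zx a) (Zx b) (Zx d) (D_wval v Zx).
  have tr2 := trip_sumr (Zx a) (Zx b) (Zx d) (D_wval v Zx).
  apply: (scalerI n2); rewrite /w2 [RHS]scalerA mulfV // scale1r scaler_nat.
  rewrite /sval /T' -cats1 !big_cat !big_seq1 [tval x (a, b, d)]/tval.
  rewrite !wval_cat.
  have rhs X (t u0 V Vr y : U) : t * u0 = u0 * t ->
      X * t * (u0 * (V * y)) + (sg * 2%:R) *: (X * t * (u0 * (Vr * y)))
      = X * u0 * (t * (V + (sg *: Vr) *+ 2)) * y.
    move=> tu0; rewrite -[sg *: Vr *+ 2]scaler_nat scalerA [2%:R * _]mulrC.
    move: (sg * 2%:R) => k2; rewrite !(mulrDr, mulrDl) -!(scalerAl, scalerAr) !mulrA.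
    by rewrite -!(mulrA X) tu0.
  rewrite (rhs _ _ _ _ _ _ tu) sV.
  (* The commutator stands before d, which calls for [trip_sum], or after it, which calls for
     [trip_sumr]. *)
  case: ew => ->.
    rewrite -tr1 !(wval_cat, wval_cons) /= !Tt !wt // !ffunE !(ga, gb, gd).
    move: (lie (x a) _) (lie (x b) _) (lie (x d) _) => p q r.
    rewrite mulrnAr mulrnAl; congr (_ *+ 2).
    by rewrite !(mulrDr, mulrDl) !mulrA addrA.
  rewrite -tr2 !(wval_cat, wval_cons) /= !Tt !wt // !ffunE !(ga, gb, gd).
  move: (lie (x a) _) (lie (x b) _) (lie (x d) _) => p q r.
  rewrite mulrnAr mulrnAl; congr (_ *+ 2).
  by rewrite !(mulrDr, mulrDl) !mulrA addrA.
apply: good_scale; apply: good_add; first exact: gq.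
apply: good_scale; apply: gq; apply: perm_trans pR.
by rewrite perm_cat2l perm_cat2r perm_rev.
Qed.

(* By [trip4], antisymmetrizing four letters of a column gives zero. *)
Lemma good_quad Phi a b d e T R : uniq [:: a; b; d; e] ->
    col a = col b -> col a = col d -> col a = col e ->
    avoid [:: a; b; d; e] R -> avoidT [:: a; b; d; e] T ->
  forall w, perm_eq w (inl e :: R) -> good Phi (sval (rcons T (a, b, d)) w).
Proof.
move=> un cab cad cae aR aT w pw.
have : inl e \in w by rewrite (perm_mem pw) mem_head.
move=> we; case/splitPr: we pw => u w' pw.
have pR : perm_eq (u ++ w') R.
  apply/seq.permP=> P; move/seq.permP/(_ P): pw; rewrite /= !count_cat /=; lia.
have aall := avoid_perm pR aR.
move: un; rewrite /= !inE !negb_or !andbT.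
case/and3P=> /and3P[nab nad nae] /andP[nbd nbe] nde.
have subu : {subset u <= u ++ w'} by move=> l lu; rewrite mem_cat lu.
have subw : {subset w' <= u ++ w'} by move=> l lw; rewrite mem_cat lw orbT.
have key i : i \in [:: a; b; d] -> [/\ tperm i e \in fun_stab col,
    odd_perm (tperm i e) &
    forall x, (forall w0, {subset w0 <= u ++ w'} ->
                 wval (pperm (tperm i e) x) w0 = wval x w0)
      /\ \prod_(t0 <- T) tval (pperm (tperm i e) x) t0
         = \prod_(t0 <- T) tval x t0].
  move=> ii; have ie : i != e by move: ii; rewrite !inE => /or3P[]/eqP->.
  have fix1 j : j \notin [:: a; b; d; e] -> tperm i e j = j.
    rewrite !inE !negb_or => /and4P[ja jb jd je]; rewrite tpermD // 1?eq_sym //.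
    by move: ii; rewrite !inE => /or3P[]/eqP->.
  split.
  - by apply: tperm_fun_stab; rewrite -cae; move: ii; rewrite !inE => /or3P[]/eqP->.
  - by rewrite odd_tperm.
  move=> x; split=> [w0 sub|].
    by apply: wval_fix => l /sub lw j jl; apply/fix1/(aall l).
  by apply: tprod_fix => t0 t0T j jt; apply/fix1/(aT t0).
have [Ca oa Ka] := key a (mem_head _ _).
have [Cb ob Kb] : [/\ _, _ & _] := key b ltac:(by rewrite !inE eqxx orbT).
have [Cd od Kd] : [/\ _, _ & _] := key d ltac:(by rewrite !inE eqxx !orbT).
(* Exchanging e with each of a, b and d in turn produces the terms of [trip4]. *)
apply: (@good_absorb _ [:: 1%g; tperm a e; tperm b e; tperm d e] _ (fun=> 0)) => //;
  last exact: good0.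
- move=> c; rewrite !in_cons in_nil orbF => /or4P[] /eqP->.
  + exact: group1.
  + exact: Ca.
  + exact: Cb.
  + exact: Cd.
move=> x Zx; rewrite !big_cons big_nil addr0 odd_perm1 oa ob od.
rewrite scale1r pperm1 !scaleN1r /sval -cats1 !big_cat !big_seq1 /=.
have tE y : tval y (a, b, d) = trip (y a) (y b) (y d) by [].
rewrite !(wval_cat, wval_cons) /= !tE.
rewrite !(Ka x).1 // !(Kb x).1 // !(Kd x).1 // !(Ka x).2 !(Kb x).2 !(Kd x).2.
rewrite !ffunE !tpermL !tpermR.
rewrite ![tperm a e _]tpermD // ?[tperm b e _]tpermD // ?[tperm d e _]tpermD //;
  try by rewrite eq_sym.
have t4 := trip4 (Zx a) (Zx b) (Zx d) (Zx e).
have mv X i j k z y : X * trip (x i) (x j) (x k) * (wval x u * (z * y))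
    = X * wval x u * (trip (x i) (x j) (x k) * z) * y.
  have tu : trip (x i) (x j) (x k) * wval x u = wval x u * trip (x i) (x j) (x k).
    by apply: wval_comm => // z0; apply: lie_trip.
  by rewrite !mulrA -(mulrA X) tu !mulrA.
rewrite !mv.
move: (trip (x a) (x b) (x d)) (trip (x e) (x b) (x d)) (trip (x a) (x e) (x d))
  (trip (x a) (x b) (x e)) t4 => t1 t2 t3 t0 t4.
move: (\prod_(t0 <- T) _) (wval x u) (wval x w') => X u' y.
have -> : X * u' * (t1 * x e) * y + (- (X * u' * (t2 * x a) * y) + (-
  (X * u' * (t3 * x b) * y) - X * u' * (t0 * x d) * y))
  = X * u' * (t1 * x e - t2 * x a - t3 * x b - t0 * x d) * y.
  by rewrite !(mulrBr, mulrBl) !addrA.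
by rewrite t4 mulr0 !mul0r.
Qed.

(** * Merging one column after another *)

Section Columns.

Variable i0 : 'I_n.

Definition col_len c := #|[set i | col i == c]|.

Definition cellf c r : 'I_n := odflt i0 [pick i | (col i == c) && (row i == r)].

Lemma cellf_col_row i : cellf (col i) (row i) = i.
Proof.
rewrite /cellf; case: pickP => [j /andP[/eqP jc /eqP jr]|/(_ i)].
  exact: row_col_inj.
by rewrite !eqxx.
Qed.

(** A column with more than r entries reaches row r, since its entries lie in distinct rows;
    [col_down] then supplies the cell. *)
Lemma cellfP c r : (r < col_len c)%N -> row (cellf c r) = r /\ col (cellf c r) = c.
Proof.
move=> ltr; have [i /eqP ic ri] : exists2 i, col i == c & (r <= row i)%N.
  have [/existsP[i /andP[ic ri]]|] := boolP [exists i, (col i == c) && (r <= row i)%N].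
    by exists i.
  rewrite negb_exists => /forallP small; case: r => [|r] in ltr small *.
    move: ltr; rewrite card_gt0 => /set0Pn[i]; rewrite inE => ic.
    by move: (small i); rewrite ic.
  move: ltr; rewrite ltnNge => /negP[].
  rewrite -[X in (_ <= X)%N]card_ord /col_len.
  apply: (@leq_card_in _ _ (fun i => inord (row i) : 'I_r.+1)) => i j.
  rewrite !inE => /eqP ic /eqP jc /(congr1 val).
  have := small i; have := small j; rewrite ic jc eqxx /= -!ltnNge => jr ir.
  by rewrite !inordK // => rij; apply: row_col_inj; rewrite // ic jc.
have [j jr jc] := col_down ri.
by rewrite -ic -jc -jr cellf_col_row.
Qed.

Lemma row_lt_len i : (row i < col_len (col i))%N.
Proof.
have fP (r : 'I_(row i).+1) : row (cellf (col i) r) = r /\ col (cellf (col i) r) = col i.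
  have [j jr jc] := col_down (ltn_ord r : (r <= row i)%N).
  by rewrite -jc -jr cellf_col_row.
have finj : injective (fun r : 'I_(row i).+1 => cellf (col i) r).
  by move=> r r' eqc; apply: val_inj; rewrite /= -(fP r).1 eqc (fP r').1.
rewrite -[X in (X <= _)%N]card_ord -(card_imset _ finj).
apply/subset_leq_card/subsetP=> j /imsetP[r _ ->].
by rewrite inE (fP r).2.
Qed.

Definition cells j := [seq i <- enum 'I_n | (j <= col i)%N].

Lemma mem_cells i j : (i \in cells j) = (j <= col i)%N.
Proof. by rewrite /cells mem_filter mem_enum andbT. Qed.

Lemma cells_step j : perm_eq (cells j)
  ([seq cellf j r | r <- iota 0 (col_len j)] ++ cells j.+1).
Proof.
have uc k : uniq (cells k) by rewrite filter_uniq ?enum_uniq.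
apply: uniq_perm => //.
  rewrite cat_uniq uc andbT map_inj_in_uniq ?iota_uniq /=; last first.
    move=> r r'; rewrite !mem_iota /= => /cellfP[rr _] /cellfP[rr' _] e.
    by rewrite -rr e rr'.
  apply/hasPn=> i; rewrite mem_cells => ji.
  apply/mapP=> -[r]; rewrite mem_iota /= => /cellfP[_ rc] ei.
  by move: ji; rewrite ei rc ltnn.
move=> i; rewrite mem_cat !mem_cells leq_eqVlt.
congr (_ || _); apply/eqP/mapP => [->|[r]].
  by exists (row i); rewrite ?mem_iota ?row_lt_len ?cellf_col_row.
by rewrite mem_iota /= => /cellfP[_ rc] ->.
Qed.

Definition item c : letter :=
  if col_len c == 2%N then inr (cellf c 0, cellf c 1) else inl (cellf c 0).
Definition tri c : triple := (cellf c 0, cellf c 1, cellf c 2).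

Definition done_letters j := [seq item c | c <- iota 0 j & (0 < col_len c < 3)%N].
Definition done_triples j := [seq tri c | c <- iota 0 j & col_len c == 3%N].

(* The columns [c < j] have been merged, those of length 2 into commutators and
   those of length 3 into central triple products. *)
Definition good_all Phi j := forall w,
  perm_eq w (done_letters j ++ map inl (cells j)) -> good Phi (sval (done_triples j) w).

Lemma lsupp_item c i : (0 < col_len c < 3)%N -> i \in lsupp (item c) -> col i = c.
Proof.
move=> /andP[c0 c3]; rewrite /item; case: eqP => [c2|_]; rewrite !inE.
  by case/orP=> /eqP->; rewrite (cellfP _).2 ?c2.
by move/eqP->; rewrite (cellfP _).2.
Qed.

Lemma tsupp_tri c i : col_len c = 3%N -> i \in tsupp (tri c) -> col i = c.
Proof.
by move=> c3; rewrite !inE => /or3P[] /eqP->; rewrite (cellfP _).2 ?c3.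
Qed.

Lemma cells_avoid j A : {in A, forall i, col i = j} ->
  avoid A (done_letters j ++ map inl (cells j.+1)).
Proof.
move=> Aj l; rewrite mem_cat => /orP[/mapP[c]|/mapP[i]].
  rewrite mem_filter mem_iota /= => /andP[c3 cj] -> i /(lsupp_item c3) ic.
  by apply/negP=> /Aj; rewrite ic => ecj; rewrite ecj ltnn in cj.
rewrite mem_cells => ji -> k; rewrite inE => /eqP->.
by apply/negP=> /Aj ij; rewrite ij ltnn in ji.
Qed.

Lemma triples_avoid j A : {in A, forall i, col i = j} -> avoidT A (done_triples j).
Proof.
move=> Aj t /mapP[c]; rewrite mem_filter mem_iota /= => /andP[/eqP c3 cj] -> i.
by move/(tsupp_tri c3) => ic; apply/negP=> /Aj; rewrite ic => e; rewrite e ltnn in cj.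
Qed.

Lemma cellf_neq c r r' : (r < r')%N -> (r' < col_len c)%N -> cellf c r != cellf c r'.
Proof.
move=> rr' r'c; apply/eqP=> /(congr1 row).
rewrite (cellfP _).1 ?(ltn_trans rr') // (cellfP _).1 // => e.
by rewrite e ltnn in rr'.
Qed.

(** A column of length 2 is merged once, by [good_pair]; one of length 3 is merged by [good_pair]
    and then [good_trip]; shorter ones stay as they are. *)
Lemma good_all_step Phi j : (col_len j <= 3)%N -> good_all Phi j.+1 -> good_all Phi j.
Proof.
move=> len3 gall w; set R := done_letters j ++ map inl (cells j.+1).
have stepP : perm_eq (done_letters j ++ map inl (cells j))
    (map inl [seq cellf j r | r <- iota 0 (col_len j)] ++ R).
  apply: (@perm_trans _ (done_letters j ++ (map inl [seq cellf j r | r <- iota 0 (col_len j)]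
     ++ map inl (cells j.+1)))).
    by rewrite perm_cat2l -map_cat; apply: perm_map; apply: cells_step.
  by rewrite perm_catCA.
have dl : done_letters j.+1 = done_letters j
    ++ (if (0 < col_len j < 3)%N then [:: item j] else [::]).
  by rewrite /done_letters -[j.+1]addn1 iotaD filter_cat map_cat /=; case: ifP.
have dt : done_triples j.+1 = done_triples j
    ++ (if col_len j == 3%N then [:: tri j] else [::]).
  by rewrite /done_triples -[j.+1]addn1 iotaD filter_cat map_cat /=; case: ifP.
move=> pw; have := perm_trans pw stepP.
have cP r : (r < col_len j)%N -> col (cellf j r) = j by case/cellfP.
case len: (col_len j) len3 dl dt cP => [|[|[|[|k]]]] //= _ dl dt cP {}pw.
- apply: (good_eq (w' := sval (done_triples j.+1) w)) => [x _|].
    by rewrite dt cats0.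
  by apply: gall; rewrite dl cats0.
- apply: (good_eq (w' := sval (done_triples j.+1) w)) => [x _|].
    by rewrite dt cats0.
  apply: gall; apply: perm_trans pw _.
  by rewrite dl /item len -catA perm_sym -cat1s perm_catCA.
- apply: good_pair pw; rewrite ?cellf_neq ?len ?cP //.
  + by apply: cells_avoid => i; rewrite !inE => /orP[]/eqP->; rewrite cP.
  + by apply: triples_avoid => i; rewrite !inE => /orP[]/eqP->; rewrite cP.
  move=> w' pw'; apply: (good_eq (w' := sval (done_triples j.+1) w')) => [x _|].
    by rewrite dt cats0.
  apply: gall; apply: perm_trans pw' _.
  by rewrite dl /item len -catA perm_sym -cat1s perm_catCA.
- apply: good_pair pw; rewrite ?cellf_neq ?len ?cP //.
  + move=> l; rewrite inE => /orP[/eqP-> i|].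
      rewrite mem_seq1 => /eqP->; rewrite !inE negb_or.
      by rewrite ![cellf j 2 == _]eq_sym !cellf_neq ?len.
    by apply: cells_avoid => i; rewrite !inE => /orP[]/eqP->; rewrite cP.
  + by apply: triples_avoid => i; rewrite !inE => /orP[]/eqP->; rewrite cP.
  apply: good_trip; rewrite ?cellf_neq ?len ?cP //.
  + by apply: cells_avoid => i; rewrite !inE => /or3P[]/eqP->; rewrite cP.
  + by apply: triples_avoid => i; rewrite !inE => /or3P[]/eqP->; rewrite cP.
  move=> w' pw'; rewrite -cats1.
  apply: (good_eq (w' := sval (done_triples j.+1) w')) => [x _|].
    by rewrite dt.
  by apply: gall; rewrite dl cats0.
Qed.

(** Merging three entries and antisymmetrizing with a fourth gives 0, which is a multiple of any
    Phi. *)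
Lemma good_all_long Phi j : (3 < col_len j)%N -> good_all Phi j.
Proof.
move=> len4 w; set R := done_letters j ++ map inl (cells j.+1).
have cP r : (r < col_len j)%N -> col (cellf j r) = j by case/cellfP.
pose R' := map inl [seq cellf j r | r <- iota 4 (col_len j - 4)] ++ R.
have stepP : perm_eq (done_letters j ++ map inl (cells j))
    ([:: inl (cellf j 0); inl (cellf j 1); inl (cellf j 2); inl (cellf j 3)] ++ R').
  have -> : [:: inl (cellf j 0); inl (cellf j 1); inl (cellf j 2); inl (cellf j 3)] ++ R'
      = map inl [seq cellf j r | r <- iota 0 (col_len j)] ++ R :> seq letter.
    have -> : iota 0 (col_len j) = iota 0 4 ++ iota 4 (col_len j - 4).
      by rewrite -iotaD subnKC.
    by rewrite !map_cat -catA.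
  apply: (@perm_trans _ (done_letters j ++ (map inl [seq cellf j r | r <- iota 0 (col_len j)]
     ++ map inl (cells j.+1)))).
    by rewrite perm_cat2l -map_cat; apply: perm_map; apply: cells_step.
  by rewrite perm_catCA.
move=> pw; have {}pw := perm_trans pw stepP.
have l3 r : (r <= 3)%N -> (r < col_len j)%N by move/leq_ltn_trans; apply.
have av A : (forall i, i \in A -> exists2 r, (r <= 3)%N & i = cellf j r) ->
    avoid A R' /\ avoidT A (done_triples j).
  move=> Ar; split=> [l|].
    rewrite mem_cat => /orP[/mapP[i /mapP[r]]|].
      rewrite mem_iota => /andP[r4 rl] -> -> k; rewrite mem_seq1 => /eqP->.
      apply/negP=> /Ar[r' r3] /esym/eqP; apply/negP/cellf_neq.
        exact: leq_ltn_trans r4.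
      by move: rl; rewrite subnKC.
    by apply: cells_avoid => i /Ar[r r3 ->]; rewrite cP // l3.
  by apply: triples_avoid => i /Ar[r r3 ->]; rewrite cP // l3.
have avoid_cons A i (l : seq letter) : i \notin A -> avoid A l -> avoid A (inl i :: l).
  by move=> iA Al k; rewrite inE => /orP[/eqP-> m|/Al//]; rewrite mem_seq1 => /eqP->.
have [|av2 avT2] := av [:: cellf j 0; cellf j 1].
  by move=> i; rewrite !inE => /orP[]/eqP->; [exists 0 | exists 1].
have [|av3 avT3] := av [:: cellf j 0; cellf j 1; cellf j 2].
  by move=> i; rewrite !inE => /or3P[]/eqP->; [exists 0 | exists 1 | exists 2].
have [|av4 avT4] := av [:: cellf j 0; cellf j 1; cellf j 2; cellf j 3].
  by move=> i; rewrite !inE => /or4P[]/eqP->; [exists 0 | exists 1 | exists 2 | exists 3].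
have neq r r' : (r < r')%N -> (r' <= 3)%N -> cellf j r != cellf j r'.
  by move=> rr' r'3; apply: cellf_neq rr' _; apply: l3.
have c3n : cellf j 3 \notin [:: cellf j 0; cellf j 1; cellf j 2].
  by rewrite !inE !negb_or ![cellf j 3 == _]eq_sym !neq.
have c2n : cellf j 2 \notin [:: cellf j 0; cellf j 1].
  by rewrite !inE !negb_or ![cellf j 2 == _]eq_sym !neq.
have c3n' : cellf j 3 \notin [:: cellf j 0; cellf j 1].
  by move: c3n; rewrite !inE !negb_or => /and3P[-> ->].
apply: good_pair pw; rewrite ?neq ?cP ?l3 //.
  by apply: (avoid_cons) => //; apply: (avoid_cons).
apply: good_trip; rewrite ?neq ?cP ?l3 //.
  by apply: avoid_cons.
apply: good_quad; rewrite ?cP ?l3 //.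
by rewrite /= !inE !negb_or !neq.
Qed.

(** * Columns of length at most 3: sorting the merged letters *)

Section Short.

Hypothesis short : forall c, (col_len c <= 3)%N.
Variable M : nat.
Hypothesis colM : forall i, (col i < M)%N.

Let T := done_triples M.
Let P := done_letters M.

Definition lcol (l : letter) : nat :=
  match l with inl i => col i | inr p => col p.1 end.

Lemma lcol_item c : (0 < col_len c)%N -> lcol (item c) = c.
Proof.
by move=> c0; rewrite /item; case: eqP => [c2|_] /=; rewrite (cellfP _).2 ?c2.
Qed.

Lemma perm_item w l : perm_eq w P -> l \in w ->
  exists2 c, (0 < col_len c < 3)%N & l = item c.
Proof.
move=> pw; rewrite (perm_mem pw) => /mapP[c]; rewrite mem_filter => /andP[c3 _] ->.
by exists c.
Qed.

Lemma perm_lcol_uniq w : perm_eq w P -> uniq (map lcol w).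
Proof.
move=> pw; rewrite (perm_uniq (perm_map lcol pw)) -map_comp map_inj_in_uniq.
  by rewrite filter_uniq ?iota_uniq.
move=> c c'; rewrite !mem_filter => /andP[/andP[c0 _] _] /andP[/andP[c'0 _] _] /=.
by rewrite !lcol_item.
Qed.

Lemma wval_fix_cols (p : 'S_n) (s : pred nat) x w w' : perm_eq w P ->
    {subset w' <= w} -> (forall l, l \in w' -> ~~ s (lcol l)) ->
    (forall i, ~~ s (col i) -> p i = i) ->
  wval (pperm p x) w' = wval x w'.
Proof.
move=> pw sub nl pi; apply: wval_fix => l lw' i il; apply: pi.
have [c c3 el] := perm_item pw (sub _ lw'); subst l.
have := nl _ lw'; rewrite lcol_item; last by case/andP: c3.
by rewrite (lsupp_item c3 il).
Qed.

Lemma tprod_fix_cols (p : 'S_n) (s : pred nat) x T' : {subset T' <= T} ->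
    (forall c, col_len c = 3%N -> tri c \in T' -> ~~ s c) ->
    (forall i, ~~ s (col i) -> p i = i) ->
  \prod_(t <- T') tval (pperm p x) t = \prod_(t <- T') tval x t.
Proof.
move=> sub nt pi; apply: tprod_fix => t tT' i it; apply: pi.
have := sub _ tT'; case/mapP=> c; rewrite mem_filter => /andP[/eqP c3 _] et.
by subst t; rewrite (tsupp_tri c3 it); apply: nt.
Qed.

Lemma tperm_fix_cols (s : pred nat) i j : s (col i) -> s (col j) ->
  forall k, ~~ s (col k) -> tperm i j k = k.
Proof.
by move=> si sj k sk; rewrite tpermD //; apply: contraNneq sk => <-.
Qed.

Lemma uniq_mid (u v : seq letter) l : uniq (map lcol (u ++ l :: v)) ->
  forall k, k \in u ++ v -> lcol k != lcol l.
Proof.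
rewrite map_cat /= uniq_catC /= mem_cat negb_or -!andbA => /and3P[lv lu _] k.
rewrite mem_cat => /orP[ku|kv].
  by apply: contraNneq lu => <-; apply: map_f.
by apply: contraNneq lv => <-; apply: map_f.
Qed.

(** All columns being merged, i and j sit in one commutator or in one triple product, and both
    alternate. *)
Lemma sval_tperm w i j x : perm_eq w P -> onZ x -> col i = col j -> i != j ->
  sval T w (pperm (tperm i j) x) = - sval T w x.
Proof.
move=> pw Zx cij nij; pose c := col i; pose s : pred nat := pred1 c.
have si : s (col i) by rewrite /s /=.
have sj : s (col j) by rewrite /s /= -cij.
have fixp := tperm_fix_cols si sj.
have nr : row i != row j by apply: contraNneq nij => rij; apply/eqP/row_col_inj.
have ri : (row i < col_len c)%N by apply: row_lt_len.
have rj : (row j < col_len c)%N by rewrite /c cij row_lt_len.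
have ei : i = cellf c (row i) by rewrite cellf_col_row.
have ej : j = cellf c (row j) by rewrite /c cij cellf_col_row.
have [len2|len3] : col_len c = 2%N \/ col_len c = 3%N.
    by move: (short c); lia.
  have cw : item c \in w.
    rewrite (perm_mem pw); apply: map_f; rewrite mem_filter len2 mem_iota /=.
    exact: colM.
  have uw := perm_lcol_uniq pw.
  case/splitPr: cw pw uw => u v pw uw; have un := uniq_mid uw.
  have lc : lcol (item c) = c by apply: lcol_item; rewrite len2.
  have fu : wval (pperm (tperm i j) x) u = wval x u.
    apply: (@wval_fix_cols _ s _ _ _ pw) => // l lu; rewrite ?mem_cat ?lu //=.
    by have := un l; rewrite lc mem_cat lu => ->.
  have fv : wval (pperm (tperm i j) x) v = wval x v.
    apply: (@wval_fix_cols _ s _ _ _ pw) => // l lu; rewrite ?mem_cat ?inE ?lu ?orbT //=.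
    by have := un l; rewrite lc mem_cat lu orbT => ->.
  have fT : \prod_(t <- T) tval (pperm (tperm i j) x) t = \prod_(t <- T) tval x t.
    apply: (@tprod_fix_cols _ s) => // d d3 _.
    by apply/eqP=> dc; rewrite dc len2 in d3.
  rewrite /sval fT !(wval_cat, wval_cons) fu fv /item len2 eqxx /= !ffunE.
  have -> : lie (x (tperm i j (cellf c 0))) (x (tperm i j (cellf c 1)))
    = - lie (x (cellf c 0)) (x (cellf c 1)).
    rewrite -lieN ei ej; move: ri rj nr; rewrite len2.
    case: (row i) => [|[|?]] //; case: (row j) => [|[|?]] // _ _ _.
      by rewrite tpermL tpermR.
    by rewrite tpermL tpermR.
  by rewrite mulNr !mulrN.
have fw : wval (pperm (tperm i j) x) w = wval x w.
  apply: (@wval_fix_cols _ s _ _ _ pw) => // l lw /=.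
  have [d /andP[d0 d3] ->] := perm_item pw lw; rewrite lcol_item //.
  by apply/eqP=> dc; rewrite dc len3 in d3.
have : c \in [seq c <- iota 0 M | col_len c == 3%N].
  by rewrite mem_filter len3 mem_iota /=; apply: colM.
have : uniq [seq c <- iota 0 M | col_len c == 3%N] by rewrite filter_uniq ?iota_uniq.
have eT : T = map tri [seq c <- iota 0 M | col_len c == 3%N] by [].
have C3 d : d \in [seq c <- iota 0 M | col_len c == 3%N] -> col_len d = 3%N.
  by rewrite mem_filter => /andP[/eqP].
move: eT C3; set Cs := [seq _ <- _ | _] => eT C3 uC cC.
case/splitPr: cC eT uC C3 => s1 s2 eT + C3; rewrite uniq_catC /= mem_cat negb_or.
move=> /andP[/andP[c2 c1] _].
have tri_inj d : tri d = tri c -> col_len d = 3%N -> d = c.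
  move=> etri d3; have [_ <-] : row (cellf d 0) = 0%N /\ col (cellf d 0) = d.
    by apply: cellfP; rewrite d3.
  by case: etri => -> _ _; rewrite (cellfP _).2 ?len3.
have fs s' : {subset s' <= s1 ++ c :: s2} -> c \notin s' ->
    \prod_(t <- map tri s') tval (pperm (tperm i j) x) t
    = \prod_(t <- map tri s') tval x t.
  move=> sub cs'; apply: (@tprod_fix_cols _ s) => //.
    by move=> t /mapP[d /sub ds ->]; rewrite eT; apply: map_f.
  move=> d d3 /mapP[d' d's etri]; apply: contraNneq cs' => dc.
  have d'3 : col_len d' = 3%N by apply: C3; apply: sub.
  by rewrite -(tri_inj d') // -etri dc.
rewrite /sval fw eT map_cat /= !big_cat !big_cons /=.
rewrite !fs //; try by move=> d ds; rewrite mem_cat ?inE ds ?orbT.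
suff -> : tval (pperm (tperm i j) x) (tri c) = - tval x (tri c).
  by rewrite mulNr !mulrN mulNr.
rewrite /tval /= !ffunE ei ej; set a := cellf c 0; set b := cellf c 1; set d := cellf c 2.
have nab : a != b by apply: cellf_neq; rewrite ?len3.
have nad : a != d by apply: cellf_neq; rewrite ?len3.
have nbd : b != d by apply: cellf_neq; rewrite ?len3.
have swab : trip (x b) (x a) (x d) = - trip (x a) (x b) (x d) by apply: tripN.
have swbd : trip (x a) (x d) (x b) = - trip (x a) (x b) (x d) by apply: tripNr.
have swad : trip (x d) (x b) (x a) = - trip (x a) (x b) (x d).
  by rewrite tripN -trip_cyc.
have tab : [/\ tperm a b a = b, tperm a b b = a & tperm a b d = d].
  by rewrite tpermL tpermR tpermD.
have tad : [/\ tperm a d a = d, tperm a d b = b & tperm a d d = a].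
  by rewrite tpermL tpermR tpermD // eq_sym.
have tbd : [/\ tperm b d a = a, tperm b d b = d & tperm b d d = b].
  by rewrite tpermL tpermR tpermD // eq_sym.
case: tab tad tbd => tab1 tab2 tab3 [tad1 tad2 tad3] [tbd1 tbd2 tbd3].
move: ri rj nr; rewrite len3.
case: (row i) => [|[|[|?]]] //; case: (row j) => [|[|[|?]]] // _ _ _.
- by rewrite tab1 tab2 tab3.
- by rewrite tad1 tad2 tad3.
- by rewrite tpermC tab1 tab2 tab3.
- by rewrite tbd1 tbd2 tbd3.
- by rewrite tpermC tad1 tad2 tad3.
- by rewrite tpermC tbd1 tbd2 tbd3.
Qed.

Lemma sval_col w c : perm_eq w P -> c \in fun_stab col ->
  forall x, onZ x -> sval T w (pperm c x) = (-1) ^+ (c : bool) *: sval T w x.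
Proof.
move=> pw; move: c; apply: fun_stab_tperm_ind.
- by move=> x _; rewrite pperm1 odd_perm1 scale1r.
- move=> s r Ps Pr x Zx; rewrite ppermM Ps; last exact: pperm_in.
  by rewrite Pr // scalerA -signr_addb odd_permM.
move=> i j cij x Zx; rewrite odd_tperm.
have [->|nij] := eqVneq i j; first by rewrite tperm1 pperm1 scale1r.
by rewrite sval_tperm // scaleN1r.
Qed.

(** Merged words already alternate along the columns, so the column antisymmetrizer only multiplies
    them by a number. *)
Lemma wact_sval w x : perm_eq w P -> onZ x ->
  wact (sval T w) coyoung x
  = #|fun_stab col|%:R *: wact (sval T w) (row_sym row F) x.
Proof.
move=> pw Zx; rewrite wactM -wact_scale; apply: (eq_wact _ _ Zx) => y Zy.
rewrite /col_alt wact_sum (eq_bigr (fun=> sval T w y)) => [|q Cq].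
  by rewrite sumr_const scaler_nat.
by rewrite wactZ wact_gunit sval_col // scalerA -expr2 sqrr_sign scale1r.
Qed.

Lemma wact_row (h : {ffun 'I_n -> U} -> U) p x : p \in fun_stab row ->
  wact (fun y => h (pperm p y)) (row_sym row F) x = wact h (row_sym row F) x.
Proof. by move=> Rp; rewrite wact_comp row_symMl. Qed.

Lemma lcol_neq2 u v l l' : uniq (map lcol (u ++ l :: l' :: v)) ->
  lcol l != lcol l' /\
  forall k, k \in u ++ v -> (lcol k != lcol l) && (lcol k != lcol l').
Proof.
move=> un; have nl := uniq_mid un.
have un' : uniq (map lcol (u ++ l' :: v)).
  by move: un; rewrite !map_cat /= !(uniq_catC (map lcol u)) /= => /andP[].
have nl' := uniq_mid un'; split.
  by rewrite eq_sym; apply: nl; rewrite mem_cat inE eqxx orbT.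
move=> k kuv; rewrite nl' // nl //.
by move: kuv; rewrite !mem_cat inE => /orP[]->; rewrite ?orbT.
Qed.

Lemma sval_fix_others u v l l' (p : 'S_n) x : perm_eq (u ++ l :: l' :: v) P ->
    (forall i, ~~ pred2 (lcol l) (lcol l') (col i) -> p i = i) ->
  [/\ wval (pperm p x) u = wval x u, wval (pperm p x) v = wval x v
    & \prod_(t <- T) tval (pperm p x) t = \prod_(t <- T) tval x t].
Proof.
move=> pw fixp; have [nll' nk] := lcol_neq2 (perm_lcol_uniq pw).
have sub k : k \in u ++ v -> ~~ pred2 (lcol l) (lcol l') (lcol k).
  by move/nk; rewrite /= negb_or.
split.
- apply: (@wval_fix_cols p (pred2 (lcol l) (lcol l')) _ _ _ pw) => [k ku|k ku|//].
    by rewrite mem_cat ku.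
  by apply: sub; rewrite mem_cat ku.
- apply: (@wval_fix_cols p (pred2 (lcol l) (lcol l')) _ _ _ pw) => [k kv|k kv|//].
    by rewrite mem_cat !inE kv !orbT.
  by apply: sub; rewrite mem_cat kv orbT.
apply: (@tprod_fix_cols p (pred2 (lcol l) (lcol l'))) => [//|c c3 _|//].
have lP k : k \in u ++ l :: l' :: v -> lcol k != c.
  move=> kw; have [d /andP[d0 d3] ->] := perm_item pw kw.
  by rewrite lcol_item //; apply/eqP=> dc; rewrite dc c3 in d3.
by rewrite /= negb_or ![c == _]eq_sym !lP // mem_cat !inE eqxx ?orbT.
Qed.

(** The sum of the two words contains the triple product of a, b and i. It changes sign when a and i
    are exchanged, and these lie in one row, so row symmetrization kills the sum. *)
Lemma swap_pair_single u v a b i : perm_eq (u ++ inr (a, b) :: inl i :: v) P ->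
    row a = row i -> col a = col b -> a != b ->
  forall x, onZ x ->
  wact (sval T (u ++ inr (a, b) :: inl i :: v)) (row_sym row F) x
  = - wact (sval T (u ++ inl i :: inr (a, b) :: v)) (row_sym row F) x.
Proof.
move=> pw rai cab nab x Zx.
set h := sval T (u ++ inr (a, b) :: inl i :: v).
set h' := sval T (u ++ inl i :: inr (a, b) :: v).
have [cai _] := lcol_neq2 (perm_lcol_uniq pw); rewrite /= in cai.
have Rp : tperm a i \in fun_stab row by apply: tperm_fun_stab.
have nai : a != i by apply: contraNneq cai => ->.
have nbi : b != i by apply: contraNneq cai => <-; rewrite cab.
have gp (y : {ffun 'I_n -> U}) : onZ y -> h (pperm (tperm a i) y) + h' (pperm
  (tperm a i) y) = - (h y + h' y).
  move=> Zy; have [|fu fv fT] := sval_fix_others (p := tperm a i) y pw.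
    by apply: tperm_fix_cols; rewrite /= eqxx ?orbT.
  have hE (z : {ffun 'I_n -> U}) : wval z u = wval y u -> wval z v = wval y v ->
      \prod_(t <- T) tval z t = \prod_(t <- T) tval y t ->
      h z + h' z = \prod_(t <- T) tval y t * wval y u * trip (z a) (z b) (z i) * wval y v.
    move=> zu zv zT; rewrite /h /h' /sval zT !(wval_cat, wval_cons) /= zu zv.
    by rewrite /trip /jord mulrDr mulrDl !mulrA.
  rewrite (hE _ fu fv fT) (hE y) // !ffunE tpermL tpermR.
  have -> : tperm a i b = b by rewrite tpermD // eq_sym.
  have -> : trip (y i) (y b) (y a) = - trip (y a) (y b) (y i).
    by rewrite tripN -trip_cyc.
  by rewrite mulrN mulNr.
apply/eqP; rewrite -addr_eq0 -wactDl; apply/eqP.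
apply: (eq_opp_charf0 charF0); rewrite -{1}(wact_row _ x Rp).
transitivity (wact (fun y => (-1) *: (h y + h' y)) (row_sym row F) x).
  by apply: (eq_wact _ _ Zx) => y Zy; rewrite gp // scaleN1r.
by rewrite wact_scale scaleN1r.
Qed.

(** Two single letters are exchanged by a transposition in the first row, two commutators by
    transpositions in the first two rows; a commutator and a single letter anticommute by
    [swap_pair_single]. *)
Lemma swap_letters u v l l' : perm_eq (u ++ l :: l' :: v) P ->
  exists b : bool, forall x, onZ x ->
  wact (sval T (u ++ l :: l' :: v)) (row_sym row F) x
  = (-1) ^+ b *: wact (sval T (u ++ l' :: l :: v)) (row_sym row F) x.
Proof.
move=> pw; have pw' : perm_eq (u ++ l' :: l :: v) P.
  by apply: perm_trans pw; rewrite perm_cat2l (perm_catCA [:: l'] [:: l]).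
have uw := perm_lcol_uniq pw.
have [cll' _] := lcol_neq2 uw.
have lw : l \in u ++ l :: l' :: v by rewrite mem_cat inE eqxx orbT.
have lw' : l' \in u ++ l :: l' :: v by rewrite mem_cat !inE eqxx !orbT.
have [c /andP[c0 c3] el] := perm_item pw lw.
have [c' /andP[c'0 c'3] el'] := perm_item pw lw'.
have pairP d : col_len d = 2%N -> [/\ row (cellf d 0) = 0%N, row (cellf d 1) = 1%N,
    col (cellf d 0) = col (cellf d 1) & cellf d 0 != cellf d 1].
  move=> d2; have [-> ->] : row (cellf d 0) = 0%N /\ col (cellf d 0) = d.
    by apply: cellfP; rewrite d2.
  have [-> ->] : row (cellf d 1) = 1%N /\ col (cellf d 1) = d.
    by apply: cellfP; rewrite d2.
  by rewrite cellf_neq ?d2.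
have r0 d : (0 < col_len d)%N -> row (cellf d 0) = 0%N by case/cellfP.
case: (eqVneq (col_len c) 2%N) => [c2|nc2]; case: (eqVneq (col_len c') 2%N) => [c'2|nc'2].
- exists false => x Zx; rewrite scale1r.
  have [ra rb cab nab] := pairP _ c2; have [ra' rb' cab' nab'] := pairP _ c'2.
  move: el el' pw pw' cll' uw; rewrite /item c2 c'2 !eqxx => -> -> pw pw'.
  move: (cellf c 0) (cellf c 1) (cellf c' 0) (cellf c' 1) ra rb cab nab ra' rb' cab' nab' pw pw'.
  move=> a b a' b' ra rb cab nab ra' rb' cab' nab' pw pw' /= cll' _.
  pose p := (tperm a a' * tperm b b')%g.
  have Rp : p \in fun_stab row by rewrite groupM ?tperm_fun_stab ?ra ?ra' ?rb ?rb'.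
  have naa' : a != a' by apply: contraNneq cll' => ->.
  have nbb' : b != b' by apply: contraNneq cll' => bb'; rewrite cab bb' cab'.
  have nab1 : a != b' by apply: contraNneq cll' => ->; rewrite cab'.
  have nba1 : b != a' by apply: contraNneq cll' => <-; rewrite cab.
  have pa : p a = a' by rewrite permM tpermL tpermD // eq_sym.
  have pa' : p a' = a by rewrite permM tpermR tpermD // eq_sym.
  have pb : p b = b' by rewrite permM [tperm a a' b]tpermD ?tpermL // eq_sym.
  have pb' : p b' = b by rewrite permM [tperm a a' b']tpermD ?tpermR // eq_sym.
  have fixp k : ~~ pred2 (col a) (col a') (col k) -> p k = k.
    move=> nk; rewrite permM !tpermD //; apply: contraNneq nk => <-; rewrite /=
      ?cab ?cab' ?eqxx ?orbT //.
  rewrite -(wact_row _ x Rp); apply: (eq_wact _ _ Zx) => y Zy.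
  have [fu fv fT] := sval_fix_others (p := p) y pw fixp.
  rewrite /sval fT !(wval_cat, wval_cons) fu fv /= !ffunE pa pb pa' pb'.
  by [].
- exists true => x Zx; rewrite scaleN1r.
  have [ra rb cab nab] := pairP _ c2.
  move: el el' pw; rewrite /item c2 eqxx (negPf nc'2) => -> -> pw.
  by apply: swap_pair_single => //; rewrite ra r0.
- exists true => x Zx; rewrite scaleN1r.
  have [ra rb cab nab] := pairP _ c'2.
  move: el el' pw'; rewrite /item c'2 eqxx (negPf nc2) => -> -> pw'.
  by rewrite swap_pair_single ?opprK // ra r0.
exists false => x Zx; rewrite scale1r.
move: el el' pw cll'; rewrite /item (negPf nc2) (negPf nc'2) => -> -> pw /= cll'.
have Rp : tperm (cellf c 0) (cellf c' 0) \in fun_stab row.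
  by apply: tperm_fun_stab; rewrite !r0.
rewrite -(wact_row _ x Rp); apply: (eq_wact _ _ Zx) => y Zy.
have [|fu fv fT] := sval_fix_others (p := tperm (cellf c 0) (cellf c' 0)) y pw.
  by apply: tperm_fix_cols; rewrite /= eqxx ?orbT.
rewrite /sval fT !(wval_cat, wval_cons) fu fv /= !ffunE tpermL tpermR.
by [].
Qed.

Lemma wact_sval_perm w' : forall u w, perm_eq w w' -> perm_eq (u ++ w) P ->
  exists b : bool, forall x, onZ x ->
  wact (sval T (u ++ w)) (row_sym row F) x
  = (-1) ^+ b *: wact (sval T (u ++ w')) (row_sym row F) x.
Proof.
elim: w' => [|l w' IHw'] u w pw puw.
  by exists false => x _; rewrite (perm_nilP pw) scale1r.
have : l \in w by rewrite (perm_mem pw) mem_head.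
move=> lw; case/splitPr: lw pw puw => w1 w2 pw puw.
have pw12 : perm_eq (w1 ++ w2) w'.
  by rewrite -(perm_cons l) -(permPr pw) perm_sym (perm_catCA w1 [:: l]).
have [b bP] : exists b : bool, forall x, onZ x ->
    wact (sval T (u ++ w1 ++ l :: w2)) (row_sym row F) x
    = (-1) ^+ b *: wact (sval T (u ++ l :: w1 ++ w2)) (row_sym row F) x.
  elim/last_ind: w1 w2 {pw pw12} puw => [|w1 k IHw1] w2 puw.
    by exists false => x _; rewrite scale1r.
  rewrite cat_rcons in puw.
  have puw' : perm_eq (u ++ w1 ++ l :: k :: w2) P.
    apply: perm_trans puw; rewrite !perm_cat2l.
    by rewrite (perm_catCA [:: l] [:: k]).
  have [b1 b1P] : exists b : bool, forall x, onZ x ->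
    wact (sval T ((u ++ w1) ++ k :: l :: w2)) (row_sym row F) x
    = (-1) ^+ b *: wact (sval T ((u ++ w1) ++ l :: k :: w2)) (row_sym row F) x.
    by apply: swap_letters; rewrite -catA.
  have [b2 b2P] := IHw1 _ puw'; exists (b1 (+) b2) => x Zx.
  by rewrite !cat_rcons catA b1P // -catA b2P // scalerA signr_addb.
have puw12 : perm_eq (rcons u l ++ w1 ++ w2) P.
  rewrite cat_rcons; apply: perm_trans puw; rewrite perm_cat2l.
  by rewrite perm_sym (perm_catCA w1 [:: l]).
have [b' b'P] := IHw' (rcons u l) _ pw12 puw12.
exists (b (+) b') => x Zx; rewrite bP // -cat_rcons b'P // cat_rcons.
by rewrite scalerA signr_addb.
Qed.

Lemma good_all_last : good_all (wact (sval T P) (row_sym row F)) M.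
Proof.
have -> : good_all (wact (sval T P) (row_sym row F)) M
    = forall w, perm_eq w P -> good (wact (sval T P) (row_sym row F)) (sval T w).
  rewrite /good_all; have -> : cells M = [::]; last by rewrite cats0.
  apply/eqP; rewrite -[_ == _]negbK -has_filter; apply/hasPn=> i _.
  by rewrite -ltnNge.
move=> w pw; have [b bP] := @wact_sval_perm P [::] w pw pw.
exists (#|fun_stab col|%:R * (-1) ^+ b) => x Zx.
by rewrite wact_sval // bP // scalerA.
Qed.

End Short.

Lemma good_all_down Phi j : good_all Phi j -> good_all Phi 0.
Proof.
elim: j => // j IHj gj; apply: IHj.
have [len3|len4] := leqP (col_len j) 3; first exact: good_all_step gj.
exact: good_all_long.
Qed.

Lemma good_all_word Phi s : good_all Phi 0 -> good Phi (fun x => word1 (pperm s x)).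
Proof.
move=> g0; pose w : seq letter := [seq inl (s i) | i <- index_enum 'I_n].
apply: (good_eq (w' := sval (done_triples 0) w)) => [x _|].
  rewrite /sval big_nil mul1r /wval /w big_map.
  by apply: eq_bigr => i _; rewrite ffunE.
apply: g0; rewrite /w (map_comp inl s); apply: perm_map.
apply: uniq_perm; rewrite ?(map_inj_uniq perm_inj) ?index_enum_uniq //.
  by rewrite filter_uniq ?enum_uniq.
move=> i; rewrite mem_cells; apply/mapP; exists (s^-1 i)%g => //.
by rewrite permKV.
Qed.

End Columns.

Lemma line_ok_skew : line_ok skew_elt coyoung.
Proof.
have [/line_ok_trivial ok|n_gt1] := leqP n 1; first exact: ok.
pose i0 : 'I_n := Ordinal (ltnW n_gt1).
suff [Phi [j gj]] : exists Phi j, good_all i0 Phi j.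
  exists Phi => s; have [k kP] := good_all_word s (good_all_down gj).
  by exists k => x Zx; rewrite -kP // wact_comp.
have [[c len4]|len3] := classic (exists c, (3 < col_len c)%N).
  by exists (fun=> 0), c; apply: good_all_long.
pose M := (\max_i col i).+1.
exists (wact (sval (done_triples i0 M) (done_letters i0 M)) (row_sym row F)), M.
apply: good_all_last => [c|i]; last by rewrite ltnS; apply: leq_bigmax.
by rewrite leqNgt; apply/negP=> len4; apply: len3; exists c.
Qed.

End SkewWords.

End SkewAlgebra.

(** Inversion fixes the row and column sums and reverses products, hence carries the Young
    symmetrizer to e'. *)
Lemma quasi_primitive_coyoung (F : fieldType) (charF0 : [pchar F] =i pred0)
    n (la : intpart n) : quasi_primitive (tab_coyoung F la).
Proof.
have rowV : ginv (row_sym (tab_row la) F) = row_sym (tab_row la) F.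
  rewrite /row_sym ginv_sum (reindex_inj invg_inj) /=.
  by apply: eq_big => [p|p Rp]; rewrite ?groupV // ginv_gunit invgK.
have colV : ginv (col_alt (tab_col la) F) = col_alt (tab_col la) F.
  rewrite /col_alt ginv_sum (reindex_inj invg_inj) /=.
  apply: eq_big => [p|p Rp]; rewrite ?groupV //.
  by rewrite ginvZ ginv_gunit invgK odd_permV.
have -> : tab_coyoung F la = ginv (tab_young F la).
  by rewrite /tab_young /young ginvM rowV colV.
split=> [x|].
  have [k ek] := tab_young_mul charF0 la (ginv x); exists k.
  by rewrite -ginvZ -ek !ginvM ginvK mulrA.
have [k nk ek] := tab_young_sqr charF0 la; exists k => //.
by rewrite -ginvM ek ginvZ.
Qed.

(** * Algebras with graded involution *)

Section Unitization.

Variables (F : fieldType) (gT : finGroupType) (A : gstar_algebra F gT).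
Implicit Types a b c : A.

Lemma gsa_mulDl a b c : gsa_mul (a + b) c = gsa_mul a c + gsa_mul b c.
Proof. by rewrite -[a]scale1r gsa_mul_linl !scale1r. Qed.

Lemma gsa_mulDr a b c : gsa_mul a (b + c) = gsa_mul a b + gsa_mul a c.
Proof. by rewrite -[b]scale1r gsa_mul_linr !scale1r. Qed.

Lemma gsa_mul0l a : gsa_mul 0 a = 0.
Proof. by apply: (addrI (gsa_mul 0 a)); rewrite -gsa_mulDl !addr0. Qed.

Lemma gsa_mul0r a : gsa_mul a 0 = 0.
Proof. by apply: (addrI (gsa_mul a 0)); rewrite -gsa_mulDr !addr0. Qed.

Lemma gsa_mulZl k a b : gsa_mul (k *: a) b = k *: gsa_mul a b.
Proof. by rewrite -[k *: a]addr0 gsa_mul_linl gsa_mul0l addr0. Qed.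

Lemma gsa_mulZr k a b : gsa_mul a (k *: b) = k *: gsa_mul a b.
Proof. by rewrite -[k *: b]addr0 gsa_mul_linr gsa_mul0r addr0. Qed.

Lemma gsa_starD a b : gsa_star (a + b) = gsa_star a + gsa_star b.
Proof. by rewrite -[a]scale1r gsa_star_lin !scale1r. Qed.

Lemma gsa_star0 : gsa_star (0 : A) = 0.
Proof. by apply: (addrI (gsa_star 0)); rewrite -gsa_starD !addr0. Qed.

Lemma gsa_starZ k a : gsa_star (k *: a) = k *: gsa_star a.
Proof. by rewrite -[k *: a]addr0 gsa_star_lin gsa_star0 addr0. Qed.

Lemma gsa_compD g a b : gsa_comp g a -> gsa_comp g b -> gsa_comp g (a + b).
Proof. by move=> Aa Ab; rewrite -[a]scale1r; apply: gsa_comp_lin. Qed.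

Lemma gsa_compZ g k a : gsa_comp g a -> gsa_comp g (k *: a).
Proof. by move=> Aa; rewrite -[k *: a]addr0; apply: gsa_comp_lin => //; apply: gsa_comp0. Qed.

Lemma homog_part0 g e : homog_part g e (0 : A).
Proof. by split; [apply: gsa_comp0 | rewrite gsa_star0 scaler0]. Qed.

Definition unitz := (F^o * A)%type.

HB.instance Definition _ := GRing.Lmodule.on unitz.

Implicit Types x y z : unitz.

Definition unitz_mul x y : unitz :=
  (x.1 * y.1, x.1 *: y.2 + y.1 *: x.2 + gsa_mul x.2 y.2).
Definition unitz_one : unitz := (1, 0).

Fact unitz_mulA : associative unitz_mul.
Proof.
move=> x y z; congr pair => /=; first exact: mulrA.
rewrite !(gsa_mulDl, gsa_mulDr, gsa_mulZl, gsa_mulZr, gsa_mulA).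
rewrite !scalerDr !scalerA -!addrA; congr (_ + _).
rewrite [z.1 * x.1]mulrC [z.1 * y.1]mulrC; congr (_ + _).
rewrite !addrA; congr (_ + _); rewrite -!addrA addrC -!addrA.
by congr (_ + _); rewrite addrC -addrA; congr (_ + _); rewrite addrC.
Qed.

Fact unitz_mul1l : left_id unitz_one unitz_mul.
Proof.
by move=> [k a]; congr pair; rewrite /= ?mul1r // gsa_mul0l scale1r scaler0 !addr0.
Qed.

Fact unitz_mul1r : right_id unitz_one unitz_mul.
Proof.
by move=> [k a]; congr pair; rewrite /= ?mulr1 // gsa_mul0r scale1r scaler0 addr0 add0r.
Qed.

Fact unitz_mulDl : left_distributive unitz_mul +%R.
Proof.
move=> x y z; congr pair => /=; first exact: mulrDl.
by rewrite scalerDl scalerDr gsa_mulDl [RHS]addrACA; congr (_ + _); apply: addrACA.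
Qed.

Fact unitz_mulDr : right_distributive unitz_mul +%R.
Proof.
move=> x y z; congr pair => /=; first exact: mulrDr.
by rewrite scalerDl scalerDr gsa_mulDr [RHS]addrACA; congr (_ + _); apply: addrACA.
Qed.

Fact unitz_1_neq0 : unitz_one != 0.
Proof. by apply/eqP=> /(congr1 fst)/eqP; rewrite oner_eq0. Qed.

HB.instance Definition _ := GRing.Zmodule_isNzRing.Build unitz
  unitz_mulA unitz_mul1l unitz_mul1r unitz_mulDl unitz_mulDr unitz_1_neq0.

Fact unitz_scaleAl (k : F) x y : k *: (x * y) = (k *: x) * y.
Proof.
congr pair => /=; first exact: mulrA.
by rewrite !scalerDr gsa_mulZl !scalerA [k * y.1]mulrC.
Qed.

HB.instance Definition _ := GRing.Lmodule_isLalgebra.Build F unitz unitz_scaleAl.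

Fact unitz_scaleAr (k : F) x y : k *: (x * y) = x * (k *: y).
Proof.
congr pair => /=; first by rewrite mulrCA.
by rewrite !scalerDr gsa_mulZr !scalerA [k * x.1]mulrC.
Qed.

HB.instance Definition _ := GRing.Lalgebra_isAlgebra.Build F unitz unitz_scaleAr.

Lemma unitzM x y : x * y =
  (x.1 * y.1, x.1 *: y.2 + y.1 *: x.2 + gsa_mul x.2 y.2) :> unitz.
Proof. by []. Qed.

Definition embed a : unitz := (0, a).

Lemma embedM a b : embed a * embed b = embed (gsa_mul a b).
Proof. by rewrite unitzM /= mul0r !scale0r !add0r. Qed.

Lemma embed_lin k a b : embed (k *: a + b) = k *: embed a + embed b.
Proof. by congr pair; rewrite /= [k *: 0]scaler0 addr0. Qed.

Definition unitz_star x : unitz := (x.1, gsa_star x.2).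

Definition in_part (t : vtype gT) x : Prop := x.1 = 0 /\ homog_part t.1 t.2 x.2.

Lemma in_part_embed t x : in_part t x -> x = embed x.2.
Proof. by case: x => k a [/= -> _]. Qed.

Lemma word_eval_embed (v : gvar gT -> A) w : w != [::] ->
  embed (word_eval v w) = \prod_(y <- w) embed (v y).
Proof.
case: w => // y w _; rewrite big_cons /=.
elim: w (v y) => [|y' w IHw] a /=; first by rewrite big_nil mulr1.
by rewrite IHw big_cons mulrA embedM.
Qed.

Lemma unitz_star_lin k x y : unitz_star (k *: x + y) = k *: unitz_star x + unitz_star y.
Proof. by congr pair; rewrite /= gsa_starD gsa_starZ. Qed.

Lemma unitz_starK : involutive unitz_star.
Proof. by case=> k a; rewrite /unitz_star /= gsa_starK. Qed.

Lemma unitz_starM x y : unitz_star (x * y) = unitz_star y * unitz_star x.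
Proof.
congr pair; rewrite /= ?[x.1 * _]mulrC // !gsa_starD !gsa_starZ gsa_starM.
by congr (_ + _); rewrite addrC.
Qed.

Lemma in_part_star t x : in_part t x -> unitz_star x = (-1) ^+ t.2 *: x.
Proof. by case: x => k a [/= -> [_ sa]]; congr pair; rewrite //= [_ *: 0]scaler0. Qed.

(** Equal signs cancel; therefore [jord] is symmetric and [lie] skew for letters of either kind. *)
Lemma unitz_star_mul2 t x y : in_part t x -> in_part t y -> unitz_star (x * y) = y * x.
Proof.
move=> Px Py; rewrite unitz_starM (in_part_star Px) (in_part_star Py).
by rewrite -scalerAl -scalerAr scalerA -expr2 sqrr_sign scale1r.
Qed.

Lemma unitz_starD x y : unitz_star (x + y) = unitz_star x + unitz_star y.
Proof. by congr pair; rewrite /= gsa_starD. Qed.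

Lemma unitz_starN x : unitz_star (- x) = - unitz_star x.
Proof. by congr pair; rewrite /= -scaleN1r gsa_starZ scaleN1r. Qed.

Lemma in_partI g (e : bool) x : x.1 = 0 -> gsa_comp g x.2 -> unitz_star x = (-1) ^+ e *: x ->
  in_part (g, e) x.
Proof. by move=> x1 x2 /(congr1 snd) sx; split. Qed.

Lemma comp_mul g h x y : x.1 = 0 -> y.1 = 0 -> gsa_comp g x.2 -> gsa_comp h y.2 ->
  (x * y).1 = 0 /\ gsa_comp (g * h)%g (x * y).2.
Proof.
move=> x0 y0 gx hy; rewrite unitzM /= x0 y0 mul0r !scale0r !add0r; split=> //.
exact: gsa_compM.
Qed.

Lemma in_part_jord g (e : bool) x y : in_part (g, e) x -> in_part (g, e) y ->
  in_part (g * g, false)%g (jord x y).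
Proof.
move=> Px Py; have [x1 [gx _]] := Px; have [y1 [gy _]] := Py.
have [xy1 gxy] := comp_mul x1 y1 gx gy; have [yx1 gyx] := comp_mul y1 x1 gy gx.
apply: in_partI.
- by have -> : (jord x y).1 = (x * y).1 + (y * x).1 by []; rewrite xy1 yx1 addr0.
- exact: gsa_compD.
rewrite /jord unitz_starD (unitz_star_mul2 Px Py) (unitz_star_mul2 Py Px).
by rewrite expr0 scale1r addrC.
Qed.

Lemma in_part_lie g (e : bool) x y : in_part (g, e) x -> in_part (g, e) y ->
  in_part (g * g, true)%g (lie x y).
Proof.
move=> Px Py; have [x1 [gx _]] := Px; have [y1 [gy _]] := Py.
have [xy1 gxy] := comp_mul x1 y1 gx gy; have [yx1 gyx] := comp_mul y1 x1 gy gx.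
apply: in_partI.
- have -> : (lie x y).1 = (x * y).1 - (y * x).1 by [].
  by rewrite xy1 yx1 subrr.
- have -> : (lie x y).2 = -1 *: (y * x).2 + (x * y).2 by rewrite scaleN1r addrC.
  exact: gsa_comp_lin.
rewrite /lie unitz_starD unitz_starN (unitz_star_mul2 Px Py) (unitz_star_mul2 Py Px).
by rewrite expr1 scaleN1r opprB.
Qed.

End Unitization.

(** * Words in a single part *)

Section LineSigns.

Variables (F : fieldType) (charF0 : [pchar F] =i pred0) (U : algType F).
Variables (n : nat) (Z : U -> Prop) (e : galg F 'S_n).
Hypothesis qe : quasi_primitive e.

(** 2abc is the sum of [jord a b] and [lie a b] times c. Moving c to the left, equal signs give 2cab
    up to sign and opposite signs give 2cba up to sign: a cyclic rule or a reversal rule. *)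
Lemma line_ok_signs (d1 d2 : bool) :
    (forall a b c, Z a -> Z b -> Z c ->
       jord a b * c = (-1) ^+ d1 *: (c * jord a b)) ->
    (forall a b c, Z a -> Z b -> Z c ->
       lie a b * c = (-1) ^+ d2 *: (c * lie a b)) ->
  line_ok Z e.
Proof.
move=> Zj Zl.
have sum a b c : Z a -> Z b -> Z c -> a * b * c *+ 2
    = (-1) ^+ d1 *: (c * jord a b) + (-1) ^+ d2 *: (c * lie a b).
  move=> Za Zb Zc; rewrite -Zj // -Zl // -mulrDl /jord /lie.
  by rewrite addrACA subrr addr0 -mulr2n mulrnAl.
have two (a b : U) : jord a b + lie a b = (a * b) *+ 2.
  by rewrite /jord /lie addD_subD.
have two' (a b : U) : jord a b - lie a b = (b * a) *+ 2.
  by rewrite /jord /lie addB_subD.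
case: d1 d2 sum {Zj Zl} => [] [] sum.
(* Here abc = - cab; three applications give abc = - abc, so all products of three letters
   vanish. *)
- have abc a b c : Z a -> Z b -> Z c -> a * b * c = - (c * a * b).
    move=> Za Zb Zc; apply: (mulrn_charf0_inj charF0 (m := 2)) => //.
    by rewrite sum // !expr1 !scaleN1r -opprD -mulrDr two mulrnAr mulrA mulNrn.
  apply: line_ok_cyclic => // a b c Za Zb Zc.
  have abc0 : a * b * c = 0.
    apply: (mulrn_charf0_inj charF0 (m := 2)) => //; rewrite mul0rn mulr2n.
    by rewrite {1}abc // [c * a * b]abc // [b * c * a]abc // !opprK addNr.
  by rewrite abc0; move: (abc a b c Za Zb Zc) => /eqP; rewrite abc0 eq_sym oppr_eq0 => /eqP.
- apply: (line_ok_parity charF0 qe (d := true)) => a b c Za Zb Zc.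
  apply: (mulrn_charf0_inj charF0 (m := 2)) => //.
  rewrite sum // expr1 expr0 scaleN1r scale1r addrC -opprB -mulrBr two'.
  by rewrite mulrnAr mulrA scaleN1r mulNrn.
- apply: (line_ok_parity charF0 qe (d := false)) => a b c Za Zb Zc.
  apply: (mulrn_charf0_inj charF0 (m := 2)) => //.
  by rewrite sum // expr1 expr0 scaleN1r !scale1r -mulrBr two' mulrnAr mulrA.
apply: line_ok_cyclic => // a b c Za Zb Zc.
apply: (mulrn_charf0_inj charF0 (m := 2)) => //.
by rewrite sum // expr0 !scale1r -mulrDr two mulrnAr mulrA.
Qed.

End LineSigns.

Lemma line_ok_sub (F : fieldType) (U : algType F) n (Z Z' : U -> Prop) (e : galg F 'S_n) :
  (forall a, Z a -> Z' a) -> line_ok Z' e -> line_ok Z e.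
Proof.
move=> ZZ' [Phi ok]; exists Phi => s; have [k kP] := ok s.
by exists k => x Zx; apply: kP => i; apply: ZZ'.
Qed.

Section PartLines.

Variables (F : fieldType) (charF0 : [pchar F] =i pred0).
Variables (gT : finGroupType) (A : gstar_algebra F gT).
Local Notation part := (@in_part F gT A).
Hypothesis parts_comm : forall t1 t2 : vtype gT, t1 <> t2 -> exists d : bool,
  forall x y, part t1 x -> part t2 y -> x * y = (-1) ^+ d *: (y * x).

Lemma part_line_ok (t : vtype gT) n (la : intpart n) : line_ok (part t) (tab_coyoung F la).
Proof.
have qe := quasi_primitive_coyoung charF0 la.
case: t => g e; have [g1|ng1] := eqVneq g 1%g; last first.
  have ngg : (g * g)%g <> g.
    by move=> gg; case/eqP: ng1; apply: (mulgI g); rewrite gg mulg1.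
  have [d1 d1P] : exists d : bool, forall x y, part (g * g, false)%g x ->
      part (g, e) y -> x * y = (-1) ^+ d *: (y * x).
    by apply: parts_comm => -[].
  have [d2 d2P] : exists d : bool, forall x y, part (g * g, true)%g x ->
      part (g, e) y -> x * y = (-1) ^+ d *: (y * x).
    by apply: parts_comm => -[].
  apply: (line_ok_signs charF0 qe (d1 := d1) (d2 := d2)) => a b c Pa Pb Pc.
    by apply: d1P => //; apply: in_part_jord Pa Pb.
  by apply: d2P => //; apply: in_part_lie Pa Pb.
subst g; have jordP x y d : part (1%g, d) x -> part (1%g, d) y ->
    part (1%g, false) (jord x y).
  by move=> Px Py; have := in_part_jord Px Py; rewrite mulg1.
have lieP x y d : part (1%g, d) x -> part (1%g, d) y -> part (1%g, true) (lie x y).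
  by move=> Px Py; have := in_part_lie Px Py; rewrite mulg1.
have [d dP] : exists d : bool, forall x y, part (1%g, true) x ->
    part (1%g, false) y -> x * y = (-1) ^+ d *: (y * x).
  by apply: parts_comm => -[].
have dP' x y : part (1%g, false) x -> part (1%g, true) y ->
    x * y = (-1) ^+ d *: (y * x).
  by move=> Px Py; rewrite (dP y x) // scalerA -expr2 sqrr_sign scale1r.
have jordC0 x y : part (1%g, false) x -> part (1%g, true) y -> d = true ->
    jord x y = 0 /\ jord y x = 0.
  by move=> Px Py dt; rewrite /jord dP' // dt expr1 scaleN1r addNr subrr.
case: e; case: d dP dP' jordC0 => dP dP' jordC0.
- apply: (line_ok_signs charF0 qe (d1 := true) (d2 := false)) => a b c Pa Pb Pc.
    by apply: dP' => //; apply: jordP Pa Pb.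
  (* Skew letters anticommuting with symmetric elements: [c,[a,b]] is a difference of Jordan
     products of a symmetric and a skew element, which vanish. *)
  have l0 := jord_assoc_nc a b c.
  have j1 := (jordC0 _ _ (jordP _ _ _ Pa Pc) Pb erefl).1.
  have j2 := (jordC0 _ _ (jordP _ _ _ Pc Pb) Pa erefl).2.
  rewrite j1 j2 in l0.
  apply/esym/eqP; rewrite expr0 scale1r -subr_eq0; apply/eqP.
  by rewrite -[LHS]/(lie _ _) -l0 subrr.
- pose D (x : unitz A) := gsa_comp 1%g x.2.
  have pD x : part (1%g, true) x -> skew_elt D (@unitz_star F gT A) x.
    move=> Px; split; first by have [_ []] := Px.
    by rewrite (in_part_star Px) expr1 scaleN1r.
  apply: line_ok_sub pD _; apply: (line_ok_skew charF0).
  + by move=> k x y; apply: gsa_comp_lin.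
  + exact: gsa_comp0.
  + move=> [k x] [l y] Dx Dy; rewrite /D /=.
    apply: gsa_compD; first by apply: gsa_compD; apply: gsa_compZ.
    by rewrite -[1%g]mulg1; apply: gsa_compM.
  + by move=> x; rewrite /D /= gsa_star_comp.
  + exact: unitz_star_lin.
  + exact: unitz_starK.
  + exact: unitz_starM.
  (* The scalar component of a symmetric element is harmless, and that of a skew element equals its
     opposite, hence is 0. *)
  + move=> [k x] [l y] Dx sx [/= Dy sy].
    have y0 : (l, y) = embed y :> unitz A.
      have /(congr1 fst)/= ll := sy; congr pair.
      exact: (eq_opp_charf0 charF0 (V := F^o)) ll.
    have Py : part (1%g, true) (l, y).
      rewrite y0; split=> //; split=> //=.
      by have /(congr1 snd)/= -> := sy; rewrite expr1 scaleN1r.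
    have Px : part (1%g, false) (embed x).
      split=> //; split=> //=; have /(congr1 snd)/= -> := sx.
      by rewrite expr0 scale1r.
    have -> : ((k, x) : unitz A) = k *: (1 : unitz A) + (embed x : unitz A).
      by congr pair; rewrite /= ?[k *: 1]mulr1 ?addr0 // scaler0 add0r.
    have := dP' _ _ Px Py; rewrite expr0 scale1r => exy.
    by rewrite /lie mulrDl mulrDr -scalerAl -scalerAr mul1r mulr1 exy subrr.
  + exact: tab_inj.
  + exact: tab_col_down.
- apply: (line_ok_signs charF0 qe (d1 := false) (d2 := true)) => a b c Pa Pb Pc.
    (* Symmetric letters anticommuting with skew elements: the commutator of [jord a b] with c is
       again a sum of such vanishing Jordan products. *)
    have l0 := lie_jord_nc a b c.
    have j1 := (jordC0 _ _ Pa (lieP _ _ _ Pb Pc) erefl).1.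
    have j2 := (jordC0 _ _ Pb (lieP _ _ _ Pa Pc) erefl).1.
    rewrite j1 j2 in l0.
    apply/eqP; rewrite expr0 scale1r -subr_eq0; apply/eqP.
    by rewrite -[LHS]/(lie _ _) l0 addr0.
  by apply: dP => //; apply: lieP Pa Pb.
apply: (line_ok_central_commutators charF0 qe) => [a b c Pa Pb Pc|a b c f Pa Pb Pc Pf].
  by have := dP _ _ (lieP _ _ _ Pa Pb) Pc; rewrite expr0 scale1r.
(* Symmetric letters commuting with skew elements: q = [c,f] is skew and commutes with a, so aq is
   skew and commutes with b, and [a,b] q = aqb - baq = 0. *)
have Pq := lieP _ _ _ Pc Pf.
have Paq : part (1%g, true) (a * lie c f).
  have [a1 [Da _]] := Pa; have [q1 [Dq _]] := Pq.
  have [aq1 Daq] := comp_mul a1 q1 Da Dq; rewrite mulg1 in Daq.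
  apply: in_partI => //; rewrite unitz_starM (in_part_star Pa) (in_part_star Pq).
  have := dP _ _ Pq Pa; rewrite !expr0 !expr1 !scale1r -scalerAl => ->.
  by [].
have e1 := dP _ _ Paq Pb; have e2 := dP _ _ Pq Pb.
rewrite expr0 !scale1r in e1 e2; rewrite -[c * f - _]/(lie c f).
move: (lie c f) e1 e2 => q e1 e2.
by rewrite mulrBl -mulrA -e2 mulrA e1 mulrA subrr.
Qed.

End PartLines.

Lemma mul_comm_scale (F : fieldType) (U : algType F) (x y b : U) (k l : F) :
  x * y = k *: (y * x) -> x * b = l *: (b * x) -> x * (y * b) = (k * l) *: (y * b * x).
Proof.
move=> e1 e2; rewrite mulrA e1 -scalerAl -[y * x * b]mulrA e2 -scalerAr scalerA.
by rewrite mulrA.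
Qed.

(** * Sorting words into blocks of one type *)

Section Assembly.

Variables (F : fieldType) (charF0 : [pchar F] =i pred0).
Variables (gT : finGroupType) (A : gstar_algebra F gT).
Local Notation part := (@in_part F gT A).
Hypothesis parts_comm : forall t1 t2 : vtype gT, t1 <> t2 -> exists d : bool,
  forall x y, part t1 x -> part t2 y -> x * y = (-1) ^+ d *: (y * x).

Implicit Types (v : gvar gT -> A) (w : seq (gvar gT)) (t : vtype gT).

Definition eword v w : unitz A := \prod_(y <- w) (embed (v y) : unitz A).

Definition eblock v w t : unitz A := \prod_(y <- w | y.1 == t) (embed (v y) : unitz A).

Lemma admissible_part v y : admissible v -> part y.1 (embed (v y)).
Proof. by move=> av; split=> //; case: y => -[g e] i; apply: av. Qed.

Lemma eblock_cons v y w t : eblock v (y :: w) t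
  = if y.1 == t then (embed (v y) : unitz A) * eblock v w t else eblock v w t.
Proof. exact: big_cons. Qed.

Lemma eblock_comm y t w : t != y.1 -> exists d : bool, forall v, admissible v ->
  embed (v y) * eblock v w t = (-1) ^+ d *: (eblock v w t * embed (v y)).
Proof.
move=> nt; have [d dP] : exists d : bool, forall x z, part y.1 x -> part t z ->
    x * z = (-1) ^+ d *: (z * x).
  by apply: parts_comm => yt; rewrite yt eqxx in nt.
elim: w => [|z w [d' d'P]].
  by exists false => v _; rewrite /eblock big_nil mulr1 mul1r scale1r.
have [zt|nzt] := eqVneq z.1 t.
  exists (d (+) d') => v av; rewrite eblock_cons zt eqxx.
  rewrite signr_addb; apply: mul_comm_scale; last exact: d'P.
  by apply: dP; [| rewrite -zt]; apply: admissible_part.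
exists d' => v av; rewrite eblock_cons (negPf nzt); exact: d'P.
Qed.

Lemma eblocks_cons y w (ts : seq (vtype gT)) : uniq ts -> y.1 \in ts ->
  exists d : bool, forall v, admissible v ->
  embed (v y) * \prod_(t <- ts) eblock v w t
  = (-1) ^+ d *: \prod_(t <- ts) eblock v (y :: w) t.
Proof.
elim: ts => // t ts IHts /= /andP[nt uts]; rewrite inE => yts.
have [yt|nyt] := eqVneq y.1 t.
  exists false => v av; rewrite scale1r !big_cons mulrA.
  rewrite eblock_cons yt eqxx; congr (_ * _).
  apply: eq_big_seq => t' t'ts; rewrite eblock_cons yt ifN //.
  by apply: contraNneq nt => ->.
have [d dP] := @eblock_comm y t w ltac:(by rewrite eq_sym).
have [|d' d'P] := IHts uts; first by move: yts; rewrite (negPf nyt).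
exists (d (+) d') => v av; rewrite !big_cons mulrA dP // -scalerAl -mulrA d'P //.
rewrite -scalerAr scalerA signr_addb; congr (_ *: (_ * _)).
by rewrite eblock_cons (negPf nyt).
Qed.

(** The sign is the same for all evaluations; as renaming keeps types, it is also common to all
    renamings of w. *)
Lemma eword_blocks w : exists d : bool, forall v, admissible v ->
  eword v w = (-1) ^+ d *: \prod_t eblock v w t.
Proof.
elim: w => [|y w [d dP]].
  exists false => v _; rewrite /eword big_nil scale1r big1 // => t _.
  by rewrite /eblock big_nil.
have [d' d'P] := @eblocks_cons y w (index_enum (vtype gT))
  (index_enum_uniq _) (mem_index_enum _).
exists (d (+) d') => v av.
rewrite /eword big_cons -/(eword v w) dP // -scalerAr d'P //.
by rewrite scalerA signr_addb.
Qed.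

Variables (nn : vtype gT -> nat).

Definition type_vals v t : {ffun 'I_(nn t) -> unitz A} :=
  [ffun i => embed (v (t, val i))].

Lemma block_perm w t : w \in mwords nn -> exists s : 'S_(nn t),
  [seq y <- w | y.1 == t] = [seq (t, val (s i)) | i <- index_enum 'I_(nn t)].
Proof.
rewrite mem_permutations => pw; set wt := filter _ _.
have pwt : perm_eq wt [seq (t, i) | i <- iota 0 (nn t)].
  apply: uniq_perm; rewrite ?filter_uniq ?(perm_uniq pw) ?mvars_uniq //.
    by rewrite map_inj_uniq ?iota_uniq // => i j [].
  move=> [t' i]; rewrite mem_filter (perm_mem pw) mem_mvars /=.
  apply/andP/mapP => [[/eqP -> ltn]|[j + [-> ->]]]; rewrite ?mem_iota ?eqxx //.
  by exists i; rewrite ?mem_iota.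
have szw : size wt = nn t by rewrite (perm_size pwt) size_map size_iota.
pose f (i : 'I_(nn t)) : 'I_(nn t) :=
  insubd i (nth (t, 0%N) wt (index i (index_enum 'I_(nn t)))).2.
have szI : size (index_enum 'I_(nn t)) = nn t.
  by rewrite -[RHS]card_ord cardE enumT /index_enum unlock.
have ltI i : (index i (index_enum 'I_(nn t)) < size wt)%N.
  by rewrite szw -[X in (_ < X)%N]szI index_mem mem_index_enum.
have fE i : (t, val (f i)) = nth (t, 0%N) wt (index i (index_enum 'I_(nn t))).
  have := mem_nth (t, 0%N) (ltI i); rewrite (perm_mem pwt) => /mapP[j].
  rewrite mem_iota => /andP[_ ltj] ej; rewrite /f ej /=.
  by rewrite val_insubd ltj.
have f_inj : injective f.
  move=> i j fij; have := fE i; rewrite fij fE => /eqP.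
  rewrite nth_uniq // ?(perm_uniq pwt) ?map_inj_uniq ?iota_uniq //; last by move=> ? ? [].
  move/eqP=> eij; rewrite -[i](nth_index i (mem_index_enum i)) -eij.
  by rewrite nth_index // mem_index_enum.
exists (perm f_inj); apply: (@eq_from_nth _ (t, 0%N)) => [|k].
  by rewrite size_map szw szI.
rewrite szw => ltk; pose i0 : 'I_(nn t) := Ordinal ltk.
rewrite (nth_map i0) ?szI // permE fE index_uniq ?index_enum_uniq ?szI //.
Qed.

Variable la : multipart nn.
Local Notation e t := (tab_coyoung F (la t)).

(** Coefficients and sorted words both factor over the types, so the sum over the product group is a
    product of sums, each on a line by [part_line_ok]. *)
Lemma eword_line : exists Phi : (gvar gT -> A) -> unitz A, forall w, w \in mwords nn ->
  exists k, forall v, admissible v ->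
    \sum_s gprod (fun t => e t) s *: eword v (map (rename s) w) = k *: Phi v.
Proof.
have /fin_all_exists[Phi PhiP] t : exists Phi : {ffun 'I_(nn t) -> unitz A} -> unitz A,
    forall s, exists k, forall x : {ffun 'I_(nn t) -> unitz A},
    (forall i, part t (x i)) ->
    wact (@word1 F (unitz A) (nn t)) (gunit F s * e t) x = k *: Phi x.
  exact: (part_line_ok charF0 parts_comm).
exists (fun v => \prod_t Phi t (type_vals v t)) => w mw.
have [d dP] := eword_blocks w.
have /fin_all_exists[s sP] := fun t => block_perm t mw.
have /fin_all_exists[k kP] t := PhiP t (s t).
exists ((-1) ^+ d * \prod_t k t) => v av.
have part_vals t i : part t (type_vals v t i).
  by rewrite ffunE; apply: (@admissible_part v (t, val i)).
rewrite -scalerA -scaler_prod.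
transitivity ((-1) ^+ d *: \sum_(r : symprod nn) \prod_t
    (e t (r t) *: word1 (pperm (s t) (pperm (r t) (type_vals v t))))).
  rewrite scaler_sumr; apply: eq_bigr => r _.
  have ar : admissible (v \o rename r) by move=> g b i; apply: av.
  have -> : eword v (map (rename r) w) = eword (v \o rename r) w.
    by rewrite /eword big_map.
  rewrite dP // ffunE scaler_prod [LHS]scalerA mulrC -scalerA; congr (_ *: (_ *: _)).
  apply: eq_bigr => t _; rewrite /eblock -big_filter sP big_map.
  apply: eq_bigr => i _; rewrite !ffunE /=; congr (embed (v _)).
  by rewrite /rename /= valK.
congr (_ *: _); rewrite (sum_dffun_prod (fun t r => e t r *:
  word1 (pperm (s t) (pperm r (type_vals v t))))).
apply: eq_bigr => t _; rewrite -kP // wactM; apply: eq_bigr => r _.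
by rewrite wact_gunit.
Qed.

Hypothesis nn_gt0 : (0 < \sum_t nn t)%N.

Lemma mwords_neq0 w : w \in mwords nn -> w != [::].
Proof.
move=> mw; apply: contraL nn_gt0 => /eqP w0.
rewrite w0 mem_permutations perm_sym in mw; rewrite -leqNgt leqn0 sum_nat_eq0.
apply/forallP=> t; rewrite implyTb eqn0Ngt; apply/negP=> nt.
by have := mem_mvars nn (t, 0%N); rewrite (perm_mem mw) /= nt.
Qed.

Lemma mlpoly_identityP (u : 'rV[F]_(size (mwords nn))) :
  gstar_identity A (mlpoly u) <->
  (forall v, admissible v -> gpoly_eval v (mlpoly u) = 0).
Proof.
split=> [[] //|uI]; split=> //; rewrite mlpoly_coef1 big1 // => i _.
by rewrite (negPf (mwords_neq0 (mword_in i))) mulr0.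
Qed.

Local Notation N := (size (mwords nn)).
Local Notation U := (mlidentities A nn).
Local Notation E := (galg_mx (mlpoly_repr F nn) (gprod (fun t => e t))).

Lemma gpoly_eval_mul_E v (u : 'rV[F]_N) :
  embed (gpoly_eval v (mlpoly (u *m E)))
  = \sum_i u 0 i *: \sum_s gprod (fun t => e t) s *: eword v (map (rename s) (mword i)).
Proof.
have embed_sum (I : Type) (r : seq I) (f : I -> A) :
    embed (\sum_(i <- r) f i) = \sum_(i <- r) embed (f i) :> unitz A.
  elim: r => [|i r IHr]; first by rewrite !big_nil.
  by rewrite !big_cons -IHr -[f i]scale1r embed_lin !scale1r.
have embedZ k a : embed (k *: a) = k *: (embed a : unitz A).
  by rewrite -[k *: a]addr0 embed_lin addr0.
rewrite gpoly_eval_mlpoly.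
transitivity (embed (\sum_s gprod (fun t => e t) s *:
    \sum_i (u *m mlpoly_mx F s) 0 i *: word_eval v (mword i))).
  congr embed; rewrite /galg_mx mulmx_sumr.
  under eq_bigr => i _ do rewrite summxE scaler_suml.
  rewrite exchange_big; apply: eq_bigr => s _ /=; rewrite scaler_sumr.
  by apply: eq_bigr => i _; rewrite -scalemxAr mxE scalerA.
rewrite embed_sum; under eq_bigr => s _ do
  rewrite embedZ (sum_mlpoly_mx s u (word_eval v)) embed_sum scaler_sumr.
rewrite exchange_big; apply: eq_bigr => i _ /=.
rewrite scaler_sumr; apply: eq_bigr => s _.
rewrite embedZ word_eval_embed ?scalerA ?[_ * u 0 i]mulrC //.
by apply: mwords_neq0; apply: mwords_rename; apply: mword_in.
Qed.

(** Row i of the matrix evaluates to [k i] times a common function of v. A row that is not an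
    identity has [k i] nonzero, and modulo identities all rows are multiples of it. *)
Lemma rank_coyoung_leq1 : (\rank (galg_mx (mlquotient_repr A nn) (gprod (fun t => e t))) <= 1)%N.
Proof.
have [Phi PhiP] := eword_line.
have /fin_all_exists[k kP] (i : 'I_N) := PhiP _ (mword_in i).
have rowE i v : admissible v -> embed (gpoly_eval v (mlpoly (row i E))) = k i *: Phi v.
  move=> av; rewrite rowE gpoly_eval_mul_E (bigD1 i) //= mxE !eqxx scale1r kP //.
  rewrite big1 ?addr0 // => j /negPf nj; rewrite mxE eqxx /= nj.
  exact: scale0r.
pose B := in_factmod U E.
have -> : galg_mx (mlquotient_repr A nn) (gprod (fun t => e t)) = val_factmod 1%:M *m B.
  have -> : galg_mx (mlquotient_repr A nn) (gprod (fun t => e t))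
      = in_factmod U (val_factmod 1%:M *m E).
    rewrite /galg_mx mulmx_sumr linear_sum; apply: eq_bigr => s _ /=.
    rewrite -scalemxAr linearZ /=; congr (_ *: _).
  by rewrite /B [in LHS]in_factmodE [in RHS]in_factmodE mulmxA.
apply: leq_trans (mxrankM_maxr _ _) _.
have rowB i : row i B = in_factmod U (row i E).
  by rewrite /B in_factmodE row_mul -in_factmodE.
have [allU|] := boolP [forall i, (row i E <= U)%MS].
  suff -> : B = 0 by rewrite mxrank0.
  apply/row_matrixP => i; rewrite rowB row0; apply/eqP; rewrite in_factmod_eq0.
  exact: (forallP allU).
rewrite negb_forall => /existsP[i0 ni0].
apply: leq_trans (rank_leq_row (row i0 B)); apply: mxrankS; apply/row_subP => j.
have nk : k i0 != 0.
  apply: contraNneq ni0 => k0; apply/mlidentitiesP/mlpoly_identityP => v av.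
  by have /(congr1 snd) := rowE i0 v av; rewrite k0 scale0r.
pose c := k j / k i0.
have : (row j E - c *: row i0 E <= U)%MS.
  apply/mlidentitiesP/mlpoly_identityP => v av.
  rewrite linearB linearZ /= linearB linearZ /=.
  have ej := congr1 snd (rowE j v av); have ei := congr1 snd (rowE i0 v av).
  rewrite /= in ej ei; rewrite ej ei scalerA /c divfK // subrr //.
rewrite -in_factmod_eq0 linearB linearZ /= -!rowB subr_eq0 => /eqP ->.
exact: scalemx_sub.
Qed.

End Assembly.

(** * Identities in two variables as relations between parts *)

Section Evaluation.

Variables (F : fieldType) (gT : finGroupType) (A : gstar_algebra F gT).

Lemma gpoly_eval_word (v : gvar gT -> A) (k : {fmonom gvar gT}) :
  gpoly_eval v (<< k >> : gpoly F gT) = word_eval v k.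
Proof.
have s : (msupp (<< k >> : gpoly F gT) `<=` [fset k])%fset by exact: msuppU_le.
by rewrite (gpoly_evalEw v s) big_seq_fset1 mcoeffUU scale1r.
Qed.

Lemma gpoly_eval_words (v : gvar gT -> A) (k k' : {fmonom gvar gT}) (alpha : F) :
  gpoly_eval v ((<< k >> : gpoly F gT) + alpha *: << k' >>)
  = word_eval v k + alpha *: word_eval v k'.
Proof. by rewrite addrC gpoly_eval_is_linear !gpoly_eval_word addrC. Qed.

Lemma gpoly_coef1 (k k' : {fmonom gvar gT}) (alpha : F) :
    k != @fmone _ -> k' != @fmone _ ->
  ((<< k >> : gpoly F gT) + alpha *: << k' >>)@_(@fmone _) = 0.
Proof.
move=> /negPf nk /negPf nk'.
by rewrite mcoeffD mcoeffZ !mcoeffU1 nk nk' mulr0 addr0.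
Qed.

Lemma gX_mulE (g h : gT) (e1 e2 : bool) i j : gX F g e1 i * gX F h e2 j
  = << FMonom [:: (((g, e1), i) : gvar gT); ((h, e2), j)] >>.
Proof.
rewrite /gX malgM_def fgmulUU mulr1; congr (<< _ *g _ >>).
by apply/eqP; rewrite fmP fmM !fmU.
Qed.

Lemma homog_star g e (a : A) : homog_part g e a -> gsa_star a = (-1) ^+ e *: a.
Proof. by case. Qed.

Lemma gX_identityP (g h : gT) (e1 e2 : bool) (alpha : F) :
  gstar_identity A
    (gX F g e1 1 * gX F h e2 2 + alpha *: (gX F h e2 2 * gX F g e1 1)) <->
  (forall a b : A, homog_part g e1 a -> homog_part h e2 b ->
     gsa_mul a b + alpha *: gsa_mul b a = 0).
Proof.
rewrite !gX_mulE; split=> [[_ fI] a b Aa Ab|fI].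
  pose v (x : gvar gT) : A := if x == ((g, e1), 1%N) then a
    else if x == ((h, e2), 2%N) then b else 0.
  have av : admissible v.
    move=> g' e' i; rewrite /v; case: eqP => [[-> -> _]//|_].
    by case: eqP => [[-> -> _]//|_]; apply: homog_part0.
  have := fI v av; rewrite gpoly_eval_words /=.
  have -> : v ((g, e1), 1%N) = a by rewrite /v eqxx.
  have -> : v ((h, e2), 2%N) = b by rewrite /v eqxx; case: eqP => // -[].
  by [].
split=> [|v av].
  by apply: gpoly_coef1; rewrite fmP fm1.
by rewrite gpoly_eval_words /= fI.
Qed.

Lemma parts_comm_of_identity (t1 t2 : vtype gT) (alpha : F) :
    alpha \in [:: 0; 1; -1] ->
    (forall a b : A, homog_part t1.1 t1.2 a -> homog_part t2.1 t2.2 b ->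
       gsa_mul a b + alpha *: gsa_mul b a = 0) ->
  exists d : bool, forall x y : unitz A, in_part t1 x -> in_part t2 y ->
    x * y = (-1) ^+ d *: (y * x).
Proof.
move=> al ab; exists (alpha == 1) => x y Px Py.
have [_ hx] := Px; have [_ hy] := Py; rewrite (in_part_embed Px) (in_part_embed Py).
have embedZ k (a : A) : k *: (embed a : unitz A) = embed (k *: a).
  by congr pair; rewrite /= [k *: 0]scaler0.
rewrite !embedM embedZ; congr embed; have := ab _ _ hx hy.
move: al; rewrite !inE => /or3P[] /eqP->; rewrite ?eqxx.
(* For alpha = 0 the involution turns ab = 0 into ba = 0, so the sign is immaterial. *)
- rewrite scale0r addr0 => xy0; rewrite xy0 eq_sym oner_eq0 expr0 scale1r.
  have /eqP := congr1 (@gsa_star F gT A) xy0.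
  rewrite gsa_star0 gsa_starM (homog_star hx) (homog_star hy).
  rewrite gsa_mulZl gsa_mulZr scalerA scaler_eq0 -signr_addb signr_eq0 /=.
  by move/eqP.
- by rewrite scale1r expr1 scaleN1r => /eqP; rewrite addr_eq0 => /eqP.
rewrite scaleN1r => /eqP; rewrite subr_eq0 => /eqP ->.
(* If -1 = 1 in F, then alpha = -1 also satisfies [alpha == 1], and the two signs agree. *)
have [e|_] := eqVneq (-1 : F) 1; last by rewrite expr0 scale1r.
by rewrite expr1 e scale1r.
Qed.

Lemma identity_of_relation (t1 t2 : vtype gT) (p q : F) :
    (p != 0) || (q != 0) ->
    (forall a b : A, homog_part t1.1 t1.2 a -> homog_part t2.1 t2.2 b ->
       p *: gsa_mul a b + q *: gsa_mul b a = 0) ->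
  exists2 alpha : F, alpha \in [:: 0; 1; -1] &
    forall a b : A, homog_part t1.1 t1.2 a -> homog_part t2.1 t2.2 b ->
       gsa_mul a b + alpha *: gsa_mul b a = 0.
Proof.
move=> npq pq.
have qp (a b : A) : homog_part t1.1 t1.2 a -> homog_part t2.1 t2.2 b ->
    q *: gsa_mul a b + p *: gsa_mul b a = 0.
  move=> ha hb; have /eqP := congr1 (@gsa_star F gT A) (pq a b ha hb).
  rewrite gsa_starD !gsa_starZ gsa_star0 !gsa_starM (homog_star ha) (homog_star hb).
  rewrite !(gsa_mulZl, gsa_mulZr) !scalerA.
  have -> : p * (-1) ^+ t2.2 * (-1) ^+ t1.2 = (-1) ^+ t1.2 * (-1) ^+ t2.2 * p.
    by rewrite mulrC [p * _]mulrC mulrA.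
  have -> : q * (-1) ^+ t1.2 * (-1) ^+ t2.2 = (-1) ^+ t1.2 * (-1) ^+ t2.2 * q.
    by rewrite -mulrA mulrC.
  rewrite -!(scalerA _ _ (gsa_mul _ _)) -scalerDr scaler_eq0 -signr_addb signr_eq0 /=.
  by rewrite addrC => /eqP.
have [pq0|npq0] := eqVneq (p + q) 0.
  exists (-1) => [|a b ha hb]; first by rewrite !inE eqxx !orbT.
  have ep : p = - q by apply/eqP; rewrite -addr_eq0 pq0.
  have nq : q != 0 by move: npq; rewrite ep oppr_eq0 orbb.
  apply/eqP; rewrite scaleN1r; have /eqP := pq a b ha hb.
  by rewrite ep scaleNr addrC -scalerBr scaler_eq0 (negPf nq) /= -opprB oppr_eq0.
exists 1 => [|a b ha hb]; first by rewrite !inE eqxx orbT.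
have /eqP : (p + q) *: (gsa_mul a b + gsa_mul b a) = 0.
  rewrite scalerDr !scalerDl addrACA -[RHS]addr0 -{2}(qp a b ha hb) -(pq a b ha hb).
  by rewrite -!addrA; congr (_ + _); rewrite addrCA [p *: _ + _]addrC addrCA.
by rewrite scaler_eq0 (negPf npq0) scale1r /= => /eqP.
Qed.

End Evaluation.

Lemma intpart_small_eq n (la mu : intpart n) : (n <= 1)%N -> la = mu.
Proof.
case: n la mu => [|[|//]] la mu _; apply: val_inj; first exact: etrans (tuple0 _) (esym (tuple0 _)).
have one (nu : intpart 1) : tnth (val nu) ord0 = ord_max.
  apply: val_inj; have := shape_sumn nu; rewrite /shape_of -[val nu]/(intpart_val nu).
  case: (intpart_val nu) => -[|a [|b s]] //= sz.
  by rewrite (tnth_nth a) /= addn0.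
by apply: eq_from_tnth => i; rewrite (ord1 i) !one.
Qed.

(** The Specht module lies in the group algebra, whose dimension n! is 1 here. *)
Lemma sym_char1_small (F : fieldType) n (la : intpart n) : (n <= 1)%N ->
  exists2 d : nat, sym_char F la 1%g = d%:R & (d <= 1)%N.
Proof.
move=> n1; exists (\rank (specht_mx F la)).
  by rewrite /sym_char repr_mx1 mxtrace1.
apply: leq_trans (rank_leq_row _) _; suff : (#|[set: 'S_n]| <= 1)%N by [].
by rewrite cardsT card_Sn; case: n n1 {la} => [|[]].
Qed.

(** * Multiplicities in two variables *)

Section Forward.

Variables (F : fieldType) (charF0 : [pchar F] =i pred0).
Variables (gT : finGroupType) (A : gstar_algebra F gT).
Variables (t1 t2 : vtype gT).
Hypothesis nt12 : t1 != t2.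

Let nn (t : vtype gT) : nat := (t == t1) + (t == t2).
Let x1 : gvar gT := (t1, 0%N).
Let x2 : gvar gT := (t2, 0%N).

Lemma two_vars_gt0 : (0 < \sum_t nn t)%N.
Proof. by rewrite (bigD1 t1) //= /nn eqxx. Qed.

Lemma two_vars_small t : (nn t <= 1)%N.
Proof.
rewrite /nn; have [->|_] := eqVneq t t1; first by rewrite (negPf nt12).
by case: (t == t2).
Qed.

Lemma mvars_two : perm_eq (mvars nn) [:: x1; x2].
Proof.
apply: uniq_perm; rewrite ?mvars_uniq //=.
  by rewrite inE andbT xpair_eqE eqxx andbT.
move=> [t i]; rewrite mem_mvars /= !inE !xpair_eqE /nn.
have [->|nt1] := eqVneq t t1; first by rewrite (negPf nt12) orbF addn0 ltnS leqn0.
by rewrite add0n; case: eqVneq => // _; rewrite ltnS leqn0.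
Qed.

Lemma mwords_two w : (w \in mwords nn) = (w == [:: x1; x2]) || (w == [:: x2; x1]).
Proof.
rewrite mem_permutations (permPr mvars_two).
have nx : x1 != x2 by rewrite xpair_eqE eqxx andbT.
apply/idP/orP => [pw|[] /eqP->]; [| exact: perm_refl | by rewrite (perm_catC [:: x2] [:: x1])].
have := perm_size pw; case: w pw => [|a [|b [|//]]] // pw _.
have ua : uniq [:: a; b] by rewrite (perm_uniq pw) /= inE nx.
have := perm_mem pw a; have := perm_mem pw b; rewrite !inE !eqxx ?orbT ?orTb.
move=> /esym/orP eb /esym/orP ea; case: eb ea ua => /eqP-> [] /eqP->.
- by rewrite /= inE eqxx.
- by right.
- by left.
by rewrite /= inE eqxx.
Qed.

Lemma small_quotient_relation : (\rank (cokermx (mlidentities A nn)) <= 1)%N ->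
  exists p q : F, ((p != 0) || (q != 0)) /\
    forall a b : A, homog_part t1.1 t1.2 a -> homog_part t2.1 t2.2 b ->
       p *: gsa_mul a b + q *: gsa_mul b a = 0.
Proof.
move=> rk; have nx : x1 != x2 by rewrite xpair_eqE eqxx andbT.
have [i1 e1] : {i : 'I_(size (mwords nn)) | mword i = [:: x1; x2]}.
  by apply: mwordP; rewrite mwords_two eqxx.
have [i2 e2] : {i : 'I_(size (mwords nn)) | mword i = [:: x2; x1]}.
  by apply: mwordP; rewrite mwords_two eqxx orbT.
have ni : i1 != i2.
  apply/eqP=> ei; apply/negP: nx; rewrite negbK; move: e1; rewrite ei e2 => /eqP.
  by rewrite eqseq_cons eq_sym => /andP[].
have Ui i : (i == i1) || (i == i2).
  have := mword_in i; rewrite mwords_two -e1 -e2.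
  by case/orP=> /eqP/mword_inj->; rewrite eqxx ?orbT.
have N2 : (1 < size (mwords nn))%N.
  rewrite -[X in (_ < X)%N]card_ord; apply/card_gt1P.
  by exists i1, i2.
(* Two words but a quotient of dimension at most 1: some nonzero row is an identity, and its two
   coordinates are p and q. *)
pose u := nz_row (mlidentities A nn).
have nu : u != 0.
  rewrite nz_row_eq0 -mxrank_eq0; apply: contraL N2 => /eqP r0.
  by rewrite -leqNgt; move: rk; rewrite mxrank_coker r0 subn0.
exists (u 0 i1), (u 0 i2); split=> [|a b ha hb].
  rewrite -negb_and; apply: contraNN nu => /andP[/eqP u1 /eqP u2].
  apply/eqP/rowP=> i; rewrite mxE.
  by case/orP: (Ui i) => /eqP->.
have /mlidentitiesP[_ uI] := nz_row_sub (mlidentities A nn).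
pose v (x : gvar gT) : A := if x == x1 then a else if x == x2 then b else 0.
have av : admissible v.
  move=> g e i; rewrite /v; case: eqP => [[E _]|_]; first by move: ha; rewrite -E.
  by case: eqP => [[E _]|_]; [move: hb; rewrite -E | apply: homog_part0].
have := uI v av; rewrite gpoly_eval_mlpoly (bigD1 i1) //= (bigD1 i2) 1?eq_sym //=.
rewrite big1 ?addr0 => [|i /andP[/negPf n1 /negPf n2]]; last first.
  by have := Ui i; rewrite n1 n2.
by rewrite e1 e2 /= /v !eqxx eq_sym (negPf nx).
Qed.

(** At the identity the character is the dimension. Each type has at most one variable, so any two
    multipartitions agree and the degree is at most 1. *)
Lemma small_multiplicity_quotient (m : multipart nn -> nat) :
    (forall s, cocharacter A s = \sum_la (m la)%:R * multi_char F la s) ->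
    (forall la, m la <= 1)%N ->
  (\rank (cokermx (mlidentities A nn)) <= 1)%N.
Proof.
move=> /(_ 1%g); rewrite /cocharacter repr_mx1 mxtrace1 => tr1 m1.
have eqla (la mu : multipart nn) : la = mu.
  by apply/ffunP=> t; apply: intpart_small_eq; apply: two_vars_small.
have charP (la : multipart nn) : exists2 d : nat,
    multi_char F la 1%g = d%:R & (d <= 1)%N.
  have /fin_all_exists2[d dE d1] := fun t => sym_char1_small F (la t) (two_vars_small t).
  exists (\prod_t d t)%N.
    rewrite natr_prod; apply: eq_bigr => t _; rewrite -dE; congr sym_char.
    by rewrite ffunE.
  by elim/big_ind: _ => // x y; case: x => [|[]] // ; case: y => [|[]].
rewrite leqNgt; apply/negP=> rk; have [la _|nola] := pickP (fun _ : multipart nn => true).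
  have [d dE d1] := charP la; move: tr1; rewrite (bigD1 la) //= big1 => [|mu]; last first.
    by rewrite (eqla mu la) eqxx.
  rewrite addr0 dE -natrM => /(natr_charf0_inj charF0) rE.
  by move: rk; rewrite rE ltnNge (leq_trans (leq_mul (m1 la) d1)).
move: tr1; rewrite big1 => [|la _]; last by have := nola la.
by move/(natr_charf0_inj charF0 (b := 0)) => rE; rewrite rE in rk.
Qed.

End Forward.

Theorem theorem6p12 (F : fieldType) (charF0 : [pchar F] =i pred0)
    (gT : finGroupType) (abelG : abelian [set: gT])
    (A : gstar_algebra F gT)
    (m : forall nn : vtype gT -> nat, multipart nn -> nat)
    (cochar_m : forall nn : vtype gT -> nat, (0 < \sum_t nn t)%N ->
       forall s : symprod nn,
         cocharacter A s
           = \sum_(la : multipart nn) (m nn la)%:R * multi_char F la s) :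
  (forall nn : vtype gT -> nat, (0 < \sum_t nn t)%N ->
     forall la : multipart nn, (m nn la <= 1)%N)
  <->
  (forall (g h : gT) (e1 e2 : bool), g <> h ->
     exists2 alpha : F, alpha \in [:: 0; 1; -1] &
       gstar_identity A
         (gX F g e1 1 * gX F h e2 2 + alpha *: (gX F h e2 2 * gX F g e1 1)))
  /\
  (forall g : gT,
     exists2 beta : F, beta \in [:: 0; 1; -1] &
       gstar_identity A
         (gX F g false 1 * gX F g true 2
            + beta *: (gX F g true 2 * gX F g false 1))).
Proof.
split=> [m1|[idi idii] nn nn_gt0 la].
  have rel g h (e1 e2 : bool) : ((g, e1) : vtype gT) != (h, e2) ->
      exists2 alpha : F, alpha \in [:: 0; 1; -1] &
      gstar_identity A
        (gX F g e1 1 * gX F h e2 2 + alpha *: (gX F h e2 2 * gX F g e1 1)).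
    move=> nt; have gt0 := two_vars_gt0 ((g, e1) : vtype gT) (h, e2).
    have rk := small_multiplicity_quotient charF0 nt (cochar_m _ gt0) (m1 _ gt0).
    have [p [q [npq pq]]] := small_quotient_relation nt rk.
    have [alpha al ab] := identity_of_relation npq pq.
    by exists alpha => //; apply/gX_identityP.
  split=> [g h e1 e2 ngh|g]; apply: rel; rewrite xpair_eqE ?andbF //.
  by rewrite negb_and; apply/orP; left; apply/eqP.
apply: leq_trans (multiplicity_leq_rank charF0 (cochar_m nn nn_gt0) la) _.
apply: rank_coyoung_leq1 => // -[g e1] [h e2] nt.
have [egh|/eqP ngh] := eqVneq g h; last first.
  have [alpha al /gX_identityP ab] := idi g h e1 e2 ngh.
  exact: (@parts_comm_of_identity _ _ A (g, e1) (h, e2) alpha).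
subst h; have [beta bl /gX_identityP ab] := idii g.
have [d dP] := @parts_comm_of_identity _ _ A (g, false) (g, true) beta bl ab.
(* Only the symmetric and the skew part of degree g remain, in either order. *)
exists d; case: e1 e2 nt => [] [] nt x y Px Py; try by case: nt.
  by rewrite (dP y x) // scalerA -expr2 sqrr_sign scale1r.
exact: dP.
Qed.
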